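(* For every integer $n \geq 6$, the graph $G(n,n,n)$ has a nonorientable quadrangular embedding.
   Context: For nonnegative integers $m,n,k$ with $k \le \min(m,n)$, $G(m,n,k)$ denotes the nearly complete bipartite graph obtained from the complete bipartite graph $K_{m,n}$ (with $m$ white vertices and $n$ black vertices) by deleting $k$ pairwise independent edges (a matching of size $k$); thus $G(n,n,n)$ is $K_{n,n}$ minus a perfect matching. An embedding of a graph in a closed surface is cellular if every face is an open disk; a quadrangular embedding is a cellular embedding in which every face is bounded by a closed walk of length 4. A nonorientable quadrangular embedding is a quadrangular embedding in a nonorientable closed surface. *)

(* Defs.v *)
From HB Require Import structures.
From mathcomp Require Import all_boot all_order all_algebra.
From mathcomp Require Import all_classical all_reals all_analysis.

Set Implicit Arguments.
Unset Strict Implicit.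
Unset Printing Implicit Defensive.

Import Order.TTheory GRing.Theory Num.Theory.
Import numFieldNormedType.Exports.

Local Open Scope classical_set_scope.
Local Open Scope ring_scope.

Record sgraph := SGraph {
  vertex :> finType;
  adj : rel vertex;
  adj_sym : symmetric adj;
  adj_irr : irreflexive adj }.

(* White vertices are [inl i], black vertices are [inr j]; the deleted matching
   consists of the edges joining [inl i] and [inr i] for [i < k], so [k] is
   meant to be at most [minn m n]. *)
Definition ncb_adj (m n k : nat) : rel ('I_m + 'I_n) := fun x y =>
  match x, y with
  | inl i, inr j | inr j, inl i => ~~ ((i == j :> nat) && (i < k)%N)
  | _, _ => false
  end.

Lemma ncb_adj_sym m n k : symmetric (@ncb_adj m n k).
Proof. by case=> [i|j] [i'|j']. Qed.

Lemma ncb_adj_irr m n k : irreflexive (@ncb_adj m n k).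
Proof. by case. Qed.

Definition G (m n k : nat) : sgraph :=
  SGraph (@ncb_adj_sym m n k) (@ncb_adj_irr m n k).

Definition homeo_on (T U : topologicalType) (A : set T) (B : set U)
    (f : T -> U) : Prop :=
  exists g : U -> T,
    [/\ {within A, continuous f}, {within B, continuous g},
        forall x, A x -> B (f x) /\ g (f x) = x
      & forall y, B y -> A (g y) /\ f (g y) = y].

Definition homeomorphic (T U : topologicalType) (A : set T) (B : set U) : Prop :=
  exists f : T -> U, homeo_on A B f.

Definition unit_disk (R : realType) : set (R * R) :=
  [set p | p.1 ^+ 2 + p.2 ^+ 2 < 1].

Definition closed_square (R : realType) : set (R * R) := `[0, 1] `*` `[0, 1].

Definition open_square (R : realType) : set (R * R) := `]0, 1[ `*` `]0, 1[.

Definition open_disk (R : realType) (S : topologicalType) (U : set S) : Prop :=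
  homeomorphic (@unit_disk R) U.

(* Second countability is omitted: it follows from compactness and local
   planarity. *)
Definition closed_surface (R : realType) (S : topologicalType) : Prop :=
  [/\ compact [set: S], hausdorff_space S, connected [set: S]
    & forall x : S, exists U : set S, [/\ open U, U x & open_disk R U]].

(* [f] induces an injective continuous map, hence (when [S] is Hausdorff) an
   embedding, of the Moebius band, presented as [0, 1] x [-1, 1] with (0, y)
   glued to (1, -y). *)
Definition moebius_band (R : realType) (S : topologicalType)
    (f : R * R -> S) : Prop :=
  let D : set (R * R) := `[0, 1] `*` `[-1, 1] in
  {within D, continuous f} /\
  forall p q, D p -> D q ->
    (f p = f q <-> [\/ p = q,
                       [/\ p.1 = 0, q.1 = 1 & q.2 = - p.2]
                     | [/\ p.1 = 1, q.1 = 0 & q.2 = - p.2]]).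

(* For closed surfaces only: nonorientability is containing a Moebius band. *)
Definition nonorientable (R : realType) (S : topologicalType) : Prop :=
  exists f : R * R -> S, moebius_band f.

(* [pt v] is the point representing the vertex [v]; for adjacent [u] and [v],
   [arc u v] parametrizes by [0, 1], from [pt u] to [pt v], the arc representing
   the edge uv.  Each edge carries two parametrizations, [arc u v] and its
   reverse [arc v u]; [arc u v] is irrelevant when [u] and [v] are not
   adjacent. *)
Record embedding (R : realType) (S : topologicalType) (H : sgraph)
    (pt : H -> S) (arc : H -> H -> R -> S) : Prop := Embedding {
  pt_inj : injective pt;
  arc_continuous : forall u v, adj u v -> {within `[0, 1], continuous (arc u v)};
  arc_start : forall u v, adj u v -> arc u v 0 = pt u;
  arc_end : forall u v, adj u v -> arc u v 1 = pt v;
  arc_reverse : forall u v t, adj u v -> 0 <= t <= 1 ->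
    arc v u t = arc u v (1 - t);
  arc_vertex : forall u v w t, adj u v -> 0 < t < 1 -> arc u v t <> pt w;
  arc_disjoint : forall u v u' v' s t, adj u v -> adj u' v' ->
    0 < s < 1 -> 0 < t < 1 -> arc u v s = arc u' v' t ->
    [/\ u = u', v = v' & s = t] \/ [/\ u = v', v = u' & s = 1 - t] }.

Section Faces.
Variables (R : realType) (S : topologicalType) (H : sgraph).
Variables (pt : H -> S) (arc : H -> H -> R -> S).

Definition drawing : set S :=
  range pt `|` [set x | exists u v t, [/\ adj u v, 0 <= t <= 1 & x = arc u v t]].

Definition face (F : set S) : Prop :=
  exists2 x, (~` drawing) x & F = connected_component (~` drawing) x.

Definition cellular : Prop := forall F, face F -> open_disk R F.

(* The closed walk a b c d a bounds [F]: a closed square maps continuously into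
   the surface, its interior homeomorphically onto [F], while its boundary runs
   once along the walk.  Vertices and edges of the walk may be repeated. *)
Definition bounded_by (F : set S) (a b c d : H) : Prop :=
  [/\ adj a b, adj b c, adj c d & adj d a] /\
  exists h : R * R -> S,
    [/\ {within @closed_square R, continuous h},
        homeo_on (@open_square R) F h
      & forall t, 0 <= t <= 1 ->
          [/\ h (t, 0) = arc a b t, h (1, t) = arc b c t,
              h (1 - t, 1) = arc c d t & h (0, 1 - t) = arc d a t]].

Definition quadrangular : Prop :=
  cellular /\ forall F, face F -> exists a b c d, bounded_by F a b c d.

End Faces.

Definition has_nonorientable_quadrangular_embedding (R : realType) (H : sgraph)
    : Prop :=
  exists S : topologicalType,
    [/\ closed_surface R S, nonorientable R S
      & exists (pt : H -> S) (arc : H -> H -> R -> S),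
          embedding pt arc /\ quadrangular pt arc].

(* Main.v *)
Require Import Defs.
From mathcomp Require Import all_boot all_order all_algebra.
From mathcomp Require Import all_classical all_reals all_analysis.
From mathcomp Require Import zify ring lra.

(* A cellular quadrangulation is given by the set of its faces together with, at
   each vertex, the cyclic order of the neighbours.  Coning every face from its
   centre turns it into a simplicial complex, realized here by barycentric
   coordinates: the surface is a subspace of a product of lines (hence Hausdorff),
   it is a finite union of triangles (hence compact), and the open star of a node
   is an open cone over its link, a cycle, hence an open disk.  A strip of
   triangles that closes up with a twist is a Moebius band.

   Faces for [G n n n]: for odd [n = 2 h + 1], colour classes are indexed by the
   residues mod [n] and the faces are invariant under translation, an edge being
   labelled by the difference of its ends.  In label order, the white rotation is
   h+1, ..., 2h, h, ..., 1; pairing white corners [x, x+1] and [y, y+1] into the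
   faces makes [x, y] and [x+1, y+1] corners of the black rotation, and suitable
   pairings make it a single cycle.  For even [n = 2 h + 2] a point at infinity is
   added to both colours, one orbit of faces being split into two.  The orders 6, 7
   and 8 are explicit. *)

Set Implicit Arguments.
Unset Strict Implicit.
Unset Printing Implicit Defensive.

Import Order.TTheory GRing.Theory Num.Theory.
Import numFieldNormedType.Exports.

Local Open Scope classical_set_scope.
Local Open Scope ring_scope.

(** Write [x, y] for two consecutive labels of the white rotation. It leaves the natural order of
    labels only at [2h, h] and [1, h + 1]. These two corners fit into one face because 1 + 2h = h +
    (h + 1), and that face makes 1, h and also h + 1, 2h consecutive at black vertices. If every
    other corner were paired with a neighbouring one inside 1, ..., h or inside h + 1, ..., 2h, the
    black labels would close up into two separate cycles, one for each half. So some pairs must be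
    mixed, joining a corner of the lower half to one of the upper half. Each half has h - 1 corners:
    one mixed pair suffices for even h, while for odd h two are used, and the extra pair 1, 3 ties
    the loose ends into a single cycle.

    Infinity is placed between 2h - 2 and 2h - 1 at white vertices, and between 2h - 1 and 2h at
    black ones. The two new orbits of faces take over exactly the corners of the discarded pair 2h -
    2, 2h - 1, so the rest of both rotations stays as it was. *)

Section Limits.
Context {R : realType} {T : Type} {F : set_system T} {FF : Filter F}.

Lemma cvg_min (f g : T -> R) a b : f @ F --> a -> g @ F --> b ->
  Num.min (f x) (g x) @[x --> F] --> Num.min a b.
Proof.
move=> fa gb; rewrite minr_absE.
under eq_fun do rewrite minr_absE.
apply: cvgM; last exact: cvg_cst.
by apply: cvgB; [exact: cvgD | apply: cvg_norm; exact: cvgB].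
Qed.

Lemma cvg_max (f g : T -> R) a b : f @ F --> a -> g @ F --> b ->
  Num.max (f x) (g x) @[x --> F] --> Num.max a b.
Proof.
move=> fa gb; rewrite maxr_absE.
under eq_fun do rewrite maxr_absE.
apply: cvgM; last exact: cvg_cst.
by apply: cvgD; [exact: cvgD | apply: cvg_norm; exact: cvgB].
Qed.

Lemma cvg_sumr (I : Type) (s : seq I) (P : pred I) (f : I -> T -> R) (a : I -> R) :
  (forall i, P i -> f i @ F --> a i) ->
  \sum_(i <- s | P i) f i x @[x --> F] --> \sum_(i <- s | P i) a i.
Proof.
move=> fa; elim: s => [|i s IHs].
  rewrite big_nil; under eq_fun do rewrite big_nil; exact: cvg_cst.
rewrite big_cons; under eq_fun do rewrite big_cons.
case: ifP => // Pi; apply: cvgD => //; exact: fa.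
Qed.

Lemma cvg_pairR (f g : T -> R) a b : f @ F --> a -> g @ F --> b ->
  (fun x => (f x, g x)) @ F --> ((a, b) : (R * R)%type).
Proof. by move=> fa gb; exact: (cvg_pair fa gb). Qed.

End Limits.

(** * Subspaces of a product of lines *)

Section Coordinates.
Variables (R : realType) (N : eqType) (X : set {ptws N -> R}).

Lemma coord_continuous v : continuous (fun x : X => set_val x v).
Proof.
move=> x; apply: (@continuous_comp _ _ _ (set_val : X -> _) (fun g => g v)).
  exact: initial_continuous.
exact: (@proj_continuous N (fun=> R) v).
Qed.

(** Two initial topologies are stacked here, the subspace topology and the product topology; both
    are tested on coordinates. *)
Lemma cvg_coordP T (F : set_system T) (f : T -> X) (x : X) : Filter F ->
  (forall v, set_val (f t) v @[t --> F] --> set_val x v) -> f @ F --> x.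
Proof.
move=> FF fx.
have : set_val \o f @ F --> (set_val x : {ptws N -> R}).
  apply/cvg_sup => v A [_ /= [[B Bo <-] Bx] BA].
  by apply: filterS BA _; apply: fx; exact: open_nbhs_nbhs.
move=> cf A [_ /= [[B Bo <-] Bx] BA].
by apply: filterS BA _; apply: cf; exact: open_nbhs_nbhs.
Qed.

Lemma coord_hausdorff : hausdorff_space X.
Proof.
have hN : hausdorff_space {ptws N -> R}.
  exact: (@hausdorff_product N (fun=> R)) => ?; exact: Rhausdorff.
move=> x y xy; apply: val_inj => /=.
apply: hN => A B Ax By.
have [z [Az Bz]] := xy _ _ (@initial_continuous _ _ (set_val : X -> _) x _ Ax)
  (@initial_continuous _ _ (set_val : X -> _) y _ By).
by exists (set_val z).
Qed.

(** A total map into the subtype, with the dummy value [x0] outside [X], so that explicit formulas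
    can be used as maps into the surface. *)
Definition to_cplx (x0 : X) (g : N -> R) : X :=
  if pselect (X g) is left Xg then exist _ g (mem_set Xg) else x0.

Lemma to_cplxK x0 g : X g -> set_val (to_cplx x0 g) = g.
Proof. by rewrite /to_cplx; case: pselect. Qed.

Lemma to_cplx_val x0 x : to_cplx x0 (set_val x) = x.
Proof. by apply: val_inj; exact: to_cplxK (set_valP x). Qed.

Lemma to_cplx_continuous (T : topologicalType) (A : set T) x0 (g : T -> N -> R) :
  (forall t, A t -> X (g t)) ->
  (forall v t, A t -> {for t, continuous (g ^~ v)}) ->
  {within A, continuous (to_cplx x0 \o g)}.
Proof.
move=> Xg cg; apply/subspace_continuousP => t At.
apply: cvg_coordP => v; rewrite /comp to_cplxK; last exact: Xg.
have gt : g s v @[s --> within A (nbhs t)] --> g t v.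
  by apply: cvg_trans (cg v t At); apply: cvg_app; exact: cvg_within.
apply: cvg_trans gt; apply: near_eq_cvg.
near=> s; rewrite /comp to_cplxK//; apply: Xg; near: s; exact: withinT.
Unshelve. all: by end_near. Qed.

End Coordinates.

(** * Complete fans in the plane *)

Definition nxt (k t : nat) : nat := if (t.+1 < k)%N then t.+1 else 0%N.

(* A complete fan in the plane with rays through [(px t, py t)], [t < k], in
   cyclic order; [c t z] is the [t]-th coefficient of [z] with respect to the two
   rays bounding a cone that contains [z]. *)
Record fan (R : realType) (k : nat) (px py : nat -> R)
    (c : nat -> R * R -> R) : Prop := Fan {
  fan_continuous : forall t, continuous (c t);
  fan_ge0 : forall t z, 0 <= c t z;
  fan_support : forall z, exists2 t, (t < k)%N & forall s, (s < k)%N ->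
    s != t -> s != nxt k t -> c s z = 0;
  fan_sum : forall z, z.1 = \sum_(t < k) c t z * px t /\
                      z.2 = \sum_(t < k) c t z * py t;
  fan_coef : forall t a b s, (t < k)%N -> (s < k)%N -> 0 <= a -> 0 <= b ->
    c s (a * px t + b * px (nxt k t), a * py t + b * py (nxt k t)) =
    if s == t then a else if s == nxt k t then b else 0 }.

(** The rays are the four half-axes, and the coefficients are the positive and negative parts of the
    two coordinates. *)
Lemma fan4 (R : realType) : exists px py c, @fan R 4 px py c.
Proof.
exists (nth 0 [:: 1; 0; -1; 0]), (nth 0 [:: 0; 1; 0; -1]).
exists (fun t z => nth 0 [:: Num.max z.1 0; Num.max z.2 0;
                             Num.max (- z.1) 0; Num.max (- z.2) 0] t).
split.
- case=> [|[|[|[|t]]]] /= z.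
  + by apply: cvg_max; [exact: cvg_fst | exact: cvg_cst].
  + by apply: cvg_max; [exact: cvg_snd | exact: cvg_cst].
  + by apply: cvg_max; [apply: cvgN; exact: cvg_fst | exact: cvg_cst].
  + by apply: cvg_max; [apply: cvgN; exact: cvg_snd | exact: cvg_cst].
  + by case: t => [|t]; exact: cvg_cst.
- by case=> [|[|[|[|[|t]]]]] z //=; rewrite le_max lexx orbT.
- case=> x y; have [x0|x0] := leP 0 x; have [y0|y0] := leP 0 y.
  + exists 0%N => // -[|[|[|[|s]]]] //= _ _ _; apply: max_r; lra.
  + exists 3%N => // -[|[|[|[|s]]]] //= _ _ _; apply: max_r; lra.
  + exists 1%N => // -[|[|[|[|s]]]] //= _ _ _; apply: max_r; lra.
  + exists 2%N => // -[|[|[|[|s]]]] //= _ _ _; apply: max_r; lra.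
- case=> x y; rewrite !big_ord_recr !big_ord0 /=; split.
  + by have [x0|x0] := leP 0 x; case: (leP 0 (- x)) => ?; lra.
  + by have [x0|x0] := leP 0 y; case: (leP 0 (- y)) => ?; lra.
- move=> [|[|[|[|t]]]] // a b [|[|[|[|s]]]] // _ _ a0 b0; rewrite /nxt /=;
    match goal with |- Num.max ?u _ = _ => case: (leP 0 u) => ?; lra end.
Qed.

(* A cone is subdivided by the sum of the generators of its two rays. *)
Lemma fanS (R : realType) (k : nat) px py c : (2 < k)%N -> @fan R k px py c ->
  exists px' py' c', @fan R k.+1 px' py' c'.
Proof.
case: k => // k k1 [cC c0 cS cE cP].
(* Coefficient of the new ray: inside the subdivided cone, between rays [k] and 0, the common part
   of the two coefficients moves to the sum of the generators. In every other cone one of the two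
   vanishes, hence so does [m], and nothing changes. *)
pose m z := Num.min (c k z) (c 0%N z).
pose px' t := if t == k.+1 then px k + px 0%N else px t.
pose py' t := if t == k.+1 then py k + py 0%N else py t.
pose c' t z := if t == k.+1 then m z else
  if (t == k) || (t == 0%N) then c t z - m z else c t z.
have mC : continuous m by move=> z; apply: cvg_min; exact: cC.
have m0 z : 0 <= m z by rewrite le_min !c0.
have nk : nxt k.+1 k = 0%N by rewrite /nxt ltnn.
have nk' : nxt k.+2 k = k.+1 by rewrite /nxt ltnSn.
have nk1 : nxt k.+2 k.+1 = 0%N by rewrite /nxt ltnn.
have nt t : (t < k)%N -> nxt k.+1 t = t.+1 by move=> tk; rewrite /nxt ifT.
have nt' t : (t < k)%N -> nxt k.+2 t = t.+1.
  by move=> tk; rewrite /nxt ifT// ltnS ltnW.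
have ne t : (t <= k)%N -> t == k.+1 = false by lia.
exists px', py', c'; split.
- move=> t; rewrite /c'; case: (t == k.+1) => //.
  case: ((t == k) || (t == 0%N)); last exact: cC.
  by move=> z; apply: cvgB; [exact: cC | exact: mC].
- move=> t z; rewrite /c'; case: ifP => [_|_]; first exact: m0.
  case: ifP => [|_]; last exact: c0.
  by case/orP => /eqP->; rewrite subr_ge0 ge_min lexx ?orbT.
- move=> z; have [t] := cS z; rewrite ltnS leq_eqVlt => /orP[/eqP->|tk] H.
    rewrite nk in H; have [h|h] := leP (c 0%N z) (c k z).
      exists k; first lia.
      move=> s; rewrite nk' /c' => sk sk0 sk1; rewrite (negPf sk0) (negPf sk1).
      case: eqP => [->|/eqP s0]; last first.
        by apply: H => //; lia.
      by rewrite orbT /m min_r// subrr.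
    exists k.+1; first lia.
    move=> s; rewrite nk1 /c' => sk sk1 s0.
    rewrite (negPf sk1) (negPf s0) orbF; case: eqP => [->|/eqP sk'].
      by rewrite /m min_l ?subrr// ltW.
    by apply: H => //; lia.
  have mz : m z = 0.
    apply/eqP; rewrite eq_le m0 andbT; have [t0|t0] := eqVneq t 0%N.
      by rewrite ge_min (H k) ?lexx// ?nt//; lia.
    by rewrite ge_min (H 0%N) ?lexx ?orbT// ?nt//; lia.
  exists t => [|s sk st]; first lia.
  rewrite nt'// -(nt _ tk) => st'; rewrite /c' mz subr0 if_same.
  by case: eqP => // sk1; apply: H => //; lia.
- move=> z; have [E1 E2] := cE z.
  have big (p p' : nat -> R) : p' k.+1 = p k + p 0%N ->
      (forall t, (t <= k)%N -> p' t = p t) ->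
      \sum_(t < k.+2) c' t z * p' t = \sum_(t < k.+1) c t z * p t.
    move=> pk pt; case: k k1 {mC m0 nk nk' nk1 nt nt' ne E1 E2 cS cE cP} @m px' py' @c' pk pt => // k k1 m px' py' c' pk pt.
    rewrite big_ord_recr big_ord_recl big_ord_recr /=.
    rewrite [RHS]big_ord_recl [in RHS]big_ord_recr /= /bump /= !add1n.
    have -> : \sum_(i < k) c' (1 + i)%N z * p' (1 + i)%N =
              \sum_(i < k) c (1 + i)%N z * p (1 + i)%N.
      apply: eq_bigr => i _; have ik := ltn_ord i.
      by rewrite /c' pt ?ifF//; lia.
    rewrite /c' !eqxx /= pk !pt//.
    by rewrite (_ : k.+1 == k.+2 = false); [ring | lia].
  split; [rewrite E1; apply/esym/big | rewrite E2; apply/esym/big].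
  - by rewrite /px' eqxx.
  - by move=> t tk; rewrite /px' ne.
  - by rewrite /py' eqxx.
  - by move=> t tk; rewrite /py' ne.
- move=> t a b s tk sk a0 b0.
  have [tk'|] := ltnP t k.
    rewrite nt'// /px' /py' !ne//; last exact: ltnW.
    set z := (_, _).
    have hz r : (r <= k)%N -> c r z = if r == t then a else if r == t.+1 then b else 0.
      by move=> rk; rewrite /z -(nt _ tk') cP// ltnW.
    have mz : m z = 0.
      apply/eqP; rewrite eq_le m0 andbT ge_min !hz//.
      case: t tk' {tk hz z} => [|t] tk' /=; last by rewrite lexx orbT.
      have -> : k == 0%N = false by lia.
      have -> : k == 1%N = false by lia.
      by rewrite lexx.
    rewrite /c' mz subr0 if_same; case: eqP => [->|/eqP sk1].
      have -> : k.+1 == t = false by lia.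
      by have -> : k.+1 == t.+1 = false by lia.
    by apply: hz; lia.
  rewrite leq_eqVlt => /orP[/eqP tE|kt].
    rewrite -tE nk' /px' /py' eqxx ne//.
    have -> : (a * px k + b * (px k + px 0%N), a * py k + b * (py k + py 0%N)) =
      ((a + b) * px k + b * px 0%N, (a + b) * py k + b * py 0%N).
      by congr (_, _); ring.
    set z := (_, _).
    have hz r : (r <= k)%N -> c r z = if r == k then a + b else if r == 0%N then b else 0.
      by move=> rk; rewrite /z -nk cP// addr_ge0.
    have k0 : 0%N == k = false by lia.
    have mz : m z = b by rewrite /m !hz// eqxx k0 eqxx min_r// lerDr.
    rewrite /c' mz; have [->|sk1] := eqVneq s k.+1.
      by have -> : k.+1 == k = false by lia.
    have sk' : (s <= k)%N by lia.
    rewrite hz//; case: eqP => [_|_] /=; first by rewrite addrK.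
    by case: eqP => // _; rewrite subrr.
  have -> : t = k.+1 by lia.
  rewrite nk1 /px' /py' eqxx ne//.
  have -> : (a * (px k + px 0%N) + b * px 0%N, a * (py k + py 0%N) + b * py 0%N) =
    (a * px k + (a + b) * px 0%N, a * py k + (a + b) * py 0%N).
    by congr (_, _); ring.
  set z := (_, _).
  have hz r : (r <= k)%N -> c r z = if r == k then a else if r == 0%N then a + b else 0.
    by move=> rk; rewrite /z -nk cP// addr_ge0.
  have k0 : 0%N == k = false by lia.
  have mz : m z = a by rewrite /m !hz// eqxx k0 eqxx min_l// lerDl.
  rewrite /c' mz; have [//|sk1] := eqVneq s k.+1.
  have sk' : (s <= k)%N by lia.
  rewrite hz//; case: (eqVneq s k) => [->|_] /=.
    by rewrite subrr (_ : k == 0%N = false)//; lia.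
  by case: eqP => // _; rewrite addrC addKr.
Qed.

Lemma fan_exists (R : realType) (k : nat) : (3 < k)%N ->
  exists px py c, @fan R k px py c.
Proof.
move=> k3; rewrite -(subnK k3); elim: (k - 4)%N => [|j [px [py [c IH]]]].
  exact: fan4.
by rewrite addSn; apply: fanS IH; rewrite addnC.
Qed.

(** * Open disks: the plane and open stars *)

Lemma continuous_in_within (T U : topologicalType) (A : set T) (f : T -> U) :
  (forall x, A x -> {for x, continuous f}) -> {within A, continuous f}.
Proof.
by move=> fc; apply: continuous_in_subspaceT => x; rewrite inE; exact: fc.
Qed.

Lemma within_continuous_comp (T U V : topologicalType) (A : set T) (B : set U)
    (f : T -> U) (g : U -> V) :
  (forall x, A x -> B (f x)) ->
  {within A, continuous f} -> {within B, continuous g} ->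
  {within A, continuous (g \o f)}.
Proof.
move=> AB /subspace_continuousP fc /subspace_continuousP gc.
apply/subspace_continuousP => x Ax.
apply: (cvg_comp f g); last exact: gc (AB _ Ax).
move=> C wC; have fC : \forall y \near within A (nbhs x), B (f y) -> C (f y).
  exact: fc _ Ax _ wC.
apply: filterS2 fC (withinT _ _) => y /= Cy Ay; exact: Cy (AB _ Ay).
Qed.

Lemma homeomorphic_trans (T U V : topologicalType) (A : set T) (B : set U)
    (C : set V) : homeomorphic A B -> homeomorphic B C -> homeomorphic A C.
Proof.
move=> [f [f' [fc f'c AB BA]]] [g [g' [gc g'c BC CB]]].
exists (g \o f), (f' \o g'); split.
- by apply: within_continuous_comp gc => // x /AB[].
- by apply: within_continuous_comp f'c => // x /CB[].
- by move=> x /AB[Bf fK]; have [Cg gK] := BC _ Bf; rewrite /= gK.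
- by move=> x /CB[Bf fK]; have [Cg gK] := BA _ Bf; rewrite /= gK.
Qed.

(** The map [p / sqrt (1 - |p|^2)] and its inverse [p / sqrt (1 + |p|^2)] are radial and need no
    separate case at the origin. *)
Lemma disk_plane (R : realType) :
  homeomorphic (@unit_disk R) [set: (R * R)%type].
Proof.
pose q (p : R * R) := p.1 ^+ 2 + p.2 ^+ 2.
have q0 p : 0 <= q p by rewrite addr_ge0// sqr_ge0.
have qc : continuous q.
  by move=> p; apply: cvgD; rewrite expr2; under eq_fun do rewrite expr2;
    apply: cvgM; (exact: cvg_fst || exact: cvg_snd).
exists (fun p => (p.1 / Num.sqrt (1 - q p), p.2 / Num.sqrt (1 - q p))).
exists (fun p => (p.1 / Num.sqrt (1 + q p), p.2 / Num.sqrt (1 + q p))).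
have sc (e : R -> R) p : {for q p, continuous e} -> 0 < e (q p) ->
    {for p, continuous (fun p : R * R =>
      (p.1 / Num.sqrt (e (q p)), p.2 / Num.sqrt (e (q p))))}.
  move=> ec e0.
  have ic : (Num.sqrt (e (q x)))^-1 @[x --> p] --> (Num.sqrt (e (q p)))^-1.
    apply: cvgV; first by rewrite gt_eqF// sqrtr_gt0.
    apply: continuous_cvg; first exact: sqrt_continuous.
    apply: continuous_cvg; [exact: ec | exact: qc].
  by apply: cvg_pairR; apply: cvgM => //; [exact: cvg_fst | exact: cvg_snd].
split.
- apply: continuous_in_within => p; rewrite /unit_disk/= -/(q p) => p1.
  apply: (sc (fun x => 1 - x)); last by rewrite subr_gt0.
  by apply: cvgB; [exact: cvg_cst | exact: cvg_id].
- apply: continuous_in_within => p _.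
  apply: (sc (fun x => 1 + x)); last by rewrite ltr_wpDr.
  by apply: cvgD; [exact: cvg_cst | exact: cvg_id].
- move=> p; rewrite /unit_disk/= -/(q p) => p1; split=> //.
  set s := Num.sqrt (1 - q p).
  have s0 : 0 < s by rewrite sqrtr_gt0 subr_gt0.
  have ss : s ^+ 2 = 1 - q p by rewrite sqr_sqrtr// subr_ge0 ltW.
  have -> : 1 + q (p.1 / s, p.2 / s) = s^-1 ^+ 2.
    rewrite {1}/q /= !expr_div_n -mulrDl -/(q p) exprVn ss.
    by field; lra.
  rewrite sqrtr_sqr ger0_norm ?invr_ge0 ?(ltW s0)// invrK !divfK ?gt_eqF//.
  by case: p {p1 s s0 ss}.
- move=> p _.
  set s := Num.sqrt (1 + q p).
  have p1 : 0 < 1 + q p by rewrite ltr_wpDr.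
  have s0 : 0 < s by rewrite sqrtr_gt0.
  have ss : s ^+ 2 = 1 + q p by rewrite sqr_sqrtr// ltW.
  have qE : q (p.1 / s, p.2 / s) = q p / (1 + q p).
    by rewrite {1}/q /= !expr_div_n -mulrDl -/(q p) ss.
  split; first by rewrite /unit_disk/= -[ltLHS]/(q (p.1 / s, p.2 / s)) qE ltr_pdivrMr// mul1r; lra.
  have -> : 1 - q (p.1 / s, p.2 / s) = s^-1 ^+ 2.
    by rewrite qE exprVn ss; field; lra.
  rewrite sqrtr_sqr ger0_norm ?invr_ge0 ?(ltW s0)// invrK !divfK ?gt_eqF//.
  by case: p {s s0 ss p1 qE}.
Qed.

Section Star.
Variables (R : realType) (N : eqType) (X : set {ptws N -> R}).
Hypothesis X_ge0 : forall x, X x -> forall d, 0 <= x d.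

(** The tests are made in order, so the weights are the intended ones only when the three nodes are
    distinct. *)
Definition pt3 (d0 d1 d2 : N) (a0 a1 a2 : R) (d : N) : R :=
  if d == d0 then a0 else if d == d1 then a1 else if d == d2 then a2 else 0.

(** The link nodes are sent to the rays of a fan. A point [z] of the plane gets weights proportional
    to 1 at the centre and to its fan coefficients on the link, normalized by [W z]. Conversely, the
    link weights are divided by the weight of [v] and taken as multiples of the rays. *)
Lemma star_open_disk (k : nat) (v : N) (L : nat -> N) : (3 < k)%N ->
  (forall s t, (s < k)%N -> (t < k)%N -> L s = L t -> s = t) ->
  (forall t, (t < k)%N -> L t != v) ->
  (forall t a0 a1 a2, (t < k)%N -> 0 <= a0 -> 0 <= a1 -> 0 <= a2 ->
     a0 + a1 + a2 = 1 -> X (pt3 v (L t) (L (nxt k t)) a0 a1 a2)) ->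
  (forall x, X x -> 0 < x v -> exists2 t, (t < k)%N &
     x = pt3 v (L t) (L (nxt k t)) (x v) (x (L t)) (x (L (nxt k t))) /\
     x v + x (L t) + x (L (nxt k t)) = 1) ->
  open_disk R [set x : X | 0 < set_val x v].
Proof.
move=> k3 Linj Lv XL LX.
have [px [py [c [cC c0 cS cE cP]]]] := fan_exists R k3.
have k0 : (0 < k)%N by lia.
have nk t : (nxt k t < k)%N by rewrite /nxt; case: ifP.
have nn t : (t < k)%N -> nxt k t != t by rewrite /nxt; case: ifP; lia.
pose W z := 1 + \sum_(t < k) c t z.
pose f z d := (if d == v then 1 else \sum_(t < k | L t == d) c t z) / W z.
have W0 z : 0 < W z by rewrite ltr_wpDr// sumr_ge0.
have fL z t : (t < k)%N -> f z (L t) = c t z / W z.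
  move=> tk; rewrite /f (negPf (Lv _ tk)) (big_pred1 (Ordinal tk))//.
  move=> i /=; apply/eqP/eqP => [/Linj iE|->//]; apply: val_inj => /=.
  exact: iE.
have sum2 (a : nat -> R) t : (t < k)%N ->
    (forall s, (s < k)%N -> s != t -> s != nxt k t -> a s = 0) ->
    \sum_(s < k) a s = a t + a (nxt k t).
  move=> tk a0; rewrite (bigD1 (Ordinal tk))//=; congr (_ + _).
  rewrite (bigD1 (Ordinal (nk t)))//=; last exact: nn.
  rewrite big1 ?addr0// => i /andP[it inx]; exact: a0.
have fE z : exists2 t, (t < k)%N &
    f z = pt3 v (L t) (L (nxt k t)) (1 / W z) (c t z / W z) (c (nxt k t) z / W z)
    /\ W z = 1 + (c t z + c (nxt k t) z).
  have [t tk tz] := cS z; exists t => //; split; last first.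
    by rewrite /W (sum2 (c ^~ z) t tk tz).
  apply/funext => d; rewrite /pt3; case: eqP => [->|/eqP dv].
    by rewrite /f eqxx.
  case: eqP => [->|/eqP dt]; first exact: fL.
  case: eqP => [->|/eqP dn]; first exact: fL.
  rewrite /f (negPf dv) big1 ?mul0r// => i /eqP Li.
  apply: tz => //; first by apply: contraNN dt => /eqP <-; rewrite Li.
  by apply: contraNN dn => /eqP <-; rewrite Li.
have fX z : X (f z).
  have [t tk [-> WE]] := fE z; have wp := W0 z; rewrite WE in wp *.
  apply: XL; rewrite ?divr_ge0 ?ler01 ?(ltW wp)//.
  by field; lra.
pose x0 : X := exist _ (f (0, 0)) (mem_set (fX _)).
apply: homeomorphic_trans (disk_plane R) _.
exists (to_cplx x0 \o f).
exists (fun x : X => (\sum_(t < k) set_val x (L t) / set_val x v * px t,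
                      \sum_(t < k) set_val x (L t) / set_val x v * py t)).
split.
- apply: to_cplx_continuous => // d z _.
  apply: cvgM.
    case: (d == v); first exact: cvg_cst.
    by apply: cvg_sumr => i _; exact: cC.
  apply: cvgV; first by rewrite gt_eqF.
  apply: cvgD; first exact: cvg_cst.
  by apply: cvg_sumr => i _; exact: cC.
- apply: continuous_in_within => x /= xv.
  have xc (F : set_system X) (p : nat -> R) : Filter F -> F --> x ->
      \sum_(t < k) set_val y (L t) / set_val y v * p t @[y --> F]
      --> \sum_(t < k) set_val x (L t) / set_val x v * p t.
    move=> FF Fx.
    have cv d : set_val y d @[y --> F] --> set_val x d.
      by apply: cvg_trans (@coord_continuous _ _ X d x); exact: cvg_app.
    apply: cvg_sumr => i _; apply: cvgM; last exact: cvg_cst.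
    by apply: cvgM => //; apply: cvgV; rewrite ?gt_eqF.
  have FF := nbhs_filter x.
  by apply: (@cvg_pairR R _ _ FF); exact: xc.
- move=> z _ /=; rewrite to_cplxK; last exact: fX.
  have fv : f z v = 1 / W z by rewrite /f eqxx.
  split; first by rewrite fv divr_gt0.
  have [E1 E2] := cE z; rewrite fv [RHS]surjective_pairing E1 E2.
  have w0 : W z != 0 by rewrite gt_eqF.
  congr (_, _); apply: eq_bigr => i _; rewrite fL//; congr (_ * _);
    by rewrite div1r invrK divfK.
- move=> x /= xv; split=> //.
  pose y : N -> R := set_val x.
  have {}xv : 0 < y v by [].
  have Xy : X y := set_valP x.
  have [t tk [xE x1]] := LX y Xy xv.
  have {xE}yE d : y d = pt3 v (L t) (L (nxt k t)) (y v) (y (L t)) (y (L (nxt k t))) d.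
    by rewrite {1}xE.
  pose z := (\sum_(s < k) y (L s) / y v * px s, \sum_(s < k) y (L s) / y v * py s).
  suff fy : f z = y by rewrite -[RHS](to_cplx_val x0); congr (to_cplx _ _).
  have y0 d : 0 <= y d / y v by rewrite divr_ge0 ?(ltW xv)// X_ge0.
  have yL s : (s < k)%N -> s != t -> s != nxt k t -> y (L s) = 0.
    move=> sk st sn; rewrite yE /pt3 (negPf (Lv _ sk)).
    case: eqP => [/Linj e|_]; first by rewrite e ?eqxx in st.
    by case: eqP => [/Linj e|//]; rewrite e ?eqxx in sn.
  have zE : z = (y (L t) / y v * px t + y (L (nxt k t)) / y v * px (nxt k t),
                 y (L t) / y v * py t + y (L (nxt k t)) / y v * py (nxt k t)).
    rewrite /z; congr (_, _).
      by rewrite (sum2 (fun s => y (L s) / y v * px s) t)// => s sk st sn; rewrite yL ?mul0r.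
    by rewrite (sum2 (fun s => y (L s) / y v * py s) t)// => s sk st sn; rewrite yL ?mul0r.
  have cz s : (s < k)%N -> c s z = y (L s) / y v.
    move=> sk; rewrite zE cP//; case: eqP => [->//|/eqP st].
    by case: eqP => [->//|/eqP sn]; rewrite yL// mul0r.
  have WE : W z = 1 / y v.
    rewrite /W (eq_bigr (fun s : 'I_k => y (L s) / y v)); last by move=> s _; rewrite cz.
    rewrite (sum2 (fun s => y (L s) / y v) t)//; last first.
      by move=> s sk st sn; rewrite yL ?mul0r.
    have yv0 : y v != 0 by rewrite gt_eqF.
    by rewrite -mulrDl -[X in X + _](divff yv0) -mulrDl addrA x1.
  apply/funext => d; rewrite /f WE div1r invrK.
  case: (eqVneq d v) => [->|dv]; first by rewrite mul1r.
  case: (eqVneq d (L t)) => [->|dt].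
    by have := fL z t tk; rewrite /f (negPf (Lv _ tk)) WE div1r invrK cz// divfK ?gt_eqF.
  case: (eqVneq d (L (nxt k t))) => [->|dn].
    by have := fL z _ (nk t); rewrite /f (negPf (Lv _ (nk t))) WE div1r invrK cz// divfK ?gt_eqF.
  rewrite big1 ?mul0r; first by rewrite yE /pt3 (negPf dv) (negPf dt) (negPf dn).
  move=> i /eqP Li; rewrite cz// Li yE /pt3.
  by rewrite (negPf dv) (negPf dt) (negPf dn) mul0r.
Qed.

End Star.

(** * Moebius bands from twisted strips of triangles *)

Section Strip.
Variables (R : realType) (N : eqType) (X : set {ptws N -> R}).
Variables (k : nat) (u v : nat -> N).

(* The triangles of the strip are [u j, v j, strip_new j]: consecutive rungs
   [u j, v j] and [u j.+1, v j.+1] share exactly one end. *)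
Definition strip_new j := if u j.+1 == u j then v j.+1 else u j.+1.

Hypothesis k_gt0 : (0 < k)%N.
Hypothesis strip_step : forall j, (j < k)%N -> u j.+1 = u j \/ v j.+1 = v j.
Hypothesis strip_uniq : forall j, (j < k)%N -> uniq [:: u j; v j; strip_new j].
Hypothesis strip_in : forall j a0 a1 a2, (j < k)%N ->
  0 <= a0 -> 0 <= a1 -> 0 <= a2 -> a0 + a1 + a2 = 1 ->
  X (pt3 (u j) (v j) (strip_new j) a0 a1 a2).
Hypothesis strip_rung_inj : forall i j, (i < k)%N -> (j < k)%N ->
  perm_eq [:: u i; v i] [:: u j; v j] -> i = j.
Hypothesis strip_tri_inj : forall i j, (i < k)%N -> (j < k)%N ->
  perm_eq [:: u i; v i; strip_new i] [:: u j; v j; strip_new j] -> i = j.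
Hypotheses (strip_twistu : u k = v 0) (strip_twistv : v k = u 0).

(** Tent functions: [path w] interpolates linearly through the nodes [w 0, ..., w k]. *)
Let hat (i : nat) (T : R) : R := Num.max 0 (1 - `|T - i%:R|).
Let path (w : nat -> N) (T : R) (d : N) : R :=
  \sum_(i < k.+1) hat i T * (w i == d)%:R.
(** The weight stays in [1/4, 3/4], so the band only meets interiors of triangles and of rungs. The
    strip may thus touch itself at vertices or along its border; distinct rungs and distinct
    triangles suffice. Moreover [sc (- y) = 1 - sc y], which matches the exchange of [u] and [v] at
    the end. *)
Let sc (y : R) : R := (2 + y) / 4.
Let f (p : R * R) (d : N) : R :=
  sc p.2 * path u (k%:R * p.1) d + (1 - sc p.2) * path v (k%:R * p.1) d.

Let pathE w j r d : (j < k)%N -> 0 <= r <= 1 ->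
  path w (j%:R + r) d = (1 - r) * (w j == d)%:R + r * (w j.+1 == d)%:R.
Proof.
move=> jk /andP[r0 r1]; rewrite /path.
have jk' : (j < k.+1)%N by lia.
rewrite (bigD1 (Ordinal jk'))//=; congr (_ + _).
  by rewrite /hat addrAC subrr add0r ger0_norm// max_r// subr_ge0.
rewrite (bigD1 (Ordinal (jk : j.+1 < k.+1)%N))//=; last first.
  by apply/eqP => /(congr1 val) /=; lia.
rewrite big1 ?addr0 => [|i /andP[ij ij1]].
  rewrite /hat -(addn1 j) natrD opprD addrACA subrr add0r ler0_norm; last by lra.
  by rewrite max_r; [congr (_ * _); ring | lra].
have {}ij : (i : nat) <> j by move=> e; move/eqP: ij; apply; exact: val_inj.
have {}ij1 : (i : nat) <> j.+1 by move=> e; move/eqP: ij1; apply; exact: val_inj.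
rewrite /hat max_l ?mul0r// subr_le0.
have [ilj|] := ltnP i j.
  have : (i.+1%:R : R) <= j%:R by rewrite ler_nat.
  rewrite -(addn1 i) natrD => h; rewrite ger0_norm; lra.
move=> jli; have : (j.+2%:R : R) <= i%:R by rewrite ler_nat; lia.
rewrite -(addn2 j) natrD => h; rewrite ler0_norm; lra.
Qed.

Let fE j r y : (j < k)%N -> 0 <= r <= 1 -> f ((j%:R + r) / k%:R, y) =
  if u j.+1 == u j
  then pt3 (u j) (v j) (strip_new j) (sc y) ((1 - sc y) * (1 - r)) ((1 - sc y) * r)
  else pt3 (u j) (v j) (strip_new j) (sc y * (1 - r)) (1 - sc y) (sc y * r).
Proof.
move=> jk r01; apply/funext => d; rewrite /f /=.
have kn0 : (k%:R : R) != 0 by rewrite pnatr_eq0; lia.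
rewrite [k%:R * _]mulrC divfK// !pathE//.
have /and3P[/negPf uv /negPf uw /negPf vw] :
    [&& u j != v j, u j != strip_new j & v j != strip_new j].
  by have := strip_uniq jk; rewrite /= !inE negb_or andbT -andbA.
have tri a b e : a * (u j == d)%:R + b * (v j == d)%:R + e * (strip_new j == d)%:R
    = pt3 (u j) (v j) (strip_new j) a b e d.
  rewrite /pt3; case: (eqVneq d (u j)) => [->|du].
    by rewrite ?eqxx !(eq_sym _ (u j)) uv uw /=; ring.
  case: (eqVneq d (v j)) => [->|dv]; last by case: (eqVneq d _) => _ /=; ring.
  by rewrite ?eqxx (eq_sym _ (v j)) vw /=; ring.
case: ifP => [/eqP un|un].
  by rewrite -tri /strip_new un eqxx; ring.
have [e|vn] := strip_step jk; first by rewrite e eqxx in un.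
by rewrite -tri /strip_new un vn; ring.
Qed.

Let sc_int y : -1 <= y <= 1 -> 0 < sc y < 1.
Proof. by move=> /andP[y0 y1]; rewrite /sc; apply/andP; split; lra. Qed.

Let split_t (t : R) : 0 <= t < 1 ->
  exists j r, [/\ (j < k)%N, 0 <= r, r < 1 & t = (j%:R + r) / k%:R].
Proof.
move=> /andP[t0 t1].
have kp : (0 : R) < k%:R by rewrite ltr0n.
have T0 : 0 <= t * k%:R by rewrite mulr_ge0// ltW.
have /andP[n0 n1] := truncn_itv T0.
exists (Num.truncn (t * k%:R)), (t * k%:R - (Num.truncn (t * k%:R))%:R); split.
- rewrite -(ltr_nat R); apply: le_lt_trans n0 _.
  by rewrite gtr_pMl.
- by rewrite subr_ge0.
- by rewrite ltrBlDl -(natrD _ _ 1) addn1.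
- by rewrite addrC subrK mulfK// gt_eqF.
Qed.

Let fX p : 0 <= p.1 <= 1 -> -1 <= p.2 <= 1 -> X (f p).
Proof.
case: p => t y /= /andP[t0 t1] /sc_int/andP[s0 s1].
have kp : (0 : R) < k%:R by rewrite ltr0n.
have [j [r [jk r0 r1 tE]]] :
    exists j r, [/\ (j < k)%N, 0 <= r, r <= 1 & t = (j%:R + r) / k%:R].
  move: t1; rewrite le_eqVlt => /orP[/eqP->|t1].
    (* The right end of the band is the far side of the last triangle. *)
    exists k.-1, 1; split=> //; first by lia.
    by rewrite -(natrD _ _ 1) addn1 prednK// divff// gt_eqF.
  have [|j [r [jk r0 r1 tE]]] := @split_t t; first by rewrite t0.
  by exists j, r; split=> //; exact: ltW.
rewrite tE fE ?r0//; case: ifP => _; apply: strip_in => //.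
- exact: ltW.
- by apply: mulr_ge0; lra.
- by apply: mulr_ge0; lra.
- by ring.
- by apply: mulr_ge0; lra.
- by lra.
- by apply: mulr_ge0; lra.
- by ring.
Qed.

(** The set of nonzero coordinates identifies the open rung ([r = 0]) or the open triangle of the
    point, hence [j]; two coordinates then give back [y] and [r]. The end [t = 1] is excluded
    because it is glued to [t = 0]. *)
Let f_inj p q : 0 <= p.1 < 1 -> 0 <= q.1 < 1 -> -1 <= p.2 <= 1 -> -1 <= q.2 <= 1 ->
  f p = f q -> p = q.
Proof.
case: p q => [t y] [t' y'] /= /split_t[j [r [jk r0 r1 ->]]].
move=> /split_t[j' [r' [jk' r'0 r'1 ->]]] yb yb'.
have r01 : 0 <= r <= 1 by rewrite r0 ltW.
have r'01 : 0 <= r' <= 1 by rewrite r'0 ltW.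
have supp i z y0 : (i < k)%N -> 0 <= z < 1 -> -1 <= y0 <= 1 ->
    (fun d => f ((i%:R + z) / k%:R, y0) d != 0) =1
    (fun d => d \in if z == 0 then [:: u i; v i] else [:: u i; v i; strip_new i]).
  move=> ik /andP[z0 z1] /sc_int/andP[s0 s1] d.
  rewrite fE ?z0 ?(ltW z1)//.
  have a1 : sc y0 != 0 by rewrite gt_eqF.
  have a2 : 1 - sc y0 != 0 by rewrite gt_eqF// subr_gt0.
  have a3 : 1 - z != 0 by rewrite gt_eqF// subr_gt0.
  have nz a b e : a != 0 -> b != 0 ->
      (pt3 (u i) (v i) (strip_new i) a b (e * z) d != 0) =
      (d \in [:: u i; v i]) || [&& d == strip_new i, e != 0 & z != 0].
    move=> an bn; rewrite /pt3 !inE; case: (d == u i) => //=; case: (d == v i) => //=.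
    by case: (d == strip_new i); rewrite ?mulf_eq0 ?negb_or ?eqxx.
  have -> : (d \in (if z == 0 then [:: u i; v i] else [:: u i; v i; strip_new i])) =
            (d \in [:: u i; v i]) || (d == strip_new i) && (z != 0).
    by case: (eqVneq z 0); rewrite ?andbF ?orbF// !inE andbT orbA.
  case: ifP => _; rewrite nz //.
  - by rewrite a2.
  - exact: mulf_neq0.
  - by rewrite a1.
  - exact: mulf_neq0.
move=> ff.
have ss d : (d \in if r == 0 then [:: u j; v j] else [:: u j; v j; strip_new j]) =
            (d \in if r' == 0 then [:: u j'; v j'] else [:: u j'; v j'; strip_new j']).
  by rewrite -(supp j r y)// ?r0// -(supp j' r' y')// ?r'0// ff.
have uq i : (i < k)%N -> uniq [:: u i; v i].
  by move=> /strip_uniq /=; rewrite !inE negb_or => /andP[/andP[->]].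
have [zz jj] : (r == 0) = (r' == 0) /\ j = j'.
  move: ss; case: (r == 0); case: (r' == 0) => ss; split=> //.
  - by apply: strip_rung_inj => //; apply: uniq_perm; rewrite ?uq.
  - by have := perm_size (uniq_perm (uq _ jk) (strip_uniq jk') ss).
  - by have := perm_size (uniq_perm (uq _ jk) (strip_uniq jk') ss).
  - by have := perm_size (uniq_perm (strip_uniq jk) (uq _ jk') ss).
  - by have := perm_size (uniq_perm (strip_uniq jk) (uq _ jk') ss).
  - by apply: strip_tri_inj => //; apply: uniq_perm; rewrite ?strip_uniq.
subst j'; have [s0 s1] := andP (sc_int yb); have [s'0 s'1] := andP (sc_int yb').
have [/andP[uv uw] vw] : (u j != v j) && (u j != strip_new j) /\ v j != strip_new j.
  by have := strip_uniq jk; rewrite /= !inE negb_or andbT => /andP[].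
move: ff; rewrite !fE//.
have scI z z' : sc z = sc z' -> z = z' by rewrite /sc; lra.
case: ifP => _ ff.
  have e1 : sc y = sc y' by have := congr1 (@^~ (u j)) ff; rewrite /pt3 eqxx.
  have := congr1 (@^~ (strip_new j)) ff; rewrite /pt3.
  rewrite !(eq_sym (strip_new j)) (negPf uw) (negPf vw) eqxx e1 => /mulfI h.
  by rewrite (scI _ _ e1) h// subr_eq0 gt_eqF.
have e1 : sc y = sc y'.
  have := congr1 (@^~ (v j)) ff; rewrite /pt3 (eq_sym (v j)) (negPf uv) eqxx.
  by lra.
have := congr1 (@^~ (strip_new j)) ff; rewrite /pt3.
rewrite !(eq_sym (strip_new j)) (negPf uw) (negPf vw) eqxx e1 => /mulfI h.
by rewrite (scI _ _ e1) h// gt_eqF.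
Qed.

Let f_glue y : f (1, y) = f (0, - y).
Proof.
have kp : (0 : R) < k%:R by rewrite ltr0n.
have b0 : 0 <= (0 : R) <= 1 by rewrite lexx ler01.
have b1 : 0 <= (1 : R) <= 1 by rewrite lexx ler01.
have T1 : (k%:R : R) = k.-1%:R + 1 by rewrite -(natrD _ _ 1) addn1 prednK.
have T0 : (0 : R) = 0%N%:R + 0 by rewrite addr0.
apply/funext => d; rewrite /f /= mulr1 mulr0.
rewrite [in X in X + _ = _]T1 [in X in _ + X = _]T1 [in X in _ = X + _]T0 [in X in _ = _ + X]T0.
rewrite !pathE//; try lia.
rewrite prednK// strip_twistu strip_twistv /sc; by field.
Qed.

Lemma strip_nonorientable : nonorientable R X.
Proof.
have X00 : X (f (0, 0)) by apply: fX => /=; lra.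
pose x0 : X := exist _ (f (0, 0)) (mem_set X00).
exists (to_cplx x0 \o f); split.
  apply: to_cplx_continuous => [p [/= p1 p2]|d p _].
    by apply: fX; [move: p1 | move: p2]; rewrite /= in_itv.
  have pc w : path w (k%:R * q.1) d @[q --> p] --> path w (k%:R * p.1) d.
    apply: cvg_sumr => i _; apply: cvgM; last exact: cvg_cst.
    apply: cvg_max; first exact: cvg_cst.
    apply: cvgB; first exact: cvg_cst.
    apply: cvg_norm; apply: cvgB; last exact: cvg_cst.
    by apply: cvgM; [exact: cvg_cst | exact: cvg_fst].
  have sccv : sc q.2 @[q --> p] --> sc p.2.
    by apply: cvgM; [apply: cvgD; [exact: cvg_cst | exact: cvg_snd] | exact: cvg_cst].
  apply: cvgD; apply: cvgM => //; try exact: pc.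
  by apply: cvgB => //; exact: cvg_cst.
move=> [t y] [t' y'] [/= tI yI] [/= t'I y'I]; move: tI yI t'I y'I.
rewrite /= !in_itv /= => /andP[t0 t1] yb /andP[t'0 t'1] yb'.
have yN z : -1 <= z <= 1 -> -1 <= - z <= (1 : R) by move=> /andP[? ?]; apply/andP; split; lra.
have b01 : 0 <= (0 : R) < 1 by rewrite lexx ltr01.
split; last first.
  case=> [[-> ->]//|[-> -> ->]|[-> -> ->]] /=; congr (to_cplx _ _).
    by rewrite f_glue opprK.
  by rewrite f_glue.
move=> /(congr1 set_val); rewrite /= !to_cplxK; try by apply: fX; rewrite /= ?t0 ?t'0.
(* An end at [t = 1] is moved to [t = 0] by [f_glue], where injectivity holds; which of the two
   points was moved selects the clause of the gluing. *)
move: t1 t'1; rewrite !le_eqVlt => /orP[/eqP->|t1] /orP[/eqP->|t'1].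
- rewrite !f_glue => e; constructor 1.
  have [/oppr_inj ->//] : (0 : R, - y) = (0, - y') by apply: (f_inj _ _ _ _ e) => //=; exact: yN.
- rewrite f_glue => e; constructor 3.
  have [<- <-//] : (0 : R, - y) = (t', y').
  by apply: (f_inj _ _ _ _ e) => //=; [rewrite t'0 | exact: yN].
- rewrite f_glue => e; constructor 2.
  have [-> ->//] : (t, y) = (0 : R, - y') by apply: (f_inj _ _ _ _ e) => //=; [rewrite t0 | exact: yN].
  by rewrite /= opprK.
- by move=> e; constructor 1; apply: (f_inj _ _ _ _ e); rewrite //= ?t0 ?t'0.
Qed.

End Strip.

(** * Combinatorial quadrangulations *)

Notation node := ((nat + nat) + nat * nat * nat * nat)%type.
Definition Wh (i : nat) : node := inl (inl i).
Definition Bl (j : nat) : node := inl (inr j).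
(* The centre of the face with white corners [i], [i'] and black corners [j],
   [j']; the name does not depend on the order within each pair. *)
Definition Fc (i i' j j' : nat) : node :=
  inr (minn i i', maxn i i', minn j j', maxn j j').

Lemma FcSw i i' j j' : Fc i i' j j' = Fc i' i j j'.
Proof. by rewrite /Fc minnC maxnC. Qed.

Lemma FcSb i i' j j' : Fc i i' j j' = Fc i i' j' j.
Proof. by rewrite /Fc (minnC j) (maxnC j). Qed.

Lemma Fc_inj i i' j j' k k' l l' : Fc i i' j j' = Fc k k' l l' ->
  (i = k /\ i' = k' \/ i = k' /\ i' = k) /\ (j = l /\ j' = l' \/ j = l' /\ j' = l).
Proof. by case; lia. Qed.

Lemma Wh_inj : injective Wh. Proof. by move=> i j []. Qed.
Lemma Bl_inj : injective Bl. Proof. by move=> i j []. Qed.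

(* [r i] lists the neighbours of the vertex [i] of one colour in cyclic order, and
   [q i t] is the vertex opposite to [i] in the face between [r i t] and
   [r i (nxt n.-1 t)]. *)
Record rotation (n : nat) (Q : nat -> nat -> nat -> nat -> bool)
    (r q : nat -> nat -> nat) : Prop := Rotation {
  rot_lt : forall i t, (i < n)%N -> (t < n.-1)%N -> (r i t < n)%N /\ r i t <> i;
  rot_inj : forall i s t, (i < n)%N -> (s < n.-1)%N -> (t < n.-1)%N ->
    r i s = r i t -> s = t;
  rot_face : forall i t, (i < n)%N -> (t < n.-1)%N ->
    Q i (q i t) (r i t) (r i (nxt n.-1 t));
  rot_complete : forall i i' j j', Q i i' j j' ->
    exists2 t, (t < n.-1)%N & i' = q i t /\
      ((j = r i t /\ j' = r i (nxt n.-1 t)) \/ (j' = r i t /\ j = r i (nxt n.-1 t))) }.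

(* [Q i i' j j'] holds when white [i], [i'] and black [j], [j'] are the corners of
   a face. *)
Record quadrangulation (n : nat) (Q : nat -> nat -> nat -> nat -> bool)
    (rw qw rb qb : nat -> nat -> nat) : Prop := Quadrangulation {
  quad_symw : forall i i' j j', Q i i' j j' -> Q i' i j j';
  quad_symb : forall i i' j j', Q i i' j j' -> Q i i' j' j;
  quad_lt : forall i i' j j', Q i i' j j' ->
    [/\ (i < n)%N, i <> i', (j < n)%N & j <> j'];
  quad_rotw : rotation n Q rw qw;
  quad_rotb : rotation n (fun j j' i i' => Q i i' j j') rb qb }.

Section Supported.
Variables (R : realType) (N : eqType).

Definition bary (s : seq N) (x : N -> R) : Prop :=
  [/\ forall d, 0 <= x d, \sum_(d <- s) x d = 1 & forall d, d \notin s -> x d = 0].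

Lemma bary_perm s s' x : perm_eq s s' -> bary s x -> bary s' x.
Proof.
move=> ss' [x0 x1 xs]; split=> //; first by rewrite -(perm_big _ ss').
by move=> d; rewrite -(perm_mem ss'); exact: xs.
Qed.

Lemma perm_cab (a b c : N) : perm_eq [:: a; b; c] [:: c; a; b].
Proof. by apply/permP => p /=; lia. Qed.

Lemma perm_acb (a b c : N) : perm_eq [:: a; b; c] [:: a; c; b].
Proof. by apply/permP => p /=; lia. Qed.

Lemma perm_cba (a b c : N) : perm_eq [:: a; b; c] [:: c; b; a].
Proof. by apply/permP => p /=; lia. Qed.

Lemma perm_bac (a b c : N) : perm_eq [:: a; b; c] [:: b; a; c].
Proof. by apply/permP => p /=; lia. Qed.

Lemma bary_pt3 d0 d1 d2 (a0 a1 a2 : R) : uniq [:: d0; d1; d2] ->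
  0 <= a0 -> 0 <= a1 -> 0 <= a2 -> a0 + a1 + a2 = 1 ->
  bary [:: d0; d1; d2] (pt3 d0 d1 d2 a0 a1 a2).
Proof.
move=> /=; rewrite !inE negb_or andbT => /andP[/andP[d01 d02] d12] p0 p1 p2 s1.
split=> [d||d].
- by rewrite /pt3; do 3 case: ifP => // _.
- rewrite !big_cons big_nil addr0 /pt3 !eqxx !(eq_sym _ d0) (negPf d01) (negPf d02).
  by rewrite eq_sym (negPf d12) addrA.
- by rewrite !inE !negb_or /pt3 => /and3P[/negPf-> /negPf-> /negPf->].
Qed.

Lemma bary3E d0 d1 d2 (x : N -> R) : bary [:: d0; d1; d2] x ->
  x = pt3 d0 d1 d2 (x d0) (x d1) (x d2) /\ x d0 + x d1 + x d2 = 1.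
Proof.
move=> [x0 x1 xs]; split; last first.
  by move: x1; rewrite !big_cons big_nil addr0 addrA.
apply/funext => d; rewrite /pt3; case: eqP => [->//|/eqP d0'].
case: eqP => [->//|/eqP d1']; case: eqP => [->//|/eqP d2'].
by apply: xs; rewrite !inE !negb_or d0' d1' d2'.
Qed.

End Supported.

(** * Links of vertices and of face centres *)

Section VertexStar.
(* Applied to both colours: [A] is the colour of the vertex and [B] the other one. *)
Variables (R : realType) (N : eqType) (n : nat) (Q : nat -> nat -> nat -> nat -> bool).
Variables (r q : nat -> nat -> nat) (A B : nat -> N) (F : nat -> nat -> nat -> nat -> N).
Variable (X : set {ptws N -> R}).
Hypothesis n4 : (3 < n)%N.
Hypothesis QS : forall i i' j j', Q i i' j j' -> Q i i' j' j.
Hypothesis rQ : rotation n Q r q.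
Hypothesis A_inj : injective A.
Hypothesis B_inj : injective B.
Hypothesis AB : forall i j, A i != B j.
Hypothesis AF : forall i0 i i' j j', A i0 != F i i' j j'.
Hypothesis BF : forall i0 i i' j j', B i0 != F i i' j j'.
Hypothesis FS : forall i i' j j', F i i' j j' = F i i' j' j.
Hypothesis F_inj : forall i i' j j' k k' l l', F i i' j j' = F k k' l l' ->
  (j = l /\ j' = l') \/ (j = l' /\ j' = l).
Hypothesis XE : forall x, X x <-> exists i i' j j', Q i i' j j' /\
  bary [:: A i; B j; F i i' j j'] x.

Let m := n.-1.
(** The link of [A i]: neighbours in cyclic order at even places, and at odd places the centre of
    the face between the two adjacent neighbours. *)
Let L i t := let t' := t./2 in
  if odd t then F i (q i t') (r i t') (r i (nxt m t')) else B (r i t').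

Let L2 i t : L i t.*2 = B (r i t).
Proof. by rewrite /L odd_double doubleK. Qed.

Let L21 i t : L i t.*2.+1 = F i (q i t) (r i t) (r i (nxt m t)).
Proof. by rewrite /L /= odd_double /= uphalf_double. Qed.

Let nxt2 t : nxt m.*2 t.*2 = if (t < m)%N then t.*2.+1 else 0%N.
Proof. by rewrite /nxt; do 2 case: ifP; lia. Qed.

Let nxt21 t : (t < m)%N -> nxt m.*2 t.*2.+1 = (nxt m t).*2.
Proof. by move=> tm; rewrite /nxt; do 2 case: ifP; lia. Qed.

Let nxt_lt t : (nxt m t < m)%N.
Proof. by rewrite /nxt; case: ifP; rewrite /m; lia. Qed.

Lemma vertex_star_disk i0 : (i0 < n)%N -> open_disk R [set x : X | 0 < set_val x (A i0)].
Proof.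
move=> i0n; apply: (@star_open_disk _ _ X _ m.*2 (A i0) (L i0)).
- by move=> x /XE[i [i' [j [j' [_ []]]]]].
- by rewrite /m; lia.
- move=> s t sm tm; rewrite -(odd_double_half s) -(odd_double_half t).
  have s2 : (s./2 < m)%N by lia.
  have t2 : (t./2 < m)%N by lia.
  case: (odd s); case: (odd t); rewrite ?add1n ?add0n ?L2 ?L21.
  (* Equal centres might also come from exchanged neighbours. Then [s./2] and [t./2] would be
     successors of each other, which a cycle of length at least 3 forbids. *)
  + move=> /F_inj[[/(rot_inj rQ i0n s2 t2)->//]|[e1 e2]].
    have st := rot_inj rQ i0n s2 (nxt_lt _) e1.
    have ts := rot_inj rQ i0n (nxt_lt _) t2 e2.
    by move: st ts; rewrite /nxt /m; do 2 case: ifP; lia.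
  + by move/eqP; rewrite eq_sym (negPf (BF _ _ _ _ _)).
  + by move/eqP; rewrite (negPf (BF _ _ _ _ _)).
  + by move=> /B_inj/(rot_inj rQ i0n s2 t2)->.
- move=> t tm; rewrite -(odd_double_half t); case: (odd t); rewrite ?add1n ?add0n ?L2 ?L21.
    by rewrite eq_sym AF.
  by rewrite eq_sym AB.
- move=> t a0 a1 a2 tm p0 p1 p2 s1; apply/XE.
  have t2 : (t./2 < m)%N by lia.
  have Qt := rot_face rQ i0n t2.
  rewrite -(odd_double_half t); case: (odd t); rewrite ?add1n ?add0n ?nxt21 ?nxt2 ?t2 ?L2 ?L21//.
    exists i0, (q i0 t./2), (r i0 (nxt m t./2)), (r i0 t./2); split; first exact: QS.
    rewrite FS; apply: bary_perm (bary_pt3 _ _ _ _ _) => //; last first.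
      by rewrite /= !inE negb_or AB AF eq_sym BF.
    by rewrite perm_sym perm_acb.
  exists i0, (q i0 t./2), (r i0 t./2), (r i0 (nxt m t./2)); split=> //.
  by apply: bary_pt3 => //; rewrite /= !inE negb_or AB AF BF.
- move=> x /XE[i [i' [j [j' [Qx xb]]]]] xi.
  have ii : i = i0.
    have [_ _ xs] := xb; apply/eqP; apply: contraLR xi => ii.
    rewrite xs ?ltxx// !inE !negb_or AB AF andbT andbT.
    by apply: contraNN ii => /eqP/A_inj->.
  subst i; have [t tm [i'E jE]] := rot_complete rQ Qx.
  have xE := bary3E xb.
  (* In the link, the corner [j] comes just before the face centre or just after it, which gives an
     even or an odd place. *)
  case: jE => -[jE j'E].
    exists t.*2; first by lia.
    by rewrite nxt2 tm L2 L21 -jE -j'E -i'E.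
  exists t.*2.+1; first by lia.
  have pe : perm_eq [:: A i0; B j; F i0 i' j j'] [:: A i0; F i0 i' j j'; B j].
    exact: perm_acb.
  rewrite nxt21// L2 L21 -i'E -jE -j'E FS.
  exact: bary3E (bary_perm pe xb).
Qed.

End VertexStar.

Section Realization.
Variables (R : realType) (n : nat) (Q : nat -> nat -> nat -> nat -> bool).
Variables (rw qw rb qb : nat -> nat -> nat).
Hypothesis n4 : (3 < n)%N.
Hypothesis QD : quadrangulation n Q rw qw rb qb.

Definition quad_space : set {ptws node -> R} := [set x | exists i i' j j',
  Q i i' j j' /\ bary [:: Wh i; Bl j; Fc i i' j j'] x].
Local Notation X := quad_space.

Lemma quad_space_ge0 x : X x -> forall d, 0 <= x d.
Proof. by move=> [i [i' [j [j' [_ []]]]]]. Qed.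

Lemma white_star_disk i : (i < n)%N -> open_disk R [set x : X | 0 < set_val x (Wh i)].
Proof.
apply: (@vertex_star_disk R node n Q rw qw Wh Bl Fc X) => //.
- exact: quad_symb QD.
- exact: quad_rotw QD.
- exact: Wh_inj.
- exact: Bl_inj.
- exact: FcSb.
- by move=> ? ? ? ? ? ? ? ? /Fc_inj[].
Qed.

Lemma black_star_disk j : (j < n)%N -> open_disk R [set x : X | 0 < set_val x (Bl j)].
Proof.
apply: (@vertex_star_disk R node n (fun j j' i i' => Q i i' j j') rb qb Bl Wh
  (fun j j' i i' => Fc i i' j j') X) => //.
- by move=> ? ? ? ? /(quad_symw QD).
- exact: quad_rotb QD.
- exact: Bl_inj.
- exact: Wh_inj.
- by move=> *; exact: FcSw.
- by move=> ? ? ? ? ? ? ? ? /Fc_inj[].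
move=> x; split=> [[i [i' [j' [j'' [Qx xb]]]]]|[j' [j'' [i [i' [Qx xb]]]]]].
  exists j', j'', i, i'; split=> //; apply: bary_perm xb.
  exact: perm_bac.
exists i, i', j', j''; split=> //; apply: bary_perm xb.
exact: perm_bac.
Qed.

Lemma face_star_disk i i' j j' : Q i i' j j' ->
  open_disk R [set x : X | 0 < set_val x (Fc i i' j j')].
Proof.
move=> Qi; have [_ ii' _ jj'] := quad_lt QD Qi.
have Q' := quad_symw QD Qi; have Q'' := quad_symb QD Qi; have Q3 := quad_symb QD Q'.
pose L t := nth (Wh i) [:: Wh i; Bl j; Wh i'; Bl j'] t.
have corner k l : (k = i \/ k = i') -> (l = j \/ l = j') ->
    exists k' l', Q k k' l l' /\ Fc k k' l l' = Fc i i' j j'.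
  case=> -> [] ->; [exists i', j'|exists i', j|exists i, j'|exists i, j]; split=> //.
  + by rewrite FcSb.
  + by rewrite FcSw.
  + by rewrite FcSw FcSb.
have XWB k l a0 a1 a2 : (k = i \/ k = i') -> (l = j \/ l = j') ->
    0 <= a0 -> 0 <= a1 -> 0 <= a2 -> a0 + a1 + a2 = 1 ->
    X (pt3 (Fc i i' j j') (Wh k) (Bl l) a0 a1 a2) /\
    X (pt3 (Fc i i' j j') (Bl l) (Wh k) a0 a1 a2).
  move=> ki lj p0 p1 p2 s1; have [k' [l' [Qk FE]]] := corner k l ki lj.
  split; exists k, k', l, l'; (split; first by []); rewrite FE;
    apply: bary_perm (bary_pt3 _ p0 p1 p2 s1) => //.
    by rewrite perm_sym perm_cab.
  by rewrite perm_sym perm_cba.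
apply: (@star_open_disk _ _ X quad_space_ge0 4 (Fc i i' j j') L) => //.
- case=> [|[|[|[|s]]]] [|[|[|[|t]]]] //= _ _ [] e; exfalso;
    by [apply: ii' | apply: jj' | apply/ii'/esym | apply/jj'/esym].
- by case=> [|[|[|[|t]]]].
- case=> [|[|[|[|t]]]]// a0 a1 a2 _ p0 p1 p2 s1; rewrite /L /nxt /=.
  + by apply: (XWB i j a0 a1 a2 _ _ p0 p1 p2 s1).1; left.
  + by apply: (XWB i' j a0 a1 a2 _ _ p0 p1 p2 s1).2; [right|left].
  + by apply: (XWB i' j' a0 a1 a2 _ _ p0 p1 p2 s1).1; right.
  + by apply: (XWB i j' a0 a1 a2 _ _ p0 p1 p2 s1).2; [left|right].
- move=> x [k [k' [l [l' [Qk xb]]]]] xF.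
  have FE : Fc i i' j j' = Fc k k' l l'.
    have [_ _ xs] := xb; apply/eqP; apply: contraLR xF => FF.
    by rewrite xs ?ltxx// !inE.
  have xWB := bary3E (bary_perm (perm_cab _ _ _) xb).
  have xBW := bary3E (bary_perm (perm_cba _ _ _) xb).
  have [ki lj] := Fc_inj (esym FE); rewrite -FE in xWB xBW.
  have {}ki : k = i \/ k = i' by case: ki => -[]; [left | right].
  have {}lj : l = j \/ l = j' by case: lj => -[]; [left | right].
  by case: ki lj => kE [] lE; rewrite kE lE in xWB xBW;
    [exists 0%N | exists 3%N | exists 1%N | exists 2%N].
Qed.

End Realization.

(** * The realization is a closed surface *)

Section Surface.
Variables (R : realType) (n : nat) (Q : nat -> nat -> nat -> nat -> bool).
Variables (rw qw rb qb : nat -> nat -> nat).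
Hypothesis n4 : (3 < n)%N.
Hypothesis QD : quadrangulation n Q rw qw rb qb.
Local Notation X := (@quad_space R Q).

(** The deleted matching enters here: a black corner of a face at [i] occurs in the rotation at [i],
    which avoids the index [i]. *)
Lemma quad_neq i i' j j' : Q i i' j j' ->
  [/\ (i' < n)%N, (j' < n)%N & [/\ i <> j, i <> j', i' <> j & i' <> j']].
Proof.
have ij k k' l l' : Q k k' l l' -> k <> l.
  move=> Qk; have [kn _ _ _] := quad_lt QD Qk.
  have [t tm [_ lE]] := rot_complete (quad_rotw QD) Qk.
  have [_ r1] := rot_lt (quad_rotw QD) kn tm.
  have nt : (nxt n.-1 t < n.-1)%N by rewrite /nxt; case: ifP; lia.
  have [_ r2] := rot_lt (quad_rotw QD) kn nt.
  by move=> kl; case: lE => -[e1 e2]; [apply: r1; rewrite -e1 | apply: r2; rewrite -e2].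
move=> Qi; have Q1 := quad_symw QD Qi; have Q2 := quad_symb QD Qi.
have [in' _ _ _] := quad_lt QD Q1; have [_ _ jn' _] := quad_lt QD Q2.
do !split=> //; [exact: ij Qi | exact: ij Q2 | exact: ij Q1 |].
exact: ij (quad_symb QD Q1).
Qed.

(** By counting: the [n - 1] distinct values of the rotation at [i] lie among the [n - 1] indices
    other than [i], so they exhaust them. *)
Lemma edge_in_quad i j : (i < n)%N -> (j < n)%N -> i <> j -> exists i' j', Q i i' j j'.
Proof.
move=> ni nj ij; pose s := map (rw i) (iota 0 n.-1).
have us : uniq s.
  rewrite map_inj_in_uniq ?iota_uniq// => a b; rewrite !mem_iota => an bn.
  by apply: (rot_inj (quad_rotw QD) ni); lia.
have sub : {subset s <= rem i (iota 0 n)}.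
  move=> a /mapP[t]; rewrite mem_iota => tm ->.
  have tm' : (t < n.-1)%N by lia.
  have [rn ri] := rot_lt (quad_rotw QD) ni tm'.
  rewrite mem_rem_uniq ?iota_uniq// inE mem_iota.
  by apply/andP; split; [exact/eqP | lia].
have sz : (size (rem i (iota 0 n)) <= size s)%N.
  by rewrite size_rem ?mem_iota; [rewrite size_map !size_iota | lia].
have [_ eqs] := uniq_min_size us sub sz.
have : j \in s.
  rewrite eqs mem_rem_uniq ?iota_uniq// inE mem_iota.
  by apply/andP; split; [apply/eqP => /esym | lia].
case/mapP => t; rewrite mem_iota => tm jE.
exists (qw i t), (rw i (nxt n.-1 t)); rewrite jE.
by apply: (rot_face (quad_rotw QD) ni); lia.
Qed.

Definition edge_pt (w w' : node) (t : R) (d : node) : R :=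
  (1 - t) * (d == w)%:R + t * (d == w')%:R.

Lemma edge_ptE i j i' j' t :
  edge_pt (Wh i) (Bl j) t = pt3 (Fc i i' j j') (Wh i) (Bl j) 0 (1 - t) t.
Proof.
apply/funext => d; rewrite /edge_pt /pt3; case: (eqVneq d (Fc i i' j j')) => [->|_].
  by rewrite !mulr0 addr0.
case: (eqVneq d (Wh i)) => [->|_]; first by rewrite mulr1 mulr0 addr0.
by rewrite mulr0 add0r; case: eqP => _; rewrite ?mulr1 ?mulr0.
Qed.

Lemma edge_pt_rev w w' t : edge_pt w' w t = edge_pt w w' (1 - t).
Proof. by apply/funext => d; rewrite /edge_pt subKr addrC. Qed.

Lemma quad_pt i i' j j' a0 a1 a2 : Q i i' j j' -> 0 <= a0 -> 0 <= a1 -> 0 <= a2 ->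
  a0 + a1 + a2 = 1 -> X (pt3 (Fc i i' j j') (Wh i) (Bl j) a0 a1 a2).
Proof.
move=> Qi p0 p1 p2 s1; exists i, i', j, j'; split=> //.
apply: bary_perm (bary_pt3 _ p0 p1 p2 s1) => //.
by rewrite perm_sym perm_cab.
Qed.

Lemma quad_ptP (x : X) : exists i i' j j' a0 a1 a2,
  [/\ Q i i' j j', [/\ 0 <= a0, 0 <= a1, 0 <= a2 & a0 + a1 + a2 = 1] &
      set_val x = pt3 (Fc i i' j j') (Wh i) (Bl j) a0 a1 a2].
Proof.
have [i [i' [j [j' [Qi xb]]]]] : X (set_val x) := set_valP x; have [x0 _ _] := xb.
have [xE x1] := bary3E (bary_perm (perm_cab _ _ _) xb).
by exists i, i', j, j', (set_val x (Fc i i' j j')), (set_val x (Wh i)), (set_val x (Bl j)).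
Qed.

Lemma edge_in_space i j t : (i < n)%N -> (j < n)%N -> i <> j -> 0 <= t <= 1 ->
  X (edge_pt (Wh i) (Bl j) t).
Proof.
move=> ni nj ij /andP[t0 t1]; have [i' [j' Qi]] := edge_in_quad ni nj ij.
rewrite (edge_ptE i j i' j'); apply: quad_pt => //; first by rewrite subr_ge0.
by rewrite add0r subrK.
Qed.

Lemma quad_origin : X (edge_pt (Wh 0) (Bl 1) 0).
Proof. by apply: edge_in_space => //; try lia; rewrite lexx ler01. Qed.

Definition quad_base : X := exist _ (edge_pt (Wh 0) (Bl 1) 0) (mem_set quad_origin).
Local Notation mk := (to_cplx quad_base).

Lemma pt3_continuous (T : topologicalType) (a0 a1 a2 : T -> R) d0 d1 d2 (d : node) :
  continuous a0 -> continuous a1 -> continuous a2 ->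
  continuous (fun t => pt3 d0 d1 d2 (a0 t) (a1 t) (a2 t) d).
Proof.
move=> c0 c1 c2; rewrite /pt3; case: (d == d0) => //; case: (d == d1) => //.
by case: (d == d2) => // t; exact: cvg_cst.
Qed.

(** Each triangle is the image of a square, one side of which is collapsed to the face centre. *)
Lemma quad_compact : compact [set: X].
Proof.
pose sq : set (R * R) := `[0, 1] `*` `[0, 1].
have csq : compact sq by apply: compact_setX; exact: segment_compact.
pose g i i' j j' (p : R * R) :=
  pt3 (Fc i i' j j') (Wh i) (Bl j) (1 - p.1) (p.1 * (1 - p.2)) (p.1 * p.2).
pose K (w : 'I_n * 'I_n * 'I_n * 'I_n) : set X :=
  (mk \o g w.1.1.1 w.1.1.2 w.1.2 w.2) @` sq.
pose P (w : 'I_n * 'I_n * 'I_n * 'I_n) : bool := Q w.1.1.1 w.1.1.2 w.1.2 w.2.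
have KP w : P w -> compact (K w).
  move=> Pw; apply: continuous_compact => //; apply: to_cplx_continuous => [p|d p _].
    rewrite /sq /= !in_itv /= => -[/andP[s0 s1] /andP[t0 t1]].
    apply: quad_pt => //; rewrite ?subr_ge0 ?mulr_ge0// ?subr_ge0//.
    by ring.
  apply: pt3_continuous => {}p.
  - by apply: cvgB; [exact: cvg_cst | exact: cvg_fst].
  - apply: cvgM; first exact: cvg_fst.
    by apply: cvgB; [exact: cvg_cst | exact: cvg_snd].
  - by apply: cvgM; [exact: cvg_fst | exact: cvg_snd].
have -> : [set: X] = \big[setU/set0]_(w <- enum {: 'I_n * 'I_n * 'I_n * 'I_n} | P w) K w.
  apply/esym; rewrite -subTset => x _.
  have [i [i' [j [j' [a0 [a1 [a2 [Qi [p0 p1 p2 s1] xE]]]]]]]] := quad_ptP x.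
  have [ni _ nj _] := quad_lt QD Qi; have [ni' nj' _] := quad_neq Qi.
  rewrite -bigcup_seq_cond.
  exists (Ordinal ni, Ordinal ni', Ordinal nj, Ordinal nj').
    by rewrite /= mem_enum.
  (* At the face centre the denominator is 0 and the quotient is 0 by convention; any value would
     do, since [a1] and [a2] vanish there. *)
  exists (1 - a0, a2 / (1 - a0)) => /=.
    rewrite /sq /= !in_itv /=; split; first by apply/andP; split; lra.
    have [->|a01] := eqVneq a0 1; first by rewrite subrr invr0 mulr0 lexx ler01.
    have h : 0 < 1 - a0 by rewrite lt_neqAle eq_sym subr_eq0 eq_sym a01; lra.
    by rewrite divr_ge0 ?(ltW h)//= ler_pdivrMr// mul1r; lra.
  rewrite -[RHS](to_cplx_val quad_base); congr (to_cplx _ _).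
  rewrite xE /g /= subKr.
  have [a01|a01] := eqVneq a0 1.
    have [-> ->] : a1 = 0 /\ a2 = 0 by split; lra.
    by rewrite a01 subrr !mul0r.
  have h : 1 - a0 != 0 by rewrite subr_eq0 eq_sym.
  have -> : a1 = 1 - a0 - a2 by lra.
  by congr pt3; field.
exact: bigsetU_compact KP.
Qed.

Let joined (x y : X) := connected_component [set: X] x y.

Let segment_joined (g : R -> node -> R) :
  (forall d, continuous (g ^~ d)) -> (forall t, 0 <= t <= 1 -> X (g t)) ->
  joined (mk (g 0)) (mk (g 1)).
Proof.
move=> gc gX; have cI : connected (`[0, 1]%classic : set R).
  exact/connected_intervalP/interval_is_interval.
have h : connected ((mk \o g) @` `[0, 1]%classic).
  apply: connected_continuous_connected cI _.
  apply: to_cplx_continuous => [t|d t _]; last exact: gc.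
  by rewrite /= in_itv /=; exact: gX.
apply: (connected_component_max _ _ h) => //=.
- by exists 0; rewrite //= in_itv /= lexx ler01.
- by exists 1; rewrite //= in_itv /= lexx ler01.
Qed.

Let edge_joined i j : (i < n)%N -> (j < n)%N -> i <> j ->
  joined (mk (edge_pt (Wh i) (Bl j) 0)) (mk (edge_pt (Wh i) (Bl j) 1)).
Proof.
move=> ni nj ij; apply: segment_joined => [d t|t t01]; last exact: edge_in_space.
apply: cvgD; apply: cvgM; try exact: cvg_cst; try exact: cvg_id.
by apply: cvgB; [exact: cvg_cst | exact: cvg_id].
Qed.

(** At parameter 0 the second node is a dummy, so [edge_pt (Wh i) (Bl 1) 0] stands for the vertex
    [Wh i] even if there is no such edge. *)
Let edge_pt0 w w' w'' : edge_pt w w' 0 = edge_pt w w'' 0.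
Proof. by apply/funext => d; rewrite /edge_pt !mul0r. Qed.

Let edge_pt1 w w' w'' : edge_pt w' w 1 = edge_pt w'' w 1.
Proof. by apply/funext => d; rewrite /edge_pt subrr !mul0r. Qed.

(** A white vertex reaches [Wh 0] through a black vertex whose index differs from both, and any
    point is joined by a segment to the white corner of its triangle. *)
Lemma quad_connected : connected [set: X].
Proof.
have joinedS x y : joined x y -> joined y x by exact: connected_component_sym.
have joinedT x y z : joined x y -> joined y z -> joined x z.
  by move=> xy yz; exact: connected_component_trans xy yz.
have white i : (i < n)%N ->
    joined (mk (edge_pt (Wh 0) (Bl 1) 0)) (mk (edge_pt (Wh i) (Bl 1) 0)).
  move=> ni; have [->|i0] := eqVneq i 0%N; first exact: connected_component_refl.
  have [j [nj ij j0]] : exists j, [/\ (j < n)%N, i <> j & 0%N <> j].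
    by exists (if i == 1%N then 2%N else 1%N); case: eqP; split; lia.
  rewrite (edge_pt0 (Wh 0) (Bl 1) (Bl j)) (edge_pt0 (Wh i) (Bl 1) (Bl j)).
  have n0 : (0 < n)%N by lia.
  apply: joinedT (edge_joined n0 nj j0) _; rewrite (edge_pt1 (Bl j) (Wh 0) (Wh i)).
  exact/joinedS/edge_joined.
suff all x : joined (mk (edge_pt (Wh 0) (Bl 1) 0)) x.
  have -> : [set: X] = connected_component [set: X] (mk (edge_pt (Wh 0) (Bl 1) 0)).
    by apply/seteqP; split=> // x _; exact: all.
  exact: component_connected.
have [i [i' [j [j' [a0 [a1 [a2 [Qi [p0 p1 p2 s1] xE]]]]]]]] := quad_ptP x.
have [ni _ nj _] := quad_lt QD Qi.
apply: joinedT (white i ni) _; rewrite -(to_cplx_val quad_base x) xE.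
pose g t := pt3 (Fc i i' j j') (Wh i) (Bl j) (t * a0) (1 - t + t * a1) (t * a2).
have -> : edge_pt (Wh i) (Bl 1) 0 = g 0.
  by rewrite (edge_pt0 _ _ (Bl j)) (edge_ptE i j i' j') /g !mul0r addr0.
have -> : pt3 (Fc i i' j j') (Wh i) (Bl j) a0 a1 a2 = g 1.
  by rewrite /g !mul1r subrr add0r.
apply: segment_joined => [d|t /andP[t0 t1]].
  apply: pt3_continuous => t.
  - by apply: cvgM; [exact: cvg_id | exact: cvg_cst].
  - apply: cvgD; last by apply: cvgM; [exact: cvg_id | exact: cvg_cst].
    by apply: cvgB; [exact: cvg_cst | exact: cvg_id].
  - by apply: cvgM; [exact: cvg_id | exact: cvg_cst].
apply: quad_pt Qi _ _ _ _; first exact: mulr_ge0.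
- by rewrite addr_ge0 ?mulr_ge0 ?subr_ge0.
- exact: mulr_ge0.
have -> : a0 = 1 - a1 - a2 by lra.
by ring.
Qed.

Lemma star_open (w : node) : open [set x : X | 0 < set_val x w].
Proof.
have /continuousP := @coord_continuous R node X w.
by move=> /(_ [set y | 0 < y]); apply; exact: open_gt.
Qed.

Lemma quad_closed_surface : closed_surface R X.
Proof.
split; [exact: quad_compact | exact: coord_hausdorff | exact: quad_connected |].
move=> x; have [i [i' [j [j' [a0 [a1 [a2 [Qi [p0 p1 p2 s1] xE]]]]]]]] :=
  quad_ptP x.
have [ni _ nj _] := quad_lt QD Qi.
have [a00|a00] := ltP 0 a0.
  exists [set x : X | 0 < set_val x (Fc i i' j j')]; split.
  - exact: star_open.
  - by rewrite /= xE /pt3 eqxx.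
  - exact: (face_star_disk R QD Qi).
have [a10|a10] := ltP 0 a1.
  exists [set x : X | 0 < set_val x (Wh i)]; split.
  - exact: star_open.
  - by rewrite /= xE /pt3 eqxx.
  - exact: (white_star_disk R n4 QD).
exists [set x : X | 0 < set_val x (Bl j)]; split.
- exact: star_open.
- by rewrite /= xE /pt3 eqxx /=; lra.
- exact: (black_star_disk R n4 QD).
Qed.

End Surface.

(** * The embedded graph and its faces *)

Section Embedding.
Variables (R : realType) (n : nat) (Q : nat -> nat -> nat -> nat -> bool).
Variables (rw qw rb qb : nat -> nat -> nat).
Hypothesis n4 : (3 < n)%N.
Hypothesis QD : quadrangulation n Q rw qw rb qb.
Local Notation X := (@quad_space R Q).
Local Notation mk := (to_cplx (quad_base R n4 QD)).

Definition node_of (v : G n n n) : node :=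
  match v with inl i => Wh i | inr j => Bl j end.
Definition quad_arc (u v : G n n n) (t : R) : X := mk (edge_pt (node_of u) (node_of v) t).
Definition quad_pnt (v : G n n n) : X := mk (edge_pt (node_of v) (node_of v) 0).
Local Notation pt := quad_pnt.
Local Notation arc := quad_arc.

Lemma node_of_inj : injective node_of.
Proof.
by move=> [i|i] [j|j] //= => [/Wh_inj|/Bl_inj] => /val_inj->.
Qed.

Lemma adjP (u v : G n n n) : adj u v -> exists i j : 'I_n, (i : nat) <> j /\
  (u = inl i /\ v = inr j \/ u = inr j /\ v = inl i).
Proof.
case: u v => [i|j] [i'|j'] //=; rewrite ltn_ord andbT => /eqP ij.
  by exists i, j'; split=> //; left.
by exists i', j; split=> //; right.
Qed.

Lemma edge_pt0E w w' d : edge_pt w w' 0 d = (d == w)%:R :> R.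
Proof. by rewrite /edge_pt subr0 mul1r mul0r addr0. Qed.

Lemma edge_pt1E w w' d : edge_pt w w' 1 d = (d == w')%:R :> R.
Proof. by rewrite /edge_pt subrr mul1r mul0r add0r. Qed.

Lemma arc_in u v t : adj u v -> 0 <= t <= 1 -> X (edge_pt (node_of u) (node_of v) t).
Proof.
move=> /adjP[i [j [ij [[-> ->]|[-> ->]]]]] t01 /=; last first.
  rewrite edge_pt_rev; apply: (edge_in_space n4 QD) => //.
  by move: t01 => /andP[? ?]; apply/andP; split; lra.
exact: (edge_in_space n4 QD).
Qed.

Lemma pnt_in v : X (edge_pt (node_of v) (node_of v) 0).
Proof.
have [u uv] : exists u, adj v u.
  have pick k : exists l : 'I_n, k <> l :> nat.
    have h : ((if k == 0 then 1 else 0) < n)%N by case: ifP; lia.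
    by exists (Ordinal h) => /=; case: ifP; lia.
  case: v => [i|j].
    by have [l il] := pick i; exists (inr l) => /=; rewrite ltn_ord andbT; apply/eqP.
  by have [l jl] := pick j; exists (inl l) => /=; rewrite ltn_ord andbT; apply/eqP/nesym.
have := @arc_in v u 0 uv; rewrite lexx ler01 => /(_ isT).
by congr (quad_space _ _); apply/funext => d; rewrite !edge_pt0E.
Qed.

Lemma pnt_val v d : set_val (pt v) d = (d == node_of v)%:R.
Proof. by rewrite to_cplxK ?edge_pt0E//; exact: pnt_in. Qed.

Lemma arc_val u v t d : adj u v -> 0 <= t <= 1 ->
  set_val (arc u v t) d = (1 - t) * (d == node_of u)%:R + t * (d == node_of v)%:R.
Proof. by move=> uv t01; rewrite to_cplxK//; exact: arc_in. Qed.

Lemma adj_node_of u v : adj u v -> node_of u != node_of v.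
Proof. by move=> /adjP[i [j [ij [[-> ->]|[-> ->]]]]]. Qed.

Lemma quad_embedding : embedding pt arc.
Proof.
have itv01 (t : R) : 0 < t < 1 -> 0 <= t <= 1 by move=> /andP[? ?]; rewrite !ltW.
split.
- move=> u v uv; apply: node_of_inj; apply/eqP.
  have : set_val (pt u) (node_of u) = set_val (pt v) (node_of u) by rewrite uv.
  rewrite !pnt_val eqxx; case: eqP => // _ /eqP; by rewrite oner_eq0.
- move=> u v uv; apply: to_cplx_continuous => [t|d t _].
    by rewrite /= in_itv /=; exact: arc_in.
  apply: cvgD; apply: cvgM; try exact: cvg_cst; try exact: cvg_id.
  by apply: cvgB; [exact: cvg_cst | exact: cvg_id].
- by move=> u v uv; congr to_cplx; apply/funext => d; rewrite !edge_pt0E.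
- by move=> u v uv; congr to_cplx; apply/funext => d; rewrite edge_pt1E edge_pt0E.
- by move=> u v t uv t01; congr to_cplx; exact: edge_pt_rev.
- move=> u v w t uv t01 e; have [t0 t1] := andP t01; have tw := itv01 _ t01.
  have uv' := adj_node_of uv.
  have ew d : set_val (arc u v t) d = set_val (pt w) d by rewrite e.
  have := ew (node_of v); have := ew (node_of u).
  rewrite !pnt_val !arc_val// !eqxx (eq_sym (node_of v)) (negPf uv').
  case: eqP => [<-|_]; first by rewrite (eq_sym (node_of v)) (negPf uv') /=; lra.
  by move=> /= ? _; lra.
- move=> u v u' v' s t uv uv' s01 t01 e.
  have [s0 s1] := andP s01; have [t0 t1] := andP t01.
  have ew w : (1 - s) * (w == node_of u)%:R + s * (w == node_of v)%:R =
              (1 - t) * (w == node_of u')%:R + t * (w == node_of v')%:R.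
    by rewrite -!arc_val ?itv01// e.
  have nuv := adj_node_of uv; have nuv' := adj_node_of uv'.
  (* An interior point of an edge has nonzero weight exactly at the two ends, so the weights at [u]
     and [v] identify the other edge, its direction and the parameter. *)
  have := ew (node_of u); have := ew (node_of v).
  rewrite !eqxx (eq_sym (node_of v) (node_of u)) (negPf nuv).
  case: (eqVneq (node_of u) (node_of u')) => [uu|_].
    rewrite -uu (eq_sym (node_of v) (node_of u)) (negPf nuv) /=.
    case: (eqVneq (node_of u) (node_of v')) => [uv2|_]; first by rewrite -uu uv2 eqxx in nuv'.
    case: (eqVneq (node_of v) (node_of v')) => [vv|_] /= e1 e2; last by exfalso; lra.
    by left; split; [exact: node_of_inj | exact: node_of_inj | lra].
  case: (eqVneq (node_of u) (node_of v')) => [uv2|_]; last by move=> /= _ ?; exfalso; lra.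
  rewrite -uv2 (eq_sym (node_of v) (node_of u)) (negPf nuv).
  case: (eqVneq (node_of v) (node_of u')) => [vu|_] /= e1 e2; last by exfalso; lra.
  by right; split; [exact: node_of_inj | exact: node_of_inj | lra].
Qed.

Local Notation star i i' j j' := [set x : X | 0 < set_val x (Fc i i' j j')].

Lemma star_unique (x : X) i i' j j' k k' l l' :
  0 < set_val x (Fc i i' j j') -> 0 < set_val x (Fc k k' l l') ->
  Fc i i' j j' = Fc k k' l l'.
Proof.
have [i1 [i1' [j1 [j1' [a0 [a1 [a2 [_ _ ->]]]]]]]] := quad_ptP x.
rewrite /pt3; case: eqP => [-> _|_]; last by rewrite /= ltxx.
by case: eqP => [->//|_]; rewrite /= ltxx.
Qed.

(** On a drawn point every face-centre coordinate vanishes; conversely, a point of a triangle with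
    zero weight at the centre lies on the opposite side, which is an edge. *)
Lemma quad_drawingP (x : X) : (~` drawing pt arc) x <->
  exists i i' j j', Q i i' j j' /\ star i i' j j' x.
Proof.
have zero (y : X) i i' j j' : drawing pt arc y -> set_val y (Fc i i' j j') = 0.
  case=> [[v _ <-]|[u [v [t [uv t01 ->]]]]].
    by rewrite pnt_val; case: v.
  rewrite arc_val//; have [i1 [j1 [_ [[-> ->]|[-> ->]]]]] := adjP uv;
    by rewrite /= !mulr0 addr0.
split=> [xD|[i [i' [j [j' [_ xF]]]]] /zero x0]; last by rewrite /= x0 ltxx in xF.
have [i [i' [j [j' [a0 [a1 [a2 [Qi [p0 p1 p2 s1] xE]]]]]]]] := quad_ptP x.
exists i, i', j, j'; split=> //=; rewrite xE /pt3 eqxx lt_neqAle p0 andbT.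
apply/eqP => a00; apply: xD; right.
have [ni _ nj _] := quad_lt QD Qi; have [_ _ [ij _ _ _]] := quad_neq n4 QD Qi.
exists (inl (Ordinal ni)), (inr (Ordinal nj)), a2; split.
- by rewrite /= ni andbT; apply/eqP.
- by apply/andP; split; lra.
rewrite -[LHS](to_cplx_val (quad_base R n4 QD)) xE; congr to_cplx.
by rewrite /= (edge_ptE i j i' j') -a00; congr pt3; lra.
Qed.

(** Star-shapedness: [a x] runs along the segment from the face centre, at [t = 0], to [x], at
    [t = 1]. *)
Lemma star_connected i i' j j' : Q i i' j j' -> connected (star i i' j j').
Proof.
move=> Qi; pose a (x : X) (t : R) : node -> R := fun d =>
  (1 - t) * (d == Fc i i' j j')%:R + t * set_val x d.
have aX (x : X) t : star i i' j j' x -> 0 <= t <= 1 -> X (a x t).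
  move=> xF /andP[t0 t1].
  have [k [k' [l [l' [a0 [a1 [a2 [Qk [p0 p1 p2 s1] xE]]]]]]]] := quad_ptP x.
  have kF : Fc k k' l l' = Fc i i' j j'.
    move: xF; rewrite /= xE /pt3; case: eqP => [->//|_] /=; by rewrite ltxx.
  suff -> : a x t = pt3 (Fc k k' l l') (Wh k) (Bl l) (1 - t + t * a0) (t * a1) (t * a2).
    apply: (quad_pt Qk).
    - by rewrite addr_ge0 ?mulr_ge0 ?subr_ge0.
    - exact: mulr_ge0.
    - exact: mulr_ge0.
    have -> : a0 = 1 - a1 - a2 by lra.
    by ring.
  apply/funext => d; rewrite /a xE -kF /pt3.
  case: (eqVneq d (Fc k k' l l')) => _; first by rewrite mulr1.
  by rewrite mulr0 add0r; case: (d == Wh k) => //; case: (d == Bl l); rewrite ?mulr0.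
have a1 (x : X) : mk (a x 1) = x.
  rewrite -[RHS](to_cplx_val (quad_base R n4 QD)); congr to_cplx; apply/funext => d.
  by rewrite /a subrr mul0r add0r mul1r.
have [[c cF]|no] := pselect (exists c : X, star i i' j j' c); last first.
  suff -> : star i i' j j' = set0 by exact: connected0.
  by apply/seteqP; split=> // x xF; apply: no; exists x.
have -> : star i i' j j' =
    \bigcup_(x in star i i' j j') ((mk \o a x) @` `[0, 1]%classic).
  apply/seteqP; split=> [x xF|y [x xF [t]]].
    exists x => //; exists 1; last exact: a1.
    by rewrite /= in_itv /= lexx ler01.
  rewrite /= in_itv /= => t01 <-; rewrite to_cplxK; last exact: aX.
  have [t0 t1] := andP t01; rewrite /a eqxx mulr1.
  have [->|tn] := eqVneq t 0; first by rewrite subr0 mul0r addr0.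
  by rewrite ltr_wpDl ?subr_ge0// mulr_gt0// lt_neqAle eq_sym tn.
apply: bigcup_connected.
  exists (mk (a c 0)) => x xF; exists 0; first by rewrite /= in_itv /= lexx ler01.
  by congr to_cplx; apply/funext => d; rewrite /a !mul0r.
move=> x xF; apply: connected_continuous_connected.
  exact/connected_intervalP/interval_is_interval.
apply: to_cplx_continuous => [t|d t _]; first by rewrite /= in_itv /=; exact: aX.
apply: cvgD; apply: cvgM; try exact: cvg_cst; try exact: cvg_id.
by apply: cvgB; [exact: cvg_cst | exact: cvg_id].
Qed.

(** The stars of the face centres are open, pairwise disjoint and cover the complement of the
    drawing. Each is therefore open and closed in it and, being connected, is a component. *)
Lemma quad_face F : face pt arc F ->
  exists i i' j j', Q i i' j j' /\ F = star i i' j j'.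
Proof.
move=> [x xD ->]; have [i [i' [j [j' [Qi xF]]]]] := (quad_drawingP x).1 xD.
exists i, i', j, j'; split=> //; apply/seteqP; split; last first.
  apply: connected_component_max => //; last exact: star_connected.
  by move=> y yF; apply/quad_drawingP; exists i, i', j, j'.
set C := connected_component _ _.
have CD : C `<=` ~` drawing pt arc by exact: connected_component_sub.
have Cc : connected C by exact: component_connected.
suff CE : C `&` star i i' j j' = C by rewrite -CE => y [].
apply: Cc.
- by exists x; split=> //; exact: connected_component_refl.
- by exists (star i i' j j') => //; exact: star_open.
(* The union of the other stars; names that belong to no face only contribute empty sets. *)
pose O : set X := \bigcup_(w in [set w | w != Fc i i' j j' /\ exists k k' l l', w = Fc k k' l l'])
  [set y : X | 0 < set_val y w].
exists (~` O).
  by rewrite closedC; apply: bigcup_open => w _; exact: star_open.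
apply/seteqP; split=> [y [Cy yF]|y [Cy yO]]; split=> //.
  move=> [w [wF [k [k' [l [l' wE]]]]] /= yw]; rewrite wE in yw wF.
  by rewrite (star_unique yw yF) eqxx in wF.
have [k [k' [l [l' [_ yk]]]]] := (quad_drawingP y).1 (CD _ Cy).
have [<-//|kF] := eqVneq (Fc k k' l l') (Fc i i' j j').
by exfalso; apply: yO; exists (Fc k k' l l') => //; split=> //; exists k, k', l, l'.
Qed.

(* Barycentric coordinates over the square cut into four triangles by its
   diagonals, the white corners being the images of (0, 0) and (1, 1). *)
Definition square_pt (i i' j j' : nat) (p : R * R) (d : node) : R :=
  let a := Num.max 0 (1 - p.1 - p.2) in let b := Num.max 0 (p.1 - p.2) in
  let c := Num.max 0 (p.1 + p.2 - 1) in let e := Num.max 0 (p.2 - p.1) in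
  a * (d == Wh i)%:R + b * (d == Bl j)%:R + c * (d == Wh i')%:R + e * (d == Bl j')%:R
  + (1 - a - b - c - e) * (d == Fc i i' j j')%:R.

Let max0P (x : R) : (Num.max 0 x = x /\ Num.max 0 (- x) = 0) \/
  (Num.max 0 x = 0 /\ Num.max 0 (- x) = - x).
Proof.
have [x0|/ltW x0] := leP 0 x; [left | right]; split=> //.
  by rewrite max_l// oppr_le0.
by rewrite max_r// oppr_ge0.
Qed.

Let max0_sub (x y : R) : 0 <= x -> 0 <= y -> x = 0 \/ y = 0 -> Num.max 0 (x - y) = x.
Proof.
move=> x0 y0 [->|->]; last by rewrite subr0 max_r.
by rewrite sub0r max_l// oppr_le0.
Qed.

Lemma pt3_sum (d0 d1 d2 : node) (a0 a1 a2 : R) d : uniq [:: d0; d1; d2] ->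
  pt3 d0 d1 d2 a0 a1 a2 d = a0 * (d == d0)%:R + a1 * (d == d1)%:R + a2 * (d == d2)%:R.
Proof.
rewrite /= !inE negb_or andbT /pt3 => /andP[/andP[d01 d02] d12].
case: (eqVneq d d0) => [->|_]; first by rewrite (negPf d01) (negPf d02) /=; ring.
case: (eqVneq d d1) => [->|_]; first by rewrite (negPf d12) /=; ring.
by case: eqP => _ /=; ring.
Qed.

(** The diagonals cut out four triangles, and the symmetries of [Q] bring each of them to the
    standard form of [quad_pt]. *)
Lemma square_in i i' j j' p : Q i i' j j' -> closed_square p -> X (square_pt i i' j j' p).
Proof.
case: p => p q Qi; rewrite /closed_square /= !in_itv /= => -[/andP[p0 p1] /andP[q0 q1]].
have Q1 := quad_symw QD Qi; have Q2 := quad_symb QD Qi; have Q3 := quad_symb QD Q1.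
have [h1|h1] := leP 0 (1 - p - q); have [h2|h2] := leP 0 (p - q).
- suff -> : square_pt i i' j j' (p, q) =
      pt3 (Fc i i' j j') (Wh i) (Bl j) (2 * q) (1 - p - q) (p - q).
    by apply: quad_pt => //; lra.
  apply/funext => d; rewrite pt3_sum// /square_pt /=.
  by rewrite (max_r h1) (max_r h2) !max_l; [ring | lra..].
- suff -> : square_pt i i' j j' (p, q) =
      pt3 (Fc i i' j' j) (Wh i) (Bl j') (2 * p) (1 - p - q) (q - p).
    by apply: quad_pt => //; lra.
  apply/funext => d; rewrite pt3_sum// /square_pt /= (FcSb i i' j').
  by rewrite (max_r h1) (@max_r _ _ 0 (q - p)) ?(max_l (ltW h2)) ?max_l; [ring | lra..].
- suff -> : square_pt i i' j j' (p, q) =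
      pt3 (Fc i' i j j') (Wh i') (Bl j) (2 * (1 - p)) (p + q - 1) (p - q).
    by apply: quad_pt => //; lra.
  apply/funext => d; rewrite pt3_sum// /square_pt /= (FcSw i').
  by rewrite (max_l (ltW h1)) (max_r h2) (@max_r _ _ 0 (p + q - 1)) ?max_l; [ring | lra..].
- suff -> : square_pt i i' j j' (p, q) =
      pt3 (Fc i' i j' j) (Wh i') (Bl j') (2 * (1 - q)) (p + q - 1) (q - p).
    by apply: quad_pt => //; lra.
  apply/funext => d; rewrite pt3_sum// /square_pt /= (FcSw i') (FcSb i i' j').
  rewrite (max_l (ltW h1)) (max_l (ltW h2)) (@max_r _ _ 0 (p + q - 1)); last by lra.
  by rewrite max_r; [ring | lra].
Qed.

Lemma square_continuous i i' j j' d : continuous (fun p => square_pt i i' j j' p d).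
Proof.
move=> p; have a c : Num.max 0 (c - q.1 - q.2) @[q --> p] --> Num.max 0 (c - p.1 - p.2).
  apply: cvg_max; first exact: cvg_cst.
  apply: cvgB; last exact: cvg_snd.
  by apply: cvgB; [exact: cvg_cst | exact: cvg_fst].
have b : Num.max 0 (q.1 - q.2) @[q --> p] --> Num.max 0 (p.1 - p.2).
  apply: cvg_max; first exact: cvg_cst.
  by apply: cvgB; [exact: cvg_fst | exact: cvg_snd].
have c : Num.max 0 (q.1 + q.2 - 1) @[q --> p] --> Num.max 0 (p.1 + p.2 - 1).
  apply: cvg_max; first exact: cvg_cst.
  apply: cvgB; last exact: cvg_cst.
  by apply: cvgD; [exact: cvg_fst | exact: cvg_snd].
have e : Num.max 0 (q.2 - q.1) @[q --> p] --> Num.max 0 (p.2 - p.1).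
  apply: cvg_max; first exact: cvg_cst.
  by apply: cvgB; [exact: cvg_snd | exact: cvg_fst].
rewrite /square_pt; apply: cvgD; last first.
  apply: cvgM; last exact: cvg_cst.
  apply: cvgB; last exact: e.
  apply: cvgB; last exact: c.
  apply: cvgB; last exact: b.
  by apply: cvgB; [exact: cvg_cst | exact: a].
apply: cvgD; last by apply: cvgM; [exact: e | exact: cvg_cst].
apply: cvgD; last by apply: cvgM; [exact: c | exact: cvg_cst].
apply: cvgD; last by apply: cvgM; [exact: b | exact: cvg_cst].
by apply: cvgM; [exact: a | exact: cvg_cst].
Qed.

Lemma square_bounds i i' j j' : Q i i' j j' ->
  forall (ni : (i < n)%N) (ni' : (i' < n)%N) (nj : (j < n)%N) (nj' : (j' < n)%N),
  bounded_by arc (star i i' j j') (inl (Ordinal ni)) (inr (Ordinal nj))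
    (inl (Ordinal ni')) (inr (Ordinal nj')).
Proof.
move=> Qi ni ni' nj nj'; have [_ _ [ij ij' i'j i'j']] := quad_neq n4 QD Qi.
have [_ ii' _ jj'] := quad_lt QD Qi.
split.
  by rewrite /= ni ni' !andbT; split; apply/eqP.
have Wii : (Wh i == Wh i') = false by apply/eqP => /Wh_inj.
have Wi'i : (Wh i' == Wh i) = false by apply/eqP => /Wh_inj/esym.
have Bjj : (Bl j == Bl j') = false by apply/eqP => /Bl_inj.
have Bj'j : (Bl j' == Bl j) = false by apply/eqP => /Bl_inj/esym.
have cF : Fc i i' j j' == Fc i i' j j' by [].
have osq p : open_square p -> @closed_square R p.
  case: p => p q; rewrite /open_square /closed_square /= !in_itv /=.
  by move=> [/andP[? ?] /andP[? ?]]; split; apply/andP; split; exact: ltW.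
exists (mk \o square_pt i i' j j'); split.
- apply: to_cplx_continuous => [p|d p _]; first exact: square_in.
  exact: square_continuous.
(* The inverse solves [a - c = 1 - p.1 - p.2] and [b - e = p.1 - p.2] for the point [p]. *)
- exists (fun x : X =>
    let a := set_val x (Wh i) in let b := set_val x (Bl j) in
    let c := set_val x (Wh i') in let e := set_val x (Bl j') in
    ((1 - a + b + c - e) / 2, (1 - a - b + c + e) / 2)).
  split.
  + apply: to_cplx_continuous => [p /osq|d p _]; first exact: square_in.
    exact: square_continuous.
  + apply: continuous_in_within => x _.
    have FF := nbhs_filter x.
    have main (F : set_system X) : Filter F -> F --> x ->
        (fun y : X => ((1 - set_val y (Wh i) + set_val y (Bl j) + set_val y (Wh i')
           - set_val y (Bl j')) / 2, (1 - set_val y (Wh i) - set_val y (Bl j)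
           + set_val y (Wh i') + set_val y (Bl j')) / 2)) @ F -->
        (((1 - set_val x (Wh i) + set_val x (Bl j) + set_val x (Wh i')
           - set_val x (Bl j')) / 2, (1 - set_val x (Wh i) - set_val x (Bl j)
           + set_val x (Wh i') + set_val x (Bl j')) / 2) : (R * R)%type).
      move=> {}FF Fx.
      have cv d : set_val y d @[y --> F] --> set_val x d.
        by apply: cvg_trans (@coord_continuous _ _ X d x); exact: cvg_app.
      have c1 : cvg_to (nbhs (@cst X R 1 @ F)) (nbhs (1 : R)) by exact: cvg_cst.
      apply: cvg_pairR; (apply: cvgM; last exact: cvg_cst).
        apply: cvgB; last exact: cv.
        apply: cvgD; last exact: cv.
        by apply: cvgD; last exact: cv; apply: cvgB; last exact: cv.
      apply: cvgD; last exact: cv.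
      apply: cvgD; last exact: cv.
      by apply: cvgB; last exact: cv; apply: cvgB; last exact: cv.
    exact: main.
  + move=> [p q] pq; rewrite /= !to_cplxK; last by apply: square_in => //; exact: osq.
    move: pq; rewrite /open_square /= !in_itv /= => -[/andP[p0 p1] /andP[q0 q1]].
    rewrite /square_pt /= !eqxx Wii Wi'i Bjj Bj'j /= !mulr0 !mulr1 !addr0 !add0r.
    have -> : p + q - 1 = - (1 - p - q) by lra.
    have -> : q - p = - (p - q) by lra.
    by case: (max0P (1 - p - q)) => -[-> ->]; case: (max0P (p - q)) => -[-> ->];
      (split; [lra | congr (_, _); lra]).
  + move=> x /= xF; set a := set_val x (Wh i); set b := set_val x (Bl j).
    set c := set_val x (Wh i'); set e := set_val x (Bl j').
    (* A triangle contains one white and one black corner, so one of [a], [c] and one of [b], [e]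
       vanish: all four are recovered as positive and negative parts of the two differences. *)
    have [f [f0 s1 [a0 b0 c0 e0] [ac be] xE]] : exists f, [/\ 0 < f,
        a + b + c + e + f = 1, [/\ 0 <= a, 0 <= b, 0 <= c & 0 <= e],
        (a = 0 \/ c = 0) /\ (b = 0 \/ e = 0) &
        forall d, set_val x d = a * (d == Wh i)%:R + b * (d == Bl j)%:R +
          c * (d == Wh i')%:R + e * (d == Bl j')%:R + f * (d == Fc i i' j j')%:R].
      have [k [k' [l [l' [f [a1 [a2 [Qk [p0 p1 p2 s1] xE]]]]]]]] := quad_ptP x.
      have FE : Fc k k' l l' = Fc i i' j j'.
        by move: xF; rewrite /= xE /pt3; case: eqP => [->//|_] /=; rewrite ltxx.
      exists f; rewrite /a /b /c /e.
      have f0 : 0 < f by move: xF; rewrite /= xE /pt3 FE eqxx.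
      have {}xE d : set_val x d = f * (d == Fc i i' j j')%:R + a1 * (d == Wh k)%:R
          + a2 * (d == Bl l)%:R by rewrite xE pt3_sum// FE.
      have [ki lj] := Fc_inj FE.
      have {}ki : k = i \/ k = i' by case: ki => -[]; [left | right].
      have {}lj : l = j \/ l = j' by case: lj => -[]; [left | right].
      case: ki lj xE => -> [] -> xE.
      - have [-> -> -> ->] : [/\ set_val x (Wh i) = a1, set_val x (Bl j) = a2,
            set_val x (Wh i') = 0 & set_val x (Bl j') = 0].
          by split; rewrite xE ?eqxx ?Wii ?Wi'i ?Bjj ?Bj'j /=; ring.
        split=> //; first by lra.
          by split; [right | right].
        by move=> d; rewrite xE; ring.
      - have [-> -> -> ->] : [/\ set_val x (Wh i) = a1, set_val x (Bl j) = 0,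
            set_val x (Wh i') = 0 & set_val x (Bl j') = a2].
          by split; rewrite xE ?eqxx ?Wii ?Wi'i ?Bjj ?Bj'j /=; ring.
        split=> //; first by lra.
          by split; [right | left].
        by move=> d; rewrite xE; ring.
      - have [-> -> -> ->] : [/\ set_val x (Wh i) = 0, set_val x (Bl j) = a2,
            set_val x (Wh i') = a1 & set_val x (Bl j') = 0].
          by split; rewrite xE ?eqxx ?Wii ?Wi'i ?Bjj ?Bj'j /=; ring.
        split=> //; first by lra.
          by split; [left | right].
        by move=> d; rewrite xE; ring.
      - have [-> -> -> ->] : [/\ set_val x (Wh i) = 0, set_val x (Bl j) = 0,
            set_val x (Wh i') = a1 & set_val x (Bl j') = a2].
          by split; rewrite xE ?eqxx ?Wii ?Wi'i ?Bjj ?Bj'j /=; ring.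
        split=> //; first by lra.
          by split; [left | left].
        by move=> d; rewrite xE; ring.
    rewrite /open_square /= !in_itv /=; split.
      by split; apply/andP; split; lra.
    rewrite -[RHS](to_cplx_val (quad_base R n4 QD)); congr to_cplx; apply/funext => d.
    rewrite xE /square_pt /=.
    have -> : 1 - (1 - a + b + c - e) / 2 - (1 - a - b + c + e) / 2 = a - c by field.
    have -> : (1 - a + b + c - e) / 2 - (1 - a - b + c + e) / 2 = b - e by field.
    have -> : (1 - a + b + c - e) / 2 + (1 - a - b + c + e) / 2 - 1 = c - a by field.
    have -> : (1 - a - b + c + e) / 2 - (1 - a + b + c - e) / 2 = e - b by field.
    have [ca eb] : (c = 0 \/ a = 0) /\ (e = 0 \/ b = 0) by tauto.
    rewrite !max0_sub//; have -> : f = 1 - a - b - c - e by lra.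
    by [].
- move=> t /andP[t0 t1]; rewrite /arc /edge_pt /square_pt /=.
  by split; congr to_cplx; apply/funext => d /=;
    do 4 (first [rewrite (@max_l _ _ 0); last by lra | rewrite (@max_r _ _ 0); last by lra]);
    ring.
Qed.

Lemma quad_quadrangular : quadrangular pt arc.
Proof.
split=> F /quad_face[i [i' [j [j' [Qi ->]]]]].
  exact: (face_star_disk R QD Qi).
have [ni _ nj _] := quad_lt QD Qi; have [ni' nj' _] := quad_neq n4 QD Qi.
exists (inl (Ordinal ni)), (inr (Ordinal nj)), (inl (Ordinal ni')), (inr (Ordinal nj')).
exact: square_bounds.
Qed.

Lemma quadrangulation_embedding : nonorientable R X ->
  has_nonorientable_quadrangular_embedding R (G n n n).
Proof.
move=> no; exists X; split; [exact: (quad_closed_surface R n4 QD) | exact: no |].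
by exists pt, arc; split; [exact: quad_embedding | exact: quad_quadrangular].
Qed.

End Embedding.

(** * Criteria for rotations and strips *)

Lemma rotation_ext n Q Q' r q : (forall i i' j j', Q i i' j j' = Q' i i' j j') ->
  rotation n Q r q -> rotation n Q' r q.
Proof.
move=> QQ [h1 h2 h3 h4]; split=> // [i t ni nt|i i' j j'].
  by rewrite -QQ; exact: h3.
by rewrite -QQ; exact: h4.
Qed.

(** The opposite vertex is picked by choice. A corner determines its face, so the choice is forced,
    and this yields [rot_complete]. *)
Lemma rotation_of_unique n (Q : nat -> nat -> nat -> nat -> bool) r :
  (forall i t, (i < n)%N -> (t < n.-1)%N -> (r i t < n)%N /\ r i t <> i) ->
  (forall i s t, (i < n)%N -> (s < n.-1)%N -> (t < n.-1)%N -> r i s = r i t -> s = t) ->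
  (forall i t, (i < n)%N -> (t < n.-1)%N ->
     exists i', Q i i' (r i t) (r i (nxt n.-1 t))) ->
  (forall i i' i'' j j', Q i i' j j' -> Q i i'' j j' -> i' = i'') ->
  (forall i i' j j', Q i i' j j' -> Q i i' j' j) ->
  (forall i i' j j', Q i i' j j' -> (i < n)%N /\ exists2 t, (t < n.-1)%N &
     (j = r i t /\ j' = r i (nxt n.-1 t)) \/ (j' = r i t /\ j = r i (nxt n.-1 t))) ->
  exists q, rotation n Q r q.
Proof.
move=> rlt rinj rface runiq symb rcomp.
pose P i t i' := (i < n)%N -> (t < n.-1)%N -> Q i i' (r i t) (r i (nxt n.-1 t)).
have /choice[q qP] : forall it : nat * nat, exists i', P it.1 it.2 i'.
  move=> [i t]; rewrite /P /=.
  have [/andP[ni nt]|no] := boolP ((i < n)%N && (t < n.-1)%N).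
    by have [i' Qi] := rface _ _ ni nt; exists i'.
  by exists 0%N => ni nt; rewrite ni nt in no.
exists (fun i t => q (i, t)); split=> // [i t ni nt|i i' j j' Qi].
  exact: qP (i, t) ni nt.
have [ni [t tn jE]] := rcomp _ _ _ _ Qi; exists t => //; split=> //.
have := qP (i, t) ni tn => /= Qt.
by case: jE => -[e1 e2]; apply: runiq Qt; rewrite -e1 -e2 //; exact: symb.
Qed.

Lemma quad_strip (R : realType) (Q : nat -> nat -> nat -> nat -> bool)
    (k : nat) (u v : nat -> node) : (0 < k)%N ->
  (forall j, (j < k)%N -> u j.+1 = u j \/ v j.+1 = v j) ->
  (forall j, (j < k)%N -> exists i i' l l', Q i i' l l' /\
     perm_eq [:: u j; v j; strip_new u v j] [:: Wh i; Bl l; Fc i i' l l']) ->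
  (forall i j, (i < k)%N -> (j < k)%N ->
     perm_eq [:: u i; v i] [:: u j; v j] -> i = j) ->
  (forall i j, (i < k)%N -> (j < k)%N ->
     perm_eq [:: u i; v i; strip_new u v i] [:: u j; v j; strip_new u v j] -> i = j) ->
  u k = v 0%N -> v k = u 0%N -> nonorientable R (@quad_space R Q).
Proof.
move=> k0 step tri rung_inj tri_inj uk vk.
have uq j : (j < k)%N -> uniq [:: u j; v j; strip_new u v j].
  by move=> /tri[i [i' [l [l' [_ /perm_uniq->]]]]].
apply: (strip_nonorientable k0 step uq _ rung_inj tri_inj uk vk).
move=> j a0 a1 a2 jk p0 p1 p2 s1; have [i [i' [l [l' [Qi pe]]]]] := tri j jk.
by exists i, i', l, l'; split=> //; apply: bary_perm pe (bary_pt3 (uq _ jk) p0 p1 p2 s1).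
Qed.

(** * Translation-invariant schemes, with or without infinity *)

Section Scheme.
(* Vertices of either colour are the residues [i < m], and [m] itself, a point at
   infinity present only if [inf].  [add i d] is the residue [j] at label
   [L i j = d] from [i], and [sub] solves for [i]; a label is [m] as soon as one
   end is at infinity. *)
Variables (m : nat) (inf : bool) (add sub L : nat -> nat -> nat).
Variables (bal : nat -> nat -> nat -> nat -> Prop) (W : nat -> nat) (a0 b0 : nat).
Variable T : nat -> nat -> nat -> nat -> bool.
Local Notation n := (m + inf)%N.
Local Notation k := (n.-1).

Definition lab i j := if (i == m) || (j == m) then m else L i j.
Definition spin i t := if i == m then t else if W t == m then m else add i (W t).
(** In [T d a c b] the corners at [i] and [i'] have labels [d, a] and [c, b]; those at [j] and [j']
    have [d, c] and [a, b]. *)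
Definition scheme_quad i i' j j' := [&& (i < n)%N, (i' < n)%N, (j < n)%N, (j' < n)%N,
  i != i', j != j' & T (lab i j) (lab i j') (lab i' j) (lab i' j')].
Local Notation Q := scheme_quad.

Hypothesis m2 : (2 < m)%N.
Hypothesis add_lt : forall i d, (i < m)%N -> (d < m)%N -> (add i d < m)%N.
Hypothesis sub_lt : forall i d, (i < m)%N -> (d < m)%N -> (sub i d < m)%N.
Hypothesis L_lt : forall i j, (i < m)%N -> (j < m)%N -> (L i j < m)%N.
Hypothesis addK : forall i d, (i < m)%N -> (d < m)%N -> L i (add i d) = d.
Hypothesis LK : forall i j, (i < m)%N -> (j < m)%N -> add i (L i j) = j.
Hypothesis subK : forall j d, (j < m)%N -> (d < m)%N -> L (sub j d) j = d.
Hypothesis LsK : forall i j, (i < m)%N -> (j < m)%N -> sub j (L i j) = i.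
Hypothesis L0 : forall i, (i < m)%N -> L i i = 0%N.
Hypothesis balP : forall i d a c b, (i < m)%N -> (d < m)%N -> (a < m)%N ->
  (c < m)%N -> (b < m)%N -> bal d a c b -> L (sub (add i d) c) (add i a) = b.

Hypothesis W_pos : forall t, (t < k)%N -> (0 < W t)%N /\ (W t < n)%N.
Hypothesis W_inj : forall s t, (s < k)%N -> (t < k)%N -> W s = W t -> s = t.
Hypothesis T_sym : forall d a c b, T d a c b -> T a d b c.
(** The five cases: no corner at infinity, then infinity as [i'], as [i], as [j'], as [j]. In the
    first, [bal] says that the labels around the face close up. *)
Hypothesis T_type : forall d a c b, T d a c b ->
  [/\ 0 < d, 0 < a, 0 < c & 0 < b]%N /\
  [\/ [/\ (d < m)%N, (a < m)%N, (c < m)%N, (b < m)%N & bal d a c b /\ d <> c],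
      [/\ (d < m)%N, (a < m)%N, c = m & b = m],
      [/\ d = m, a = m, (c < m)%N & (b < m)%N] |
      [/\ (d < m)%N, a = m, (c < m)%N, b = m & d <> c] \/
      [/\ d = m, (a < m)%N, c = m, (b < m)%N & a <> b]].
Hypothesis T_face : forall t, (t < k)%N -> exists c b,
  T (W t) (W (nxt k t)) c b /\ (c <> m \/ b <> m \/ inf).
(** At a corner of an infinite vertex both labels are [m] and carry no information; such corners are
    governed by the hypotheses at the end. *)
Hypothesis T_uniq : forall d a c b c' b', (d <> m) \/ (a <> m) ->
  T d a c b -> T d a c' b' -> c = c' /\ b = b'.
Hypothesis T_complete : forall d a c b, (d <> m) \/ (a <> m) -> T d a c b ->
  exists2 t, (t < k)%N & (d = W t /\ a = W (nxt k t)) \/ (a = W t /\ d = W (nxt k t)).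
(* At infinity: the rotation is [0, 1, ..., m - 1], every face being a translate of
   a single one, whose labels are [a0], [b0]. *)
Hypothesis T_inf : forall c b, T m m c b -> (c = a0 /\ b = b0) \/ (c = b0 /\ b = a0).
Hypothesis T_inf0 : inf -> T m m a0 b0.
Hypothesis inf_lab : inf -> [/\ (0 < a0)%N, (a0 < m)%N, (0 < b0)%N & (b0 < m)%N].
Hypothesis inf_step : inf -> forall t, (t < m)%N -> L (sub t a0) (nxt m t) = b0.
Hypothesis inf_stepK : inf -> forall i j j', (i < m)%N -> (j < m)%N -> (j' < m)%N ->
  L i j = a0 -> L i j' = b0 -> j' = nxt m j.
Hypothesis inf_asym : inf -> forall j, (j < m)%N -> nxt m (nxt m j) <> j.

Let nxt_lt p t : (0 < p)%N -> (nxt p t < p)%N.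
Proof. by rewrite /nxt; case: ifP. Qed.

Let nxt_neq t : (t < m)%N -> nxt m t <> t.
Proof. by rewrite /nxt; case: ifP; lia. Qed.

Let labE i d : (i < m)%N -> (d < n)%N -> lab i (if d == m then m else add i d) = d.
Proof.
move=> im dn; rewrite /lab (_ : i == m = false); last by apply/eqP; lia.
have [->|dm] := eqVneq d m; first by rewrite eqxx.
have dm' : (d < m)%N by move: dn dm; case: (inf); lia.
rewrite (_ : add i d == m = false) /= ?addK//.
by apply/eqP; have := add_lt im dm'; lia.
Qed.

Let labK i j d : (i < m)%N -> (j < n)%N -> lab i j = d ->
  j = if d == m then m else add i d.
Proof.
move=> im jn <-; rewrite /lab (_ : i == m = false); last by apply/eqP; lia.
have [->|jm] /= := eqVneq j m; first by rewrite eqxx.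
have jm' : (j < m)%N by move: jn jm; case: (inf); lia.
by rewrite (_ : L i j == m = false) ?LK//; apply/eqP; have := L_lt im jm'; lia.
Qed.

Let labs i j d : (i < n)%N -> (j < m)%N -> lab i j = d ->
  i = if d == m then m else sub j d.
Proof.
move=> im jm <-; rewrite /lab (_ : j == m = false) ?orbF; last by apply/eqP; lia.
have [->|im0] /= := eqVneq i m; first by rewrite eqxx.
have im' : (i < m)%N by move: im im0; case: (inf); lia.
by rewrite (_ : L i j == m = false) ?LsK//; apply/eqP; have := L_lt im' jm; lia.
Qed.

Let lab_lt i j : (i < m)%N -> (j < m)%N -> lab i j <> m.
Proof.
move=> im jm; have := L_lt im jm; rewrite /lab.
have -> : (i == m) = false by lia.
have -> : (j == m) = false by lia.
by rewrite /=; lia.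
Qed.

Let ltn_n i : (i < n)%N -> i <> m -> (i < m)%N.
Proof. by case: (inf); lia. Qed.

Let eq_n i : (i < n)%N -> i = m -> inf /\ k = m.
Proof. by case: (inf); lia. Qed.

(** At a finite vertex [lab] turns neighbours into labels, to which the clauses on [W] and [T]
    apply, and [add] or [sub] leads back to vertices. The vertex at infinity is treated apart in
    each clause. *)
Lemma scheme_rotation : exists q, rotation n Q spin q.
Proof.
apply: rotation_of_unique.
- move=> i t ni tk; rewrite /spin; have [im|im] := eqVneq i m.
    by have [_ km] := eq_n ni im; rewrite km in tk; lia.
  have im' : (i < m)%N by apply: ltn_n => //; apply/eqP.
  have [w0 wn] := W_pos tk; have [wm|wm] := eqVneq (W t) m; first by lia.
  have wm' : (W t < m)%N by apply: ltn_n => //; apply/eqP.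
  split; first by have := add_lt im' wm'; lia.
  by move=> e; have := addK im' wm'; rewrite e L0//; lia.
- move=> i s t ni sk tk; rewrite /spin; have [//|im] := eqVneq i m.
  have im' : (i < m)%N by apply: ltn_n => //; apply/eqP.
  have [_ wn] := W_pos sk; have [_ wn'] := W_pos tk.
  move=> e; apply: W_inj => //.
  by rewrite -(labE im' wn) e labE.
- move=> i t ni tk; rewrite /spin; have [im|im] := eqVneq i m.
    have [infT km] := eq_n ni im; rewrite km in tk *.
    have [a1 a2 b1 b2] := inf_lab infT.
    have nm : (nxt m t < m)%N by apply: nxt_lt; lia.
    have sm := sub_lt tk a2.
    exists (sub t a0); rewrite /scheme_quad im /lab !eqxx /= infT.
    rewrite (_ : (sub t a0 == m) = false) /=; last by apply/eqP; lia.
    rewrite (_ : (t == m) = false) /=; last by apply/eqP; lia.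
    rewrite (_ : (nxt m t == m) = false) /=; last by apply/eqP; lia.
    rewrite subK// inf_step// T_inf0// !andbT.
    by have := nxt_neq tk; lia.
  have im' : (i < m)%N by apply: ltn_n => //; apply/eqP.
  have k0 : (0 < k)%N by lia.
  have nk := nxt_lt t k0.
  have [c [b [Tc cb]]] := T_face tk.
  have [w0 wn] := W_pos tk; have [w0' wn'] := W_pos nk.
  set d := W t in Tc w0 wn *; set a := W _ in Tc w0' wn' *.
  have da : d <> a.
    by move=> /W_inj e; have := e tk nk; rewrite /nxt; case: ifP; lia.
  set j := if d == m then m else add i d; set j' := if a == m then m else add i a.
  have jn : (j < n)%N.
    rewrite /j; case: eqP => [e|dm]; first by rewrite -{1}e.
    have := add_lt im' (ltn_n wn dm); lia.
  have jn' : (j' < n)%N.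
    rewrite /j'; case: eqP => [e|am]; first by rewrite -{1}e.
    have := add_lt im' (ltn_n wn' am); lia.
  have Ld : lab i j = d by exact: labE.
  have La : lab i j' = a by exact: labE.
  have jj : j != j' by apply/eqP => e; apply: da; rewrite -Ld e.
  suff [i' [ni' ii' Lc Lb]] : exists i', [/\ (i' < n)%N, i != i', lab i' j = c & lab i' j' = b].
    by exists i'; rewrite /scheme_quad ni ni' jn jn' ii' jj Ld La Lc Lb.
  have [[c0 c1 c2 c3] ty] := T_type Tc.
  have neq x : (x < m)%N -> (x == m) = false by move=> ?; apply/eqP; lia.
  (* The opposite vertex is infinity, or is found by [sub] from a finite neighbour; [d <> c] or
     [a <> b] keeps it different from [i]. *)
  case: ty => [[dm am cm bm [bl dc]]|[dm am cm bm]|[dm am cm bm]|[[dm am cm bm dc]|[dm am cm bm ab]]].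
  + have jE : j = add i d by rewrite /j neq.
    have jE' : j' = add i a by rewrite /j' neq.
    have jm : (j < m)%N by rewrite jE add_lt.
    have jm' : (j' < m)%N by rewrite jE' add_lt.
    have sm : (sub j c < m)%N by rewrite sub_lt.
    exists (sub j c); rewrite /lab !neq//=; split; [lia | | exact: subK |].
      by apply/eqP => e; apply: dc; rewrite -Ld /lab !neq// {1}e subK.
    by rewrite jE jE'; exact: balP bl.
  + have infT : inf by move: cb; rewrite cm bm; case=> // -[].
    by exists m; rewrite infT addn1 ltnSn /lab eqxx /= cm bm; split=> //; apply/eqP; lia.
  + by exfalso; apply: da; rewrite dm am.
  + have jE : j = add i d by rewrite /j neq.
    have jE' : j' = m by rewrite /j' am eqxx.
    have jm : (j < m)%N by rewrite jE add_lt.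
    have sm : (sub j c < m)%N by rewrite sub_lt.
    exists (sub j c); rewrite jE' /lab eqxx orbT !neq//=; split; [lia | | exact: subK | done].
    by apply/eqP => e; apply: dc; rewrite -Ld /lab !neq// {1}e subK.
  + have jE' : j' = add i a by rewrite /j' neq.
    have jE : j = m by rewrite /j dm eqxx.
    have jm' : (j' < m)%N by rewrite jE' add_lt.
    have sm : (sub j' b < m)%N by rewrite sub_lt.
    exists (sub j' b); rewrite jE /lab eqxx orbT !neq//=; split; [lia | | done | exact: subK].
    by apply/eqP => e; apply: ab; rewrite -La /lab !neq// {1}e subK.
- move=> i i' i'' j j' /and4P[ni ni' nj /and4P[nj' _ jj Ti]].
  move=> /and4P[_ ni'' _ /and4P[_ _ _ Ti']].
  have [im|im] := eqVneq i m; last first.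
    have im' : (i < m)%N by apply: ltn_n => //; apply/eqP.
    have nm : lab i j <> m \/ lab i j' <> m.
      have [jm|jm] := eqVneq j m.
        have jm' : (j' < m)%N by apply: ltn_n => // e; rewrite jm e eqxx in jj.
        by right; exact: lab_lt.
      have jm' : (j < m)%N by apply: ltn_n => //; apply/eqP.
      by left; exact: lab_lt.
    have [ec eb] := T_uniq nm Ti Ti'.
    have [jm|jm] := eqVneq j m.
      have jm' : (j' < m)%N by apply: ltn_n => // e; rewrite jm e eqxx in jj.
      by rewrite (labs ni' jm' eb) -(labs ni'' jm' erefl).
    have jm' : (j < m)%N by apply: ltn_n => //; apply/eqP.
    by rewrite (labs ni' jm' ec) -(labs ni'' jm' erefl).
  have [infT km] := eq_n ni im; have [a1 a2 b1 b2] := inf_lab infT.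
  move: Ti Ti'; rewrite im /lab eqxx /= => Ti Ti'.
  have fin i1 : T m m (if (i1 == m) || (j == m) then m else L i1 j)
      (if (i1 == m) || (j' == m) then m else L i1 j') ->
      [/\ i1 <> m, j <> m, j' <> m &
         (L i1 j = a0 /\ L i1 j' = b0) \/ (L i1 j = b0 /\ L i1 j' = a0)].
    move=> /T_inf; case: (i1 =P m) => [_|e1] /=; first by lia.
    case: (j =P m) => [_|e2] /=; first by lia.
    by case: (j' =P m) => [_|e3] /=; first by lia.
  have [im' jm jm' LL] := fin _ Ti; have [im'' _ _ LL'] := fin _ Ti'.
  have lt1 := ltn_n ni' im'; have lt2 := ltn_n ni'' im''.
  have lt3 := ltn_n nj jm; have lt4 := ltn_n nj' jm'.
  rewrite -(LsK lt1 lt3) -(LsK lt2 lt3).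
  (* If the two faces listed [j] and [j'] in opposite orders, each would be the successor of the
     other, against [inf_asym]. *)
  case: LL LL' => -[e1 e2] [] [e3 e4]; rewrite ?e1 ?e3//.
    have := inf_stepK infT lt1 lt3 lt4 e1 e2; have := inf_stepK infT lt2 lt4 lt3 e4 e3.
    by move=> f1 f2; have := inf_asym infT lt3; rewrite -f2 -f1.
  have := inf_stepK infT lt1 lt4 lt3 e2 e1; have := inf_stepK infT lt2 lt3 lt4 e3 e4.
  by move=> f1 f2; have := inf_asym infT lt3; rewrite -f1 -f2.
- move=> i i' j j' /and4P[ni ni' nj /and4P[nj' ii' jj Ti]].
  by rewrite /scheme_quad ni ni' nj nj' ii' eq_sym jj T_sym.
- move=> i i' j j' /and4P[ni ni' nj /and4P[nj' _ jj Ti]]; split=> //.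
  rewrite /spin; have [im|im] := eqVneq i m.
    have [infT km] := eq_n ni im; have [a1 a2 b1 b2] := inf_lab infT; rewrite km.
    move: Ti; rewrite im /lab eqxx /= => /T_inf.
    case: (i' =P m) => [_|e1] /=; first by lia.
    case: (j =P m) => [_|e2] /=; first by lia.
    case: (j' =P m) => [_|e3] /=; first by lia.
    have lt1 := ltn_n ni' e1; have lt3 := ltn_n nj e2; have lt4 := ltn_n nj' e3.
    case=> -[f1 f2]; [exists j => //; left | exists j' => //; right]; split=> //.
      exact: inf_stepK f1 f2.
    exact: inf_stepK f2 f1.
  have im' : (i < m)%N by apply: ltn_n => //; apply/eqP.
  have nm : lab i j <> m \/ lab i j' <> m.
    have [jm|jm] := eqVneq j m.
      have jm' : (j' < m)%N by apply: ltn_n => // e; rewrite jm e eqxx in jj.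
      by right; exact: lab_lt.
    have jm' : (j < m)%N by apply: ltn_n => //; apply/eqP.
    by left; exact: lab_lt.
  have [t tk dt] := T_complete nm Ti; exists t => //.
  by case: dt => -[e1 e2]; [left | right]; split; apply: labK.
Qed.

End Scheme.

(* A Moebius strip of triangles is described by small indices, relabelled by an
   increasing [psi]; this makes the combinatorics of the strip decidable. *)
Definition relabel (psi : nat -> nat) (x : node) : node :=
  match x with
  | inl (inl i) => Wh (psi i)
  | inl (inr j) => Bl (psi j)
  | inr (i, i', j, j') => inr (psi i, psi i', psi j, psi j')
  end.

Definition strip_check (s : seq (node * node)) (faces : seq (nat * nat * nat * nat)) :=
  let k := (size s).-1 in
  let u j := (nth (Wh 0, Wh 0) s j).1 in let v j := (nth (Wh 0, Wh 0) s j).2 in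
  let tri j := [:: u j; v j; strip_new u v j] in
  [&& (0 < k)%N, (u k == v 0%N) && (v k == u 0%N),
      all (fun j => (u j.+1 == u j) || (v j.+1 == v j)) (iota 0 k),
      all (fun j => has (fun f : nat * nat * nat * nat => let: (a, b, c, d) := f in
        [|| perm_eq (tri j) [:: Wh a; Bl c; Fc a b c d],
            perm_eq (tri j) [:: Wh b; Bl c; Fc a b c d],
            perm_eq (tri j) [:: Wh a; Bl d; Fc a b c d] |
            perm_eq (tri j) [:: Wh b; Bl d; Fc a b c d]]) faces) (iota 0 k) &
      all (fun i => all (fun j => (perm_eq [:: u i; v i] [:: u j; v j]
         || perm_eq (tri i) (tri j)) ==> (i == j)) (iota 0 k)) (iota 0 k)].

Lemma relabel_inj psi : injective psi -> injective (relabel psi).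
Proof.
move=> pi [[i|j]|[[[a b] c] d]] [[i'|j']|[[[a' b'] c'] d']] //=.
- by move=> /Wh_inj/pi->.
- by move=> /Bl_inj/pi->.
- by case=> /pi-> /pi-> /pi-> /pi->.
Qed.

(** The name of a face centre sorts its indices, so the relabelling has to preserve their order. *)
Lemma relabel_Fc psi a b c d : {homo psi : x y / (x < y)%N} ->
  relabel psi (Fc a b c d) = Fc (psi a) (psi b) (psi c) (psi d).
Proof.
move=> pm; have pmm x y : psi (minn x y) = minn (psi x) (psi y) /\
    psi (maxn x y) = maxn (psi x) (psi y).
  have [/pm|/pm|->] := ltngtP x y; last by rewrite minnn maxnn.
    by move=> h; rewrite (minn_idPl (ltnW h)) (maxn_idPr (ltnW h)).
  by move=> h; rewrite (minn_idPr (ltnW h)) (maxn_idPl (ltnW h)).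
have [e1 e2] := pmm a b; have [e3 e4] := pmm c d.
by rewrite /Fc /= e1 e2 e3 e4.
Qed.

Lemma strip_check_nonorientable (R : realType)
    (Q : nat -> nat -> nat -> nat -> bool) s faces psi :
  {homo psi : x y / (x < y)%N} ->
  (forall i i' j j', Q i i' j j' -> Q i' i j j') ->
  (forall i i' j j', Q i i' j j' -> Q i i' j' j) ->
  strip_check s faces ->
  (forall a b c d, (a, b, c, d) \in faces -> Q (psi a) (psi b) (psi c) (psi d)) ->
  nonorientable R (@quad_space R Q).
Proof.
move=> pm QSw QSb + QF; rewrite /strip_check.
set k := (size s).-1; set u := fun j => (nth _ s j).1; set v := fun j => (nth _ s j).2.
move=> /and5P[k0 /andP[/eqP uk /eqP vk] /allP step /allP tri /allP inj].
have pinj : injective psi.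
  by move=> x y e; have [/pm|/pm|//] := ltngtP x y; rewrite e ltnn.
have rinj := relabel_inj pinj.
have newE j : strip_new (relabel psi \o u) (relabel psi \o v) j =
    relabel psi (strip_new u v j).
  by rewrite /strip_new /= inj_eq//; case: ifP.
have io j : (j < k)%N -> j \in iota 0 k by rewrite mem_iota.
apply: (@quad_strip R Q k (relabel psi \o u) (relabel psi \o v) k0).
- by move=> j /io/step/orP[/eqP e|/eqP e]; [left | right];
    exact: (congr1 (relabel psi) e).
- move=> j /io/tri/hasP[[[[a b] c] d] fin] h; have Qf := QF _ _ _ _ fin.
  rewrite newE.
  case/or4P: h => /(perm_map (relabel psi)); rewrite !map_cons relabel_Fc// => pe.
  + by exists (psi a), (psi b), (psi c), (psi d).
  + exists (psi b), (psi a), (psi c), (psi d); split; first exact: QSw.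
    by rewrite FcSw; exact: pe.
  + exists (psi a), (psi b), (psi d), (psi c); split; first exact: QSb.
    by rewrite FcSb; exact: pe.
  + exists (psi b), (psi a), (psi d), (psi c); split; first exact/QSb/QSw.
    by rewrite FcSw FcSb; exact: pe.
- move=> i j /io ik /io jk.
  rewrite /= -[X in perm_eq X]/(map (relabel psi) [:: u i; v i]).
  rewrite -[X in perm_eq _ X]/(map (relabel psi) [:: u j; v j]).
  move=> /(perm_map_inj rinj) pe.
  by have /allP/(_ j jk) := inj i ik; rewrite pe /= => /eqP.
- move=> i j /io ik /io jk; rewrite !newE.
  rewrite -[X in perm_eq X]/(map (relabel psi) [:: u i; v i; strip_new u v i]).
  rewrite -[X in perm_eq _ X]/(map (relabel psi) [:: u j; v j; strip_new u v j]).
  move=> /(perm_map_inj rinj) pe.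
  by have /allP/(_ j jk) := inj i ik; rewrite pe orbT /= => /eqP.
- exact: (congr1 (relabel psi) uk).
- exact: (congr1 (relabel psi) vk).
Qed.

Ltac ifs := repeat (match goal with |- context [if ?b then _ else _] =>
  lazymatch b with context [if _ then _ else _] => fail | _ => case: (boolP b) => ? end
  end; try (exfalso; lia)); try lia.

(** * Labels of the faces for odd and even [h] *)

Section Families.
Variables (h : nat) (inf : bool).
Hypothesis h4 : (3 < h)%N.
Hypothesis h5 : odd h -> (4 < h)%N.
Local Notation m := (h + h).+1.

Definition addm x y := if (x + y < m)%N then (x + y)%N else (x + y - m)%N.
Definition subm x y := if (y <= x)%N then (x - y)%N else (x + m - y)%N.

(* The corners [x, x + 1] and [y, y + 1] of the white rotation belong to the same
   face. *)
Definition paired x y := if odd h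
  then [|| (x == 1) && (y == 3), (x == 2) && (y == h.+1), (x == 4) && (y == h.+2),
           [&& odd x, y == x.+1, 4 < x & y < h] |
           [&& ~~ odd x, y == x.+1, h.+2 < x & if inf then x + 2 < h + h else y < h + h]]%N
  else [|| (x == 1) && (y == h.+1),
           [&& ~~ odd x, y == x.+1, 1 < x & y < h] |
           [&& ~~ odd x, y == x.+1, h.+1 < x & if inf then x + 2 < h + h else y < h + h]]%N.

(** One representative per orbit: two paired white corners, the face at the two breaks of the white
    rotation, the face at black infinity and the face at white infinity. *)
Definition face0 d a c b :=
  [|| [&& a == d.+1, b == c.+1 & paired d c],
      [&& d == 1, a == h.+1, c == h & b == h + h],
      [&& inf, d == h + h - 2, a == m, c == h + h - 1 & b == m] |
      [&& inf, d == h + h - 1, a == h + h, c == m & b == m]]%N.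

Definition face_labels d a c b :=
  [|| face0 d a c b, face0 a d b c, face0 c b d a | face0 b c a d].
Local Notation T := face_labels.

Definition white_seq t :=
  if inf then
    if (t < h - 2)%N then (h.+1 + t)%N else if t == (h - 2)%N then m
    else if (t <= h)%N then (h + t)%N else (m - t)%N
  else if (t < h)%N then (h.+1 + t)%N else (h + h - t)%N.

(** The cycle formed by the black corners: 1, h, ..., 2, h + 2, ..., 2h, h + 1 for even [h], and 1,
    h, ..., 5, h + 3, ..., 2h, h + 1, 2, 4, h + 2, 3 for odd [h]. Infinity is inserted at position
    [i1], between 2h - 1 and 2h. *)
Definition black_seq t0 :=
  let i1 := if odd h then (h + h - 6)%N else (h + h - 2)%N in
  if inf && (t0 == i1) then m else
  let t := if inf && (i1 < t0)%N then t0.-1 else t0 in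
  if t == 0%N then 1%N else
  if odd h then
    if (t <= h - 4)%N then (h.+1 - t)%N else if (t <= h + h - 6)%N then (t + 6)%N
    else if t == (h + h - 5)%N then h.+1 else if t == (h + h - 4)%N then 2%N
    else if t == (h + h - 3)%N then 4%N else if t == (h + h - 2)%N then h.+2 else 3%N
  else
    if (t <= h - 1)%N then (h.+1 - t)%N else if (t <= h + h - 2)%N then (t + 2)%N
    else h.+1.

Local Notation n := (m + inf)%N.
Local Notation k := (n.-1).

Lemma face_labels_swap d a c b : T d a c b -> T a d b c.
Proof. by move=> /or4P[]e; apply/or4P; [constructor 2|constructor 1|constructor 4|constructor 3]. Qed.

Lemma face_labels_flip d a c b : T d a c b -> T c b d a.
Proof. by move=> /or4P[]e; apply/or4P; [constructor 3|constructor 4|constructor 1|constructor 2]. Qed.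

Lemma face0_bound d a c b : face0 d a c b ->
  [/\ 0 < d, 0 < a, 0 < c & 0 < b]%N /\
  [\/ [/\ d < m, a < m, c < m & b < m]%N /\ [/\ (d + b = a + c \/ d + b = a + c + m)%N, d <> c & d <> a],
      inf /\ [/\ d = h + h - 2, a = m, c = h + h - 1 & b = m]%N |
      inf /\ [/\ d = h + h - 1, a = h + h, c = m & b = m]%N].
Proof.
rewrite /face0 /paired => /or4P[/and3P[/eqP-> /eqP->]|/and4P[/eqP-> /eqP-> /eqP-> /eqP->]|
   /and5P[i /eqP-> /eqP-> /eqP-> /eqP->]|/and5P[i /eqP-> /eqP-> /eqP-> /eqP->]].
- case: ifP => _ H; (split; first by split=> //; case: (inf) H; lia); constructor 1;
    by (split; split; case: (inf) H; lia).
- by split; [split | constructor 1; split; split]; lia.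
- by split; [split; lia | constructor 2; split=> //; split; lia].
- by split; [split; lia | constructor 3; split=> //; split; lia].
Qed.


Variant face0_spec d a c b : Prop :=
  | Face0Pair of a = d.+1 & b = c.+1 & paired d c
  | Face0Jump of d = 1%N & a = h.+1 & c = h & b = (h + h)%N
  | Face0Inf1 of inf & d = (h + h - 2)%N & a = m & c = (h + h - 1)%N & b = m
  | Face0Inf2 of inf & d = (h + h - 1)%N & a = (h + h)%N & c = m & b = m.

Lemma face0P d a c b : face0 d a c b -> face0_spec d a c b.
Proof.
case/or4P => [/and3P[/eqP-> /eqP-> P]|/and4P[/eqP-> /eqP-> /eqP-> /eqP->]|
   /and5P[i /eqP-> /eqP-> /eqP-> /eqP->]|/and5P[i /eqP-> /eqP-> /eqP-> /eqP->]].
- exact: Face0Pair.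
- exact: Face0Jump.
- exact: Face0Inf1.
- exact: Face0Inf2.
Qed.


Lemma paired_range x y : paired x y ->
  [/\ (0 < x)%N, (x < y)%N, (y < h + h)%N, x <> h /\ y <> h &
      inf -> (y < h + h - 2)%N] /\ ~ (x = h + h - 3 /\ y = h + h - 2)%N.
Proof. by rewrite /paired; case: ifP => oh; case: (inf) => /= P; do !split; lia. Qed.

Lemma paired_inj x y y' : paired x y -> paired x y' -> y = y'.
Proof. by rewrite /paired; case: ifP => oh; case: (inf) => /=; lia. Qed.

Lemma paired_injr x x' y : paired x y -> paired x' y -> x = x'.
Proof. by rewrite /paired; case: ifP => oh; case: (inf) => /=; lia. Qed.

Lemma paired_src x y z : paired x y -> paired y z -> False.
Proof. by rewrite /paired; case: ifP => oh; case: (inf) => /=; lia. Qed.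

(** A pair creates the black corners [x, y] and [x + 1, y + 1]. With [paired_cross], this prevents
    one black corner from arising both ways, so that it determines its face. *)
Lemma paired_succ x y : paired x y -> paired x.+1 y.+1 -> False.
Proof. by rewrite /paired; case: ifP => oh; case: (inf) => /=; lia. Qed.

Lemma paired_cross x y : paired x y -> paired y.+1 x.+1 -> False.
Proof. by rewrite /paired; case: ifP => oh; case: (inf) => /=; lia. Qed.

Ltac solve_pairs := subst;
  repeat match goal with H : _.+1 = _.+1 |- _ => case: H => ?; subst end; solve [
  match goal with
  | |- _ /\ _ => by []
  | P : is_true (paired ?x ?y), P' : is_true (paired ?x' ?y) |- _ =>
      by rewrite (paired_injr P P')
  | P : is_true (paired ?x ?y), P' : is_true (paired ?x ?y') |- _ =>
      by rewrite (paired_inj P P')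
  | P : is_true (paired ?x ?y), P' : is_true (paired ?y ?z) |- _ =>
      case: (paired_src P P')
  | P : is_true (paired ?x ?y), P' : is_true (paired ?x.+1 ?y.+1) |- _ =>
      case: (paired_succ P P')
  | P : is_true (paired ?x ?y), P' : is_true (paired ?y.+1 ?x.+1) |- _ =>
      case: (paired_cross P P')
  end | lia |
  match goal with P : is_true (paired ?x ?y) |- _ =>
      have [[? ? ? [? ?] ?] ?] := paired_range P; lia end ].

(** A white corner lies in a single pair. Only two orders of the first face are examined, here and
    in [face0_uniqw_flip]; exchanging its black corners gives the other two in [face_uniqw]. *)
Lemma face0_uniqw d a c b c' b' : (d <> m) \/ (a <> m) ->
  face0 d a c b -> T d a c' b' -> c = c' /\ b = b'.
Proof.
by move=> ne F /or4P[]/face0P[]; case/face0P: F; intros; solve_pairs.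
Qed.

Lemma face0_uniqb d a c b a' b' : (d <> m) \/ (c <> m) ->
  face0 d a c b -> T d a' c b' -> a = a' /\ b = b'.
Proof.
by move=> ne F /or4P[]/face0P[]; case/face0P: F; intros; solve_pairs.
Qed.

Lemma face0_uniqw_flip d a c b c' b' : (d <> m) \/ (a <> m) ->
  face0 c b d a -> T d a c' b' -> c = c' /\ b = b'.
Proof.
by move=> ne F /or4P[]/face0P[]; case/face0P: F; intros; solve_pairs.
Qed.

Lemma face0_uniqb_swap d a c b a' b' : (d <> m) \/ (c <> m) ->
  face0 a d b c -> T d a' c b' -> a = a' /\ b = b'.
Proof.
by move=> ne F /or4P[]/face0P[]; case/face0P: F; intros; solve_pairs.
Qed.

Lemma face_infw c b : T m m c b ->
  (c = h + h - 1 /\ b = h + h \/ c = h + h /\ b = h + h - 1)%N.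
Proof. by move=> /or4P[]/face0P[]; intros; solve_pairs. Qed.

Lemma face_infb a b : T m a m b ->
  (a = h + h - 1 /\ b = h + h - 2 \/ a = h + h - 2 /\ b = h + h - 1)%N.
Proof. by move=> /or4P[]/face0P[]; intros; solve_pairs. Qed.

(** The congruence [d + b = a + c] modulo [m]; for labels below [m] both sums are below [2m], so
    three cases suffice. *)
Definition balanced d a c b := (d + b = a + c \/ d + b = a + c + m \/ d + b + m = a + c)%N.

Ltac solve_type := first
  [ constructor 1; split; first [lia | split; rewrite /balanced; lia]
  | constructor 2; split; lia | constructor 3; split; lia
  | constructor 4; left; split; lia | constructor 4; right; split; lia ].

Lemma face_typew d a c b : T d a c b ->
  [/\ 0 < d, 0 < a, 0 < c & 0 < b]%N /\
  [\/ [/\ (d < m)%N, (a < m)%N, (c < m)%N, (b < m)%N & balanced d a c b /\ d <> c],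
      [/\ (d < m)%N, (a < m)%N, c = m & b = m],
      [/\ d = m, a = m, (c < m)%N & (b < m)%N] |
      [/\ (d < m)%N, a = m, (c < m)%N, b = m & d <> c] \/
      [/\ d = m, (a < m)%N, c = m, (b < m)%N & a <> b]].
Proof.
by move=> /or4P[]/face0_bound[[? ? ? ?] [[[? ? ? ?] [? ? ?]]|[i [? ? ? ?]]|[i [? ? ? ?]]]];
  (split; first by []); subst; solve_type.
Qed.

Lemma face_typeb d c a b : T d a c b ->
  [/\ 0 < d, 0 < c, 0 < a & 0 < b]%N /\
  [\/ [/\ (d < m)%N, (c < m)%N, (a < m)%N, (b < m)%N & balanced d c a b /\ d <> a],
      [/\ (d < m)%N, (c < m)%N, a = m & b = m],
      [/\ d = m, c = m, (a < m)%N & (b < m)%N] |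
      [/\ (d < m)%N, c = m, (a < m)%N, b = m & d <> a] \/
      [/\ d = m, (c < m)%N, a = m, (b < m)%N & c <> b]].
Proof.
by move=> /or4P[]/face0_bound[[? ? ? ?] [[[? ? ? ?] [? ? ?]]|[i [? ? ? ?]]|[i [? ? ? ?]]]];
  (split; first by []); subst; solve_type.
Qed.

Definition white_pos x :=
  if (inf && (x == m))%N then (h - 2)%N else if (x <= h)%N then (h + h + inf - x)%N
  else if inf && (h + h - 2 < x)%N then (x - h)%N else (x - h.+1)%N.

Lemma white_posK t : (t < k)%N -> white_pos (white_seq t) = t.
Proof. by rewrite /white_pos /white_seq; case: (inf) => /= tk; ifs. Qed.

Lemma white_seq_inj s t : (s < k)%N -> (t < k)%N -> white_seq s = white_seq t -> s = t.
Proof. by move=> sk tk e; rewrite -(white_posK sk) e white_posK. Qed.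

Lemma white_seq_pos t : (t < k)%N -> (0 < white_seq t)%N /\ (white_seq t < n)%N.
Proof. by rewrite /white_seq; case: (inf) => /= tk; ifs. Qed.

Definition adjacent (W : nat -> nat) x y := exists2 t, (t < k)%N &
  (x = W t /\ y = W (nxt k t)) \/ (y = W t /\ x = W (nxt k t)).

Lemma adjacentC W x y : adjacent W x y -> adjacent W y x.
Proof. by move=> [t tk [e|e]]; exists t => //; [right | left]. Qed.

Lemma adjacent_at W t x y : (t.+1 < k)%N -> W t = x -> W t.+1 = y -> adjacent W x y.
Proof. by move=> tk <- <-; exists t; [lia | left; rewrite /nxt tk]. Qed.

Lemma adjacent0 W x y : (0 < k)%N -> W k.-1 = x -> W 0%N = y -> adjacent W x y.
Proof. by move=> k0 <- <-; exists k.-1; [lia | left; rewrite /nxt; ifs]. Qed.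

(** The exceptions are [h], which lies on the descending arc while [h + 1] lies on the ascending
    one, and [2h - 2], which infinity separates from its successor. *)
Lemma white_adj x : (0 < x)%N -> x <> h -> (x < h + h)%N ->
  (inf -> x <> h + h - 2)%N -> adjacent white_seq x x.+1.
Proof.
move=> x0 xh x1 xi; have [xlt|xgt] := ltnP x h.
  apply/adjacentC/(@adjacent_at _ (h + h + inf - x.+1)%N); rewrite /white_seq; ifs.
apply: (@adjacent_at _ (if inf && (x == h + h - 1) then h - 1 else x - h.+1)%N);
  rewrite /white_seq; ifs.
Qed.

Lemma white_adj_face d a c b : face0 d a c b ->
  (d <> m \/ a <> m -> adjacent white_seq d a) /\ (c <> m \/ b <> m -> adjacent white_seq c b).
Proof.
case/face0P => [-> -> P|-> -> -> ->|i -> -> -> ->|i -> -> -> ->].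
- have [[x0 xy y1 [xh yh] yi] _] := paired_range P.
  by split=> _; apply: white_adj; lia.
- split=> _; first by apply: adjacent0; rewrite /white_seq; ifs.
  by apply/adjacentC/(@adjacent_at _ (h - 1 + inf)%N); rewrite /white_seq; ifs.
- split=> _; first by apply: (@adjacent_at _ (h - 3)%N); rewrite /white_seq; ifs.
  by apply/adjacentC/(@adjacent_at _ (h - 2)%N); rewrite /white_seq; ifs.
- split=> [_|]; last by case.
  by apply: (@adjacent_at _ (h - 1)%N); rewrite /white_seq; ifs.
Qed.

Lemma black_adj x : (if odd h then (4 < x) && (x != h) && (x != h.+1) && (x != h.+2)
    else (1 < x) && (x != h) && (x != h.+1))%N -> (x < h + h)%N ->
  (inf -> x <> h + h - 1)%N -> adjacent black_seq x x.+1.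
Proof.
case: ifP => oh x0 x1 xi; have [xlt|xgt] := ltnP x h.
- by apply/adjacentC/(@adjacent_at _ (h - x)%N); rewrite /black_seq; ifs.
- by apply: (@adjacent_at _ (x - 6)%N); rewrite /black_seq; ifs.
- by apply/adjacentC/(@adjacent_at _ (h - x)%N); rewrite /black_seq; ifs.
- by apply: (@adjacent_at _ (x - 2)%N); rewrite /black_seq; ifs.
Qed.

Lemma black_adj_pair x y : paired x y -> adjacent black_seq x y /\ adjacent black_seq x.+1 y.+1.
Proof.
rewrite /paired; case: ifP => oh.
  have h5' := h5 oh.
  case/orP => [/andP[/eqP-> /eqP->]|/or4P[/andP[/eqP-> /eqP->]|/andP[/eqP-> /eqP->]|
      /and4P[ox /eqP-> x1 x2]|/and4P[ox /eqP-> x1 x2]]].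
  - split; first by apply/adjacentC/adjacent0; rewrite /black_seq; ifs.
    by apply: (@adjacent_at _ (h + h - 4 + inf)%N); rewrite /black_seq; ifs.
  - split; first by apply/adjacentC/(@adjacent_at _ (h + h - 5 + inf)%N); rewrite /black_seq; ifs.
    by apply/adjacentC/(@adjacent_at _ (h + h - 2 + inf)%N); rewrite /black_seq; ifs.
  - split; first by apply: (@adjacent_at _ (h + h - 3 + inf)%N); rewrite /black_seq; ifs.
    by apply: (@adjacent_at _ (h - 4)%N); rewrite /black_seq; ifs.
  - by split; apply: black_adj; rewrite ?oh; lia.
  - by split; apply: black_adj; rewrite ?oh; move: x2; case: (inf); lia.
case/or3P => [/andP[/eqP-> /eqP->]|/and4P[ox /eqP-> x1 x2]|/and4P[ox /eqP-> x1 x2]].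
- split; first by apply/adjacentC/adjacent0; rewrite /black_seq; ifs.
  by apply: (@adjacent_at _ (h - 1)%N); rewrite /black_seq; ifs.
- by split; apply: black_adj; rewrite ?oh; lia.
- by split; apply: black_adj; rewrite ?oh; move: x2; case: (inf); lia.
Qed.

Let inf_at := (if odd h then h + h - 6 else h + h - 2)%N.

Lemma black_adj_face d a c b : face0 d a c b ->
  (d <> m \/ c <> m -> adjacent black_seq d c) /\ (a <> m \/ b <> m -> adjacent black_seq a b).
Proof.
case/face0P => [-> -> P|-> -> -> ->|i -> -> -> ->|i -> -> -> ->].
- by have [? ?] := black_adj_pair P.
- split=> _; first by apply: (@adjacent_at _ 0%N); rewrite /black_seq; ifs.
  apply/adjacentC/(@adjacent_at _ ((if odd h then h + h - 6 else h + h - 2) + inf)%N);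
    by rewrite /black_seq; ifs.
- split=> [_|]; last by case.
  by apply: (@adjacent_at _ (inf_at - 2)%N); rewrite /inf_at /black_seq; ifs.
- split=> _; first by apply: (@adjacent_at _ (inf_at - 1)%N); rewrite /inf_at /black_seq; ifs.
  by apply/adjacentC/(@adjacent_at _ inf_at); rewrite /inf_at /black_seq; ifs.
Qed.

(** The black cycle before infinity is inserted; its inverse [core_pos] is computed first and the
    shift by one is added afterwards. *)
Let core t := (if t == 0 then 1 else
  if odd h then
    if t <= h - 4 then h.+1 - t else if t <= h + h - 6 then t + 6
    else if t == h + h - 5 then h.+1 else if t == h + h - 4 then 2
    else if t == h + h - 3 then 4 else if t == h + h - 2 then h.+2 else 3
  else
    if t <= h - 1 then h.+1 - t else if t <= h + h - 2 then t + 2 else h.+1)%N.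

Let core_pos x := (if x == 1 then 0 else
  if odd h then
    if x == 2 then h + h - 4 else if x == 3 then h + h - 1 else if x == 4 then h + h - 3
    else if x == h.+1 then h + h - 5 else if x == h.+2 then h + h - 2
    else if x <= h then h.+1 - x else x - 6
  else if x == h.+1 then h + h - 1 else if x <= h then h.+1 - x else x - 2)%N.

Let coreK t : (t < h + h)%N -> core_pos (core t) = t.
Proof. by move=> tk; rewrite /core /core_pos; ifs. Qed.

Let core_bound t : (t < h + h)%N -> (0 < core t < m)%N.
Proof. by move=> tk; rewrite /core; ifs. Qed.

Let black_seqE t : black_seq t =
  if inf && (t == inf_at) then m else core (if inf && (inf_at < t)%N then t.-1 else t).
Proof. by []. Qed.

Let inf_at_lt : (inf_at < h + h)%N.
Proof. by rewrite /inf_at; case: ifP; lia. Qed.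

Definition black_pos x :=
  if inf && (x == m) then inf_at else
  if inf && (inf_at <= core_pos x)%N then (core_pos x).+1 else core_pos x.

Lemma black_posK t : (t < k)%N -> black_pos (black_seq t) = t.
Proof.
rewrite /black_pos black_seqE; move: (inf_at) inf_at_lt => z zk.
case: (inf) => /= tk; last by rewrite coreK//; lia.
have [->|tz] := eqVneq t z; first by rewrite eqxx.
set u := (X in core X); have uk : (u < h + h)%N by rewrite /u; ifs.
have /andP[_ um] := core_bound uk; rewrite ltn_eqF// coreK// /u.
by ifs.
Qed.

Lemma black_seq_inj s t : (s < k)%N -> (t < k)%N -> black_seq s = black_seq t -> s = t.
Proof. by move=> sk tk e; rewrite -(black_posK sk) e black_posK. Qed.

Lemma black_seq_pos t : (t < k)%N -> (0 < black_seq t)%N /\ (black_seq t < n)%N.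
Proof.
rewrite black_seqE; move: (inf_at) inf_at_lt => z zk tk; case: ifP => [|_]; first by case: (inf) => //; lia.
set u := (X in core X); have /core_bound : (u < h + h)%N by rewrite /u; ifs.
by case: (inf); lia.
Qed.

End Families.

(** * Every corner of the rotations belongs to a face *)

Section FamilyQuadrangulation.
Variables (h : nat) (inf : bool).
Hypothesis h4 : (3 < h)%N.
Hypothesis h5 : odd h -> (4 < h)%N.
Local Notation m := (h + h).+1.
Local Notation n := (m + inf)%N.
Local Notation k := (n.-1).
Local Notation T := (face_labels h inf).
Local Notation white := (white_seq h inf).
Local Notation black := (black_seq h inf).

Lemma face_of_pair x y : paired h inf x y -> face0 h inf x x.+1 y y.+1.
Proof. by move=> P; rewrite /face0 !eqxx P. Qed.

Lemma face_jump : face0 h inf 1 h.+1 h (h + h).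
Proof. by rewrite /face0 !eqxx !orbT. Qed.

Lemma face_inf1 : inf -> face0 h inf (h + h - 2) m (h + h - 1) m.
Proof. by move=> i; rewrite /face0 i !eqxx !orbT. Qed.

Lemma face_inf2 : inf -> face0 h inf (h + h - 1) (h + h) m m.
Proof. by move=> i; rewrite /face0 i !eqxx !orbT. Qed.

Lemma paired_ex x : (0 < x)%N -> x <> h -> (x < h + h)%N -> (inf -> x < h + h - 2)%N ->
  exists y, paired h inf x y || paired h inf y x.
Proof.
move=> x0 xh x1 xi.
(* The partner of [x]: exceptional pairs are listed, otherwise parity and the side of [h] decide
   between predecessor and successor. *)
exists (if odd h then if x == 1 then 3 else if x == 3 then 1 else if x == 2 then h.+1
  else if x == h.+1 then 2 else if x == 4 then h.+2 else if x == h.+2 then 4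
  else if odd x == (x < h) then x.+1 else x.-1
  else if x == 1 then h.+1 else if x == h.+1 then 1 else if odd x then x.-1 else x.+1)%N.
rewrite /paired; case: (boolP (odd h)) => oh; first have h5' := h5 oh;
  case: (inf) xi => /= xi; ifs.
Qed.

(** Consecutive white labels are of four kinds: the closing step from 1 to h + 1, steps between
    paired neighbours in either direction, the step from 2h to h, and the three steps around
    infinity. *)
Lemma white_face t : (t < k)%N -> exists c b, T (white t) (white (nxt k t)) c b.
Proof.
move=> tk; have : [\/ white t = 1 /\ white (nxt k t) = h.+1,
    exists x, [/\ (0 < x)%N, x <> h, (x < h + h)%N, (inf -> x < h + h - 2)%N &
      (white t = x /\ white (nxt k t) = x.+1 \/ white t = x.+1 /\ white (nxt k t) = x)],
    white t = h + h /\ white (nxt k t) = h |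
    inf /\ (white t = h + h - 2 /\ white (nxt k t) = m \/
            white t = m /\ white (nxt k t) = h + h - 1 \/
            white t = h + h - 1 /\ white (nxt k t) = h + h)]%N.
  have [tl|tl] := ltnP t.+1 k; last first.
    by constructor 1; rewrite /nxt /white_seq; split; ifs.
  rewrite /nxt tl.
  have [t1|t1] := ltnP t (if inf then h - 3 else h - 1)%N.
    constructor 2; exists (h.+1 + t)%N; rewrite /white_seq.
    by move: t1; split; rewrite ?if_same; try (move: t1; ifs); left; split; ifs.
  have [t2|t2] := ltnP t (h - 1 + inf)%N.
    by constructor 4; rewrite /white_seq; move: t1; case: (inf) t2 tl => /= *; split => //; ifs.
  have [t3|t3] := eqVneq t (h - 1 + inf)%N.
    by constructor 3; rewrite /white_seq; split; ifs.
  constructor 2; exists (h + h + inf - t.+1)%N; rewrite /white_seq.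
  by split; try (right; split); ifs.
case=> [[-> ->]|[x [x0 xh x1 xi]]|[-> ->]|[i]].
- by exists h, (h + h)%N; rewrite /face_labels face_jump.
- have [y P] := paired_ex x0 xh x1 xi.
  have [c [b Tx]] : exists c b, T x x.+1 c b.
    exists y, y.+1; rewrite /face_labels.
    by case/orP: P => /face_of_pair->; rewrite ?orbT.
  case=> -[-> ->]; first by exists c, b.
  by exists b, c; exact: face_labels_swap.
- by exists h.+1, 1%N; rewrite /face_labels face_jump !orbT.
- case=> [[-> ->]|[[-> ->]|[-> ->]]].
  + by exists (h + h - 1)%N, m; rewrite /face_labels face_inf1.
  + by exists m, (h + h - 2)%N; rewrite /face_labels face_inf1 ?orbT.
  + by exists m, m; rewrite /face_labels face_inf2.
Qed.


Definition black_corner x y := exists a b, T x a y b.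

Lemma black_cornerC x y : black_corner x y -> black_corner y x.
Proof. by move=> [a [b Txy]]; exists b, a; exact: face_labels_flip. Qed.

Lemma black_corner_face d a c b : face0 h inf d a c b -> black_corner d c /\ black_corner a b.
Proof.
move=> F; split; [exists a, b | exists d, c]; rewrite /face_labels F ?orbT//.
Qed.

(** A pair of consecutive numbers makes three consecutive labels adjacent, so [x, x + 1] comes from
    the pair starting at [x] or from the one starting at [x - 1]. If infinity is present, 2h - 2, 2h
    - 1 comes from the face at black infinity. *)
Lemma black_corner_run x : (if odd h then (4 < x) && (x != h) && (x != h.+1) && (x != h.+2)
    else (1 < x) && (x != h) && (x != h.+1))%N -> (x < h + h)%N ->
  (inf -> x <> h + h - 1)%N -> black_corner x x.+1.
Proof.
case: x => [|x]; first by case: ifP.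
move=> x0 x1 xi.
have : [\/ paired h inf x.+1 x.+2, paired h inf x x.+1 | inf /\ x.+1 = (h + h - 2)%N].
  have [/andP[i /eqP xE]|xE] := boolP (inf && (x.+1 == h + h - 2)%N); first by constructor 3.
  move: x0; rewrite /paired; case: ifP => oh /andP[/andP[x2 x3] x4];
    have [ox|ox] := boolP (odd x); rewrite ?(oddS x) ?ox /=.
  - have [xh|xh] := ltnP x h.
      by constructor 2; rewrite eqxx; move: x2; rewrite ?xh; lia.
    by constructor 1; rewrite eqxx; move: x1 xi xE; case: (inf) => /=; lia.
  - have [xh|xh] := ltnP x h.
      by constructor 1; rewrite eqxx; lia.
    by constructor 2; rewrite eqxx; move: x1 xi xE; case: (inf) => /=; lia.
  - have [xh|xh] := ltnP x h.
      by constructor 1; rewrite eqxx; lia.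
    by constructor 1; rewrite eqxx; move: x1 xi xE; case: (inf) => /=; lia.
  - have [xh|xh] := ltnP x h.
      by constructor 2; rewrite eqxx; lia.
    by constructor 2; rewrite eqxx; move: x1 xi xE; case: (inf) => /=; lia.
case=> [/face_of_pair/black_corner_face[]//|/face_of_pair/black_corner_face[_]//|].
case=> i ->; have [+ _] := black_corner_face (face_inf1 i).
by have -> : (h + h - 1 = (h + h - 2).+1)%N by lia.
Qed.

Lemma black_corner_at t x y : (t.+1 < k)%N -> black_corner x y ->
  black t = x -> black t.+1 = y -> black_corner (black t) (black (nxt k t)).
Proof. by move=> tk C e1 e2; rewrite /nxt tk e1 e2. Qed.

(** Within a run of [black_seq] the previous lemma applies; each jump is a corner of an exceptional
    pair or of [face_jump], and the two steps through infinity belong to the face at white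
    infinity. *)
Lemma black_face t : (t < k)%N -> black_corner (black t) (black (nxt k t)).
Proof.
move=> tk; have [tl|tl] := ltnP t.+1 k; last first.
  have -> : nxt k t = 0%N by rewrite /nxt; ifs.
  have -> : t = k.-1 by lia.
  have P : paired h inf 1 (if odd h then 3%N else h.+1).
    by rewrite /paired; case: (boolP (odd h)) => oh; rewrite !eqxx.
  have [/black_cornerC C _] := black_corner_face (face_of_pair P).
  have -> : black 0 = 1%N by rewrite /black_seq; ifs.
  by have -> : black k.-1 = if odd h then 3%N else h.+1 by rewrite /black_seq; ifs.
have [-> |t0] := eqVneq t 0%N.
  apply: (black_corner_at _ (black_corner_face face_jump).1); [lia|..];
    by rewrite /black_seq; ifs.
have CJ := black_cornerC (black_corner_face face_jump).2.
case: (boolP (odd h)) => oh.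
  have h5' := h5 oh.
  have P4 : paired h inf 4 h.+2 by rewrite /paired oh; lia.
  have P2 : paired h inf 2 h.+1 by rewrite /paired oh; lia.
  have P1 : paired h inf 1 3 by rewrite /paired oh; lia.
  have [C4 C4'] := black_corner_face (face_of_pair P4).
  have [C2 C2'] := black_corner_face (face_of_pair P2).
  have [_ C1'] := black_corner_face (face_of_pair P1).
  clear P1 P2 P4.
  have [t1|t1] := ltnP t (h - 4).
    apply: (@black_corner_at _ (h - t).+1 (h - t)) => //; first last.
    + by rewrite /black_seq; ifs.
    + by rewrite /black_seq; ifs.
    + by apply/black_cornerC/black_corner_run; rewrite ?oh; lia.
  have [->|t2] := eqVneq t (h - 4)%N.
    by apply: (black_corner_at _ C4'); [lia|..]; rewrite /black_seq; ifs.
  have [t3|t3] := ltnP (t.+1 + inf) (h + h - 5).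
    apply: (@black_corner_at _ (t + 6) (t + 6).+1) => //; first last.
    + by rewrite /black_seq; ifs.
    + by rewrite /black_seq; ifs.
    + by apply/black_corner_run; rewrite ?oh; lia.
  (* The positions 2h - 7 and 2h - 6 are those of the label 2h - 1 and of infinity. *)
  have [/andP[i /eqP tE]|ni] := boolP (inf && (t == h + h - 7)%N).
    have [C' _] := black_corner_face (face_inf2 i).
    clear -h4 h5' oh tl tE i C'.
    by apply: (black_corner_at _ C'); [lia|..]; rewrite /black_seq; ifs.
  have [/andP[i /eqP tE]|ni'] := boolP (inf && (t == h + h - 6)%N).
    have [_ C] := black_corner_face (face_inf2 i).
    clear -h4 h5' oh tl tE i C.
    by apply: (black_corner_at _ (black_cornerC C)); [lia|..]; rewrite /black_seq; ifs.
  have [tE|t4] := eqVneq t (h + h - 6 + inf)%N.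
    clear -h4 h5' oh tl tE CJ.
    by apply: (black_corner_at _ CJ); [lia|..]; rewrite /black_seq; ifs.
  have [tE|t5] := eqVneq t (h + h - 5 + inf)%N.
    clear -h4 h5' oh tl tE C2.
    by apply: (black_corner_at _ (black_cornerC C2)); [lia|..]; rewrite /black_seq; ifs.
  have [tE|t6] := eqVneq t (h + h - 4 + inf)%N.
    clear -h4 h5' oh tl tE C1'.
    by apply: (black_corner_at _ C1'); [lia|..]; rewrite /black_seq; ifs.
  have [tE|t7] := eqVneq t (h + h - 3 + inf)%N.
    clear -h4 h5' oh tl tE C4.
    by apply: (black_corner_at _ C4); [lia|..]; rewrite /black_seq; ifs.
  have tE : t = (h + h - 2 + inf)%N.
    clear -h4 h5' tl t3 t4 t5 t6 t7 ni ni'; move: ni ni' t3 tl t4 t5 t6 t7.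
    by case: (inf) => /=; lia.
  clear -h4 h5' oh tl tE C2'.
    by apply: (black_corner_at _ (black_cornerC C2')); [lia|..]; rewrite /black_seq; ifs.
have P1 : paired h inf 1 h.+1 by rewrite /paired (negPf oh); lia.
have [_ C1'] := black_corner_face (face_of_pair P1).
clear P1.
have [t1|t1] := ltnP t (h - 1).
  apply: (@black_corner_at _ (h - t).+1 (h - t)) => //; first last.
  + by rewrite /black_seq; ifs.
  + by rewrite /black_seq; ifs.
  + by apply/black_cornerC/black_corner_run; rewrite ?(negPf oh); lia.
have [->|t2] := eqVneq t (h - 1)%N.
  by apply: (black_corner_at _ C1'); [lia|..]; rewrite /black_seq; ifs.
have [t3|t3] := ltnP (t.+1 + inf) (h + h - 1).
  apply: (@black_corner_at _ (t + 2) (t + 2).+1) => //; first last.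
  + by rewrite /black_seq; ifs.
  + by rewrite /black_seq; ifs.
  + by apply/black_corner_run; rewrite ?(negPf oh); lia.
have [/andP[i /eqP tE]|ni] := boolP (inf && (t == h + h - 3)%N).
  have [C' _] := black_corner_face (face_inf2 i).
  clear -h4  oh tl tE i C'.
    by apply: (black_corner_at _ C'); [lia|..]; rewrite /black_seq; ifs.
have [/andP[i /eqP tE]|ni'] := boolP (inf && (t == h + h - 2)%N).
  have [_ C] := black_corner_face (face_inf2 i).
  clear -h4  oh tl tE i C.
    by apply: (black_corner_at _ (black_cornerC C)); [lia|..]; rewrite /black_seq; ifs.
have tE : t = (h + h - 2 + inf)%N.
  by clear -h4 tl t3 ni ni'; move: ni ni' t3 tl; case: (inf) => /=; lia.
clear -h4  oh tl tE CJ.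
    by apply: (black_corner_at _ CJ); [lia|..]; rewrite /black_seq; ifs.
Qed.

End FamilyQuadrangulation.

(** * The families as nonorientable quadrangulations *)

Section FamilyEmbedding.
Variables (h : nat) (inf : bool).
Hypothesis h4 : (3 < h)%N.
Hypothesis h5 : odd h -> (4 < h)%N.
Local Notation m := (h + h).+1.
Local Notation n := (m + inf)%N.
Local Notation k := (n.-1).
Local Notation T := (face_labels h inf).
Local Notation add := (addm h).
Local Notation sub := (subm h).

Lemma face_uniqw d a c b c' b' : (d <> m) \/ (a <> m) ->
  T d a c b -> T d a c' b' -> c = c' /\ b = b'.
Proof.
move=> ne F G; have ne' : a <> m \/ d <> m by case: ne; [right | left].
case/or4P: F => F.
- exact: (face0_uniqw h4 h5 ne F G).
- by have [-> ->] := face0_uniqw h4 h5 ne' F (face_labels_swap G).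
- exact: (face0_uniqw_flip h4 h5 ne F G).
- by have [-> ->] := face0_uniqw_flip h4 h5 ne' F (face_labels_swap G).
Qed.

Lemma face_uniqb d c a b a' b' : (d <> m) \/ (c <> m) ->
  T d a c b -> T d a' c b' -> a = a' /\ b = b'.
Proof.
move=> ne F G; have ne' : c <> m \/ d <> m by case: ne; [right | left].
case/or4P: F => F.
- exact: (face0_uniqb h4 h5 ne F G).
- exact: (face0_uniqb_swap h4 h5 ne F G).
- by have [-> ->] := face0_uniqb h4 h5 ne' F (face_labels_flip G).
- by have [-> ->] := face0_uniqb_swap h4 h5 ne' F (face_labels_flip G).
Qed.

Lemma face_adjw d a c b : (d <> m) \/ (a <> m) -> T d a c b ->
  adjacent h inf (white_seq h inf) d a.
Proof.
move=> ne; have ne' : a <> m \/ d <> m by case: ne; [right | left].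
case/or4P => /(white_adj_face h4 h5)[F G].
- exact: F.
- exact/adjacentC/F.
- exact: G.
- exact/adjacentC/G.
Qed.

Lemma face_adjb d c a b : (d <> m) \/ (c <> m) -> T d a c b ->
  adjacent h inf (black_seq h inf) d c.
Proof.
move=> ne; have ne' : c <> m \/ d <> m by case: ne; [right | left].
case/or4P => /(black_adj_face h4 h5)[F G].
- exact: F.
- exact: G.
- exact/adjacentC/F.
- exact/adjacentC/G.
Qed.

Lemma face_fin d a c b : T d a c b -> inf \/ [/\ a < m, c < m & b < m]%N.
Proof.
by move=> /or4P[]/(face0_bound h4 h5)[_ [[[? ? ? ?] _]|[]|[]]]; try (by left); right.
Qed.

Definition family_quad := scheme_quad m inf (fun i j => sub j i) T.

Lemma family_quadrangulation :
  exists rw qw rb qb, quadrangulation n family_quad rw qw rb qb.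
Proof.
have m2 : (2 < m)%N by lia.
have al i d : (i < m)%N -> (d < m)%N -> (add i d < m)%N by rewrite /addm => *; ifs.
have sl i d : (i < m)%N -> (d < m)%N -> (sub i d < m)%N by rewrite /subm => *; ifs.
have [qw Rw] : exists q, rotation n (scheme_quad m inf (fun i j => sub j i) T)
    (spin m add (white_seq h inf)) q.
  apply: (@scheme_rotation m inf add sub (fun i j => sub j i) (balanced h)
    (white_seq h inf) (h + h - 1) (h + h) T) => //.
  - by move=> *; exact: sl.
  - by rewrite /addm /subm => *; ifs.
  - by rewrite /addm /subm => *; ifs.
  - by rewrite /subm => *; ifs.
  - by rewrite /subm => *; ifs.
  - by rewrite /subm => *; ifs.
  - by rewrite /balanced /addm /subm => *; ifs.
  - exact: white_seq_pos.
  - exact: white_seq_inj.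
  - exact: face_labels_swap.
  - exact: face_typew.
  - move=> t tk; have [c [b F]] := white_face h4 h5 tk.
    exists c, b; split=> //; case: (face_fin F) => [?|[_ cm _]]; last lia.
    by right; right.
  - exact: face_uniqw.
  - exact: face_adjw.
  - exact: face_infw.
  - by move=> i; rewrite /face_labels face_inf2 ?orbT.
  - by move=> _; split; lia.
  - by rewrite /subm /nxt => *; ifs.
  - by move=> _ i j j' im jm jm'; rewrite /subm /nxt; ifs.
  - by move=> _ j jm; rewrite /nxt; ifs.
(* For the black vertices [add] and [sub] change places and the middle labels of [T] are transposed.
   Advancing by one residue at black infinity lowers the label, whence the order [h + h - 1],
   [h + h - 2]. *)
have [qb Rb] : exists q, rotation n
    (scheme_quad m inf (fun j i => sub j i) (fun d c a b => T d a c b))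
    (spin m sub (black_seq h inf)) q.
  apply: (@scheme_rotation m inf sub add (fun j i => sub j i) (balanced h)
    (black_seq h inf) (h + h - 1) (h + h - 2) (fun d c a b => T d a c b)) => //.
  - by rewrite /subm => *; ifs.
  - by rewrite /subm => *; ifs.
  - by rewrite /addm /subm => *; ifs.
  - by rewrite /addm /subm => *; ifs.
  - by rewrite /subm => *; ifs.
  - by rewrite /balanced /addm /subm => *; ifs.
  - exact: black_seq_pos.
  - exact: black_seq_inj.
  - by move=> d c a b; exact: face_labels_flip.
  - exact: face_typeb.
  - move=> t tk; have [a [b F]] := black_face h4 h5 tk.
    exists a, b; split=> //; case: (face_fin F) => [?|[am _ _]]; last lia.
    by right; right.
  - by move=> d c a b a' b'; exact: face_uniqb.
  - by move=> d c a b; exact: face_adjb.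
  - by move=> a b /(face_infb h4 h5).
  - by move=> i; rewrite /face_labels face_inf1 ?orbT.
  - by move=> _; split; lia.
  - by rewrite /addm /subm /nxt => *; ifs.
  - by move=> _ j i i' jm im im'; rewrite /subm /nxt; ifs.
  - by move=> _ i im; rewrite /nxt; ifs.
exists (spin m add (white_seq h inf)), qw, (spin m sub (black_seq h inf)), qb; split.
- move=> i i' j j' /and4P[ni ni' nj /and4P[nj' ii jj F]].
  by rewrite /family_quad /scheme_quad ni ni' nj nj' eq_sym ii jj face_labels_flip.
- move=> i i' j j' /and4P[ni ni' nj /and4P[nj' ii jj F]].
  by rewrite /family_quad /scheme_quad ni ni' nj nj' ii eq_sym jj face_labels_swap.
- move=> i i' j j' /and4P[ni ni' nj /and4P[nj' ii jj F]].
  by split=> //; apply/eqP.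
- exact: Rw.
apply: rotation_ext Rb => j j' i i'; rewrite /family_quad /scheme_quad.
have labC x y : lab m (fun j i => sub j i) x y = lab m (fun i j => sub j i) y x.
  by rewrite /lab orbC.
rewrite !labC; case: (j < n)%N; case: (j' < n)%N; case: (i < n)%N; case: (i' < n)%N => //=.
by case: (j != j'); case: (i != i').
Qed.

End FamilyEmbedding.

(** The strips avoid infinity, so each serves for both values of [inf]; they return to their first
    edge with its ends exchanged. *)
Lemma family_nonorientable (R : realType) (h : nat) (inf : bool) : (3 < h)%N ->
  (odd h -> 4 < h)%N -> nonorientable R (@quad_space R (family_quad h inf)).
Proof.
move=> h4 h5; have [rw [qw [rb [qb QD]]]] := family_quadrangulation inf h4 h5.
have quad d a c b i i' j j' : face0 h inf d a c b ->
    [/\ i < h + h.+1, i' < h + h.+1, j < h + h.+1 & j' < h + h.+1]%N -> i != i' -> j != j' ->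
    [/\ subm h j i = d, subm h j' i = a, subm h j i' = c & subm h j' i' = b] ->
    family_quad h inf i i' j j'.
  rewrite addnS => F [im im' jm jm'] ii jj [e1 e2 e3 e4].
  rewrite /family_quad /scheme_quad ii jj /lab.
  have ne x : (x < (h + h).+1)%N -> (x == (h + h).+1) = false by lia.
  rewrite !ne//= e1 e2 e3 e4 /face_labels F !andbT.
  by do 3 (apply/andP; split; first by lia); lia.
case: (boolP (odd h)) => oh.
  have {}h5 := h5 oh.
  (* The residues in use are 0, ..., 4, h + 1, h + 2, 2h - 1 and 2h, renumbered 0, ..., 8. *)
  pose psi x := (if x <= 4 then x else if x <= 6 then x + h - 4 else x + (h + h) - 8)%N.
  apply: (@strip_check_nonorientable R _
    [:: (Wh 0, Bl 2); (Fc 0 7 1 2, Bl 2); (Wh 7, Bl 2); (Fc 7 5 2 3, Bl 2); (Wh 5, Bl 2);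
        (Fc 8 5 1 2, Bl 2); (Wh 8, Bl 2); (Wh 8, Fc 1 8 2 3); (Wh 8, Bl 3);
        (Fc 8 6 3 4, Bl 3); (Wh 6, Bl 3); (Fc 0 6 2 3, Bl 3); (Fc 0 6 2 3, Wh 0);
        (Bl 2, Wh 0)]
    [:: (0, 7, 1, 2); (7, 5, 2, 3); (8, 5, 1, 2); (1, 8, 2, 3); (8, 6, 3, 4);
        (0, 6, 2, 3)]%N psi).
  - by rewrite /psi => x y xy; ifs.
  - exact: quad_symw QD.
  - exact: quad_symb QD.
  - by vm_compute.
  have P1 : paired h inf 1 3 by rewrite /paired oh.
  have P2 : paired h inf 2 h.+1 by rewrite /paired oh /= eqxx.
  have P4 : paired h inf 4 h.+2 by rewrite /paired oh /= eqxx.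
  have F1 := face_of_pair P1; have F2 := face_of_pair P2; have F4 := face_of_pair P4.
  move=> a b c d; rewrite !inE => /or4P[/eqP|/eqP|/eqP|/or3P[]/eqP] [-> -> -> ->];
    [apply: (quad _ _ _ _ _ _ _ _ F1)|apply: (quad _ _ _ _ _ _ _ _ F4)|apply: (quad _ _ _ _ _ _ _ _ F2)|
     apply: (quad _ _ _ _ _ _ _ _ F1)|apply: (quad _ _ _ _ _ _ _ _ F4)|apply: (quad _ _ _ _ _ _ _ _ F2)] => //;
    clear -h4 h5; rewrite /psi /= ?/subm; try split; ifs.
(* Here the residues in use are 0, 1, 2 and h + 1, ..., h + 4. *)
pose psi x := (if x <= 2 then x else x + h - 2)%N.
apply: (@strip_check_nonorientable R _
  [:: (Wh 0, Bl 1); (Fc 0 4 1 3, Bl 1); (Wh 4, Bl 1); (Fc 5 4 0 1, Bl 1); (Wh 5, Bl 1);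
      (Wh 5, Fc 6 5 1 2); (Wh 5, Bl 2); (Fc 1 5 2 4, Bl 2); (Fc 1 5 2 4, Wh 1);
      (Bl 4, Wh 1); (Bl 4, Fc 3 1 4 5); (Bl 4, Wh 3); (Fc 3 2 4 1, Wh 3); (Bl 1, Wh 3);
      (Bl 1, Fc 0 3 1 2); (Bl 1, Wh 0)]
  [:: (0, 4, 1, 3); (5, 4, 0, 1); (6, 5, 1, 2); (1, 5, 2, 4); (3, 1, 4, 5);
      (3, 2, 4, 1); (0, 3, 1, 2)]%N psi).
- by rewrite /psi => x y xy; ifs.
- exact: quad_symw QD.
- exact: quad_symb QD.
- by vm_compute.
have P1 : paired h inf 1 h.+1 by rewrite /paired (negPf oh) eqxx.
have P2 : paired h inf (h - 2)%N (h - 2)%N.+1 by rewrite /paired (negPf oh); lia.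
have F1 := face_of_pair P1; have F2 := face_of_pair P2; have FJ := face_jump h inf.
move=> a b c d; rewrite !inE => /or4P[/eqP|/eqP|/eqP|/or4P[]/eqP] [-> -> -> ->];
  [apply: (quad _ _ _ _ _ _ _ _ FJ)|apply: (quad _ _ _ _ _ _ _ _ F2)|
   apply: (quad _ _ _ _ _ _ _ _ F2)|apply: (quad _ _ _ _ _ _ _ _ FJ)|
   apply: (quad _ _ _ _ _ _ _ _ F1)|apply: (quad _ _ _ _ _ _ _ _ FJ)|
   apply: (quad _ _ _ _ _ _ _ _ F1)] => //;
  clear -h4 oh; rewrite /psi /= ?/subm; try split; ifs.
Qed.

(** * Small orders by computation *)

Notation quad_name := (nat * nat * nat * nat)%type.

(* The faces are the translates of [ds], given by labels as in [Scheme], and of two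
   faces through the points at infinity. *)
Definition cyclic_faces m (ds : seq quad_name) (inf : option quad_name) : seq quad_name :=
  [seq (let: (d, a, c, b) := q in (g, (g + d + m - c) %% m, (g + d) %% m, (g + a) %% m)%N)
    | q <- ds, g <- iota 0 m] ++
  if inf is Some (b, b', w, w') then
    [seq ((g + m - b) %% m, (g + m - b') %% m, g, m)%N | g <- iota 0 m] ++
    [seq (g, m, (g + w) %% m, (g + w') %% m)%N | g <- iota 0 m]
  else [::].

Definition symmetric_faces (fs : seq quad_name) : seq quad_name :=
  flatten [seq (let: (a, b, c, d) := f in
    [:: (a, b, c, d); (b, a, c, d); (a, b, d, c); (b, a, d, c)]) | f <- fs].

Definition transpose (f : quad_name) : quad_name := let: (a, b, c, d) := f in (c, d, a, b).

(** A boolean form of the hypotheses of [rotation_of_unique] that are not symmetries, for a finite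
    list of faces. *)
Definition rotation_check n (fs : seq quad_name) (r : nat -> nat -> nat) :=
  let ts := iota 0 n.-1 in
  [&& all (fun i => all (fun t => [&& (r i t < n)%N, r i t != i,
        has (fun f : quad_name => let: (a, b, c, d) := f in
          [&& a == i, c == r i t & d == r i (nxt n.-1 t)]) fs &
        all (fun s => (r i s == r i t) ==> (s == t)) ts]) ts) (iota 0 n),
      all (fun f : quad_name => let: (a, b, c, d) := f in
        all (fun g : quad_name => let: (a', b', c', d') := g in
          [&& a == a', c == c' & d == d'] ==> (b == b')) fs) fs &
      all (fun f : quad_name => let: (a, b, c, d) := f in (a < n)%N &&
        has (fun t => (c == r a t) && (d == r a (nxt n.-1 t)) ||
                      (d == r a t) && (c == r a (nxt n.-1 t))) ts) fs].

Definition quad_check n (fs : seq quad_name) (rw rb : nat -> nat -> nat) :=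
  [&& all (fun f : quad_name => let: (a, b, c, d) := f in
        [&& (a < n)%N, (c < n)%N, a != b, c != d, (b, a, c, d) \in fs &
            (a, b, d, c) \in fs]) fs,
      rotation_check n fs rw & rotation_check n (map transpose fs) rb].

Lemma rotation_checkP n fs r :
  (forall a b c d, (a, b, c, d) \in fs -> (a, b, d, c) \in fs) ->
  rotation_check n fs r ->
  exists q, rotation n (fun i i' j j' => (i, i', j, j') \in fs) r q.
Proof.
move=> sym /and3P[/allP rc /allP uc /allP cc].
have io x k : (x < k)%N -> x \in iota 0 k by rewrite mem_iota.
have rt i t : (i < n)%N -> (t < n.-1)%N -> _ := fun ni nt => allP (rc i (io _ _ ni)) t (io _ _ nt).
apply: rotation_of_unique => //.
- by move=> i t ni nt; have /and4P[h1 /eqP h2 _ _] := rt _ _ ni nt.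
- move=> i s t ni ns nt e; have /and4P[_ _ _ /allP/(_ s (io _ _ ns))] := rt _ _ ni nt.
  by rewrite e eqxx => /eqP.
- move=> i t ni nt; have /and4P[_ _ /hasP[[[[a b] c] d] fin h] _] := rt _ _ ni nt.
  by case/and3P: h => /eqP e1 /eqP e2 /eqP e3; exists b; rewrite -e3 -e2 -e1.
- move=> i i' i'' j j' f1 f2; have /allP/(_ _ f2) := uc _ f1.
  by rewrite !eqxx => /eqP.
- move=> i i' j j' f1; have /andP[ni /hasP[t + h]] := cc _ f1.
  rewrite mem_iota => nt; split=> //; exists t; first by lia.
  by case/orP: h => /andP[/eqP-> /eqP->]; [left | right].
Qed.

Lemma quad_checkP n fs rw rb : quad_check n fs rw rb -> exists qw qb,
  quadrangulation n (fun i i' j j' => (i, i', j, j') \in fs) rw qw rb qb.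
Proof.
case/and3P => /allP fc wc bc.
have symw a b c d : (a, b, c, d) \in fs -> (b, a, c, d) \in fs.
  by move=> /fc /and5P[_ _ _ _ /andP[]].
have symb a b c d : (a, b, c, d) \in fs -> (a, b, d, c) \in fs.
  by move=> /fc /and5P[_ _ _ _ /andP[]].
have trK : involutive transpose by move=> [[[? ?] ?] ?].
have tr f : (f \in map transpose fs) = (transpose f \in fs).
  by rewrite -{1}(trK f) mem_map//; exact: inv_inj.
have [qw Rw] := rotation_checkP symb wc.
have [|qb Rb] := rotation_checkP _ bc; first by move=> a b c d; rewrite !tr; exact: symw.
exists qw, qb; split=> //.
- by move=> a b c d /fc /and5P[? ? /eqP ? /eqP ? _].
- by apply: rotation_ext Rb => j j' i i'; rewrite tr.
Qed.

Lemma quad_check_embedding (R : realType) n fs (rw rb : seq (seq nat)) s : (3 < n)%N ->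
  quad_check n (symmetric_faces fs) (fun i => nth 0%N (nth [::] rw i))
    (fun j => nth 0%N (nth [::] rb j)) ->
  strip_check s fs -> has_nonorientable_quadrangular_embedding R (G n n n).
Proof.
move=> n4 /quad_checkP[qw [qb QD]] sc.
apply: (quadrangulation_embedding n4 QD); apply: (@strip_check_nonorientable R _ s fs id) => //.
- exact: quad_symw QD.
- exact: quad_symb QD.
- move=> a b c d fin; apply/flatten_mapP; exists (a, b, c, d) => //.
  by rewrite inE eqxx.
Qed.

(** The families need [h] at least 4: for [h = 3], say, the pair 1, 3 would use [3, 4], which is no
    corner of the white rotation. The 15 faces here are one orbit modulo 5 and two orbits through
    infinity. *)
Lemma embedding6 (R : realType) : has_nonorientable_quadrangular_embedding R (G 6 6 6).
Proof.
apply: (@quad_check_embedding R 6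
  (cyclic_faces 5 [:: (2, 3, 1, 2)]%N (Some (1, 4, 4, 3)%N))
  [:: [:: 1; 2; 3; 4; 5]; [:: 0; 5; 2; 3; 4]; [:: 0; 4; 3; 5; 1]; [:: 0; 4; 5; 2; 1];
  [:: 0; 1; 2; 3; 5]; [:: 0; 4; 3; 2; 1]]%N
  [:: [:: 1; 4; 3; 2; 5]; [:: 0; 4; 3; 5; 2]; [:: 0; 1; 3; 5; 4]; [:: 0; 1; 2; 4; 5];
  [:: 0; 5; 1; 2; 3]; [:: 0; 2; 4; 1; 3]]%N
  [:: (Wh 0, Bl 2); (Wh 0, Fc 0 1 2 3); (Wh 0, Bl 3); (Fc 0 5 4 3, Bl 3); (Wh 5, Bl
  3); (Fc 4 5 3 2, Bl 3); (Fc 4 5 3 2, Wh 4); (Bl 2, Wh 4); (Bl 2, Fc 4 0 1 2); (Bl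
  2, Wh 0)]) => //;
  by vm_compute.
Qed.

Lemma embedding7 (R : realType) : has_nonorientable_quadrangular_embedding R (G 7 7 7).
Proof.
apply: (@quad_check_embedding R 7
  (cyclic_faces 7 [:: (4, 6, 6, 1); (5, 1, 2, 5); (3, 4, 2, 3)]%N None)
  [:: [:: 1; 6; 4; 3; 2; 5]; [:: 0; 5; 4; 3; 6; 2]; [:: 0; 3; 1; 6; 5; 4]; [:: 0; 2;
  4; 1; 5; 6]; [:: 0; 6; 2; 5; 3; 1]; [:: 0; 3; 6; 4; 2; 1]; [:: 0; 5; 3; 2; 1; 4]]%N
  [:: [:: 1; 6; 2; 5; 4; 3]; [:: 0; 2; 4; 5; 6; 3]; [:: 0; 4; 1; 3; 5; 6]; [:: 0; 1;
  5; 2; 4; 6]; [:: 0; 5; 3; 6; 2; 1]; [:: 0; 3; 2; 1; 6; 4]; [:: 0; 5; 1; 4; 3; 2]]%N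
  [:: (Wh 0, Bl 1); (Fc 2 0 6 1, Bl 1); (Fc 2 0 6 1, Wh 2); (Bl 6, Wh 2); (Fc 2 3 5
  6, Wh 2); (Fc 2 3 5 6, Bl 5); (Wh 3, Bl 5); (Fc 0 3 5 1, Bl 5); (Fc 0 3 5 1, Wh 0);
  (Bl 1, Wh 0)]) => //;
  by vm_compute.
Qed.

Lemma embedding8 (R : realType) : has_nonorientable_quadrangular_embedding R (G 8 8 8).
Proof.
apply: (@quad_check_embedding R 8
  (cyclic_faces 7 [:: (5, 1, 2, 5); (4, 6, 6, 1)]%N (Some (3, 4, 2, 3)%N))
  [:: [:: 1; 5; 2; 3; 7; 4; 6]; [:: 0; 5; 7; 4; 3; 6; 2]; [:: 0; 3; 1; 6; 7; 5; 4];
  [:: 0; 2; 4; 1; 5; 6; 7]; [:: 0; 7; 1; 3; 5; 2; 6]; [:: 0; 3; 6; 4; 2; 7; 1]; [::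
  0; 4; 1; 2; 7; 3; 5]; [:: 0; 6; 5; 4; 3; 2; 1]]%N
  [:: [:: 1; 6; 2; 5; 7; 4; 3]; [:: 0; 3; 6; 7; 5; 4; 2]; [:: 0; 4; 1; 3; 5; 6; 7];
  [:: 0; 7; 1; 5; 2; 4; 6]; [:: 0; 5; 3; 6; 2; 7; 1]; [:: 0; 3; 7; 2; 1; 6; 4]; [::
  0; 5; 1; 4; 7; 3; 2]; [:: 0; 6; 5; 4; 3; 2; 1]]%N
  [:: (Wh 0, Bl 1); (Fc 0 3 5 1, Bl 1); (Wh 3, Bl 1); (Wh 3, Fc 3 6 1 4); (Wh 3, Bl
  4); (Fc 5 3 2 4, Bl 4); (Wh 5, Bl 4); (Fc 0 5 4 6, Bl 4); (Fc 0 5 4 6, Wh 0); (Bl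
  6, Wh 0); (Fc 2 0 6 1, Wh 0); (Bl 1, Wh 0)]) => //;
  by vm_compute.
Qed.

Theorem theorem2 (R : realType) (n : nat) (hn : (6 <= n)%N) :
  has_nonorientable_quadrangular_embedding R (G n n n).
Proof.
have [->|n6] := eqVneq n 6%N; first exact: embedding6.
have [->|n7] := eqVneq n 7%N; first exact: embedding7.
have [->|n8] := eqVneq n 8%N; first exact: embedding8.
(* Now [n] is at least 9. Infinity is adjoined exactly when [n] is even, to make up for the rounding
   in [h]. *)
pose h := n.-1./2; have h4 : (3 < h)%N by rewrite /h; lia.
have h5 : odd h -> (4 < h)%N by lia.
have [rw [qw [rb [qb QD]]]] := family_quadrangulation (~~ odd n) h4 h5.
have nE : n = ((h + h).+1 + ~~ odd n)%N by rewrite /h; case: (boolP (odd n)) => /=; lia.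
have n4 : (3 < (h + h).+1 + ~~ odd n)%N by rewrite -nE; lia.
have := quadrangulation_embedding n4 QD (family_nonorientable R (~~ odd n) h4 h5).
by rewrite -nE.
Qed.
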